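(* Let $\lambda\in(0,\infty)$ and suppose that the random variable $\alpha$ with values in $(0,1)$ has a probability density of the form $\psi(x)(1-x)^{\beta}$, $x\in(0,1)$, where $\psi$ is a function on $(0,1)$ having a limit $\lim_{x\uparrow 1}\psi(x)=\psi_1\in(0,\infty)$. Let $\widetilde S^{(N,n)}$ be the doubly aggregated, conditionally centered partial sum process of independent copies of the randomized INAR(1) process with Poisson innovations (defined in the context). If $\beta\in(-1,0)$, then $$\mathcal D_{\mathrm f}\text{-}\lim_{n\to\infty}\ \mathcal D_{\mathrm f}\text{-}\lim_{N\to\infty}\ n^{-1}N^{-\frac{1}{2(1+\beta)}}\,\widetilde S^{(N,n)}=(V_{2(1+\beta)}\,t)_{t\in[0,\infty)},$$ where $V_{2(1+\beta)}$ is a symmetric $2(1+\beta)$-stable random variable (not depending on $t$) with characteristic function $$\mathbb E(e^{i\theta V_{2(1+\beta)}})=e^{-K_\beta|\theta|^{2(1+\beta)}},\quad\theta\in\mathbb R,\qquad K_\beta:=\psi_1\left(\frac{\lambda}{2}\right)^{1+\beta}\frac{\Gamma(-\beta)}{1+\beta}.$$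
   Context: Randomized INAR(1) process: let $\lambda\in(0,\infty)$ and let $\alpha$ be a random variable with values in $(0,1)$. Let $X_0$, $\xi_{k,j}$, $\varepsilon_k$ ($k,j\in\mathbb N=\{1,2,\dots\}$) be random variables which are conditionally independent given $\alpha$ and such that, conditionally on $\alpha$, each $\xi_{k,j}$ is Bernoulli with $\mathbb P(\xi_{k,j}=1\mid\alpha)=\alpha=1-\mathbb P(\xi_{k,j}=0\mid\alpha)$, each $\varepsilon_k$ is Poisson with parameter $\lambda$, and $X_0$ is Poisson with parameter $\lambda/(1-\alpha)$. Define $X_k=\sum_{j=1}^{X_{k-1}}\xi_{k,j}+\varepsilon_k$, $k\in\mathbb N$ (with $\sum_{j=1}^0:=0$). Let $(\alpha^{(j)},(X^{(j)}_k)_{k\in\mathbb Z_+})$, $j\in\mathbb N$, be independent copies of $(\alpha,(X_k)_{k\in\mathbb Z_+})$, where $\mathbb Z_+=\{0,1,2,\dots\}$. Conditional expectations are in the generalized sense, and $\mathbb E(X_k\mid\alpha)=\lambda/(1-\alpha)$. For $N,n\in\mathbb N$ set $\widetilde S^{(N,n)}_t:=\sum_{j=1}^N\sum_{k=1}^{\lfloor nt\rfloor}\bigl(X^{(j)}_k-\mathbb E(X^{(j)}_k\mid\alpha^{(j)})\bigr)=\sum_{j=1}^N\sum_{k=1}^{\lfloor nt\rfloor}\bigl(X^{(j)}_k-\frac{\lambda}{1-\alpha^{(j)}}\bigr)$, $t\in[0,\infty)$. $\mathcal D_{\mathrm f}\text{-}\lim$ denotes weak convergence of finite dimensional distributions.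 An iterated limit $\mathcal D_{\mathrm f}\text{-}\lim_{n\to\infty}\mathcal D_{\mathrm f}\text{-}\lim_{N\to\infty}$ means: for each fixed $n$ the limit in finite dimensional distributions as $N\to\infty$ exists, and then these limit processes converge in finite dimensional distributions as $n\to\infty$ to the stated process. *)

(* Defs.v *)
From HB Require Import structures.
From mathcomp Require Import all_boot all_order all_algebra.
From mathcomp Require Import complex.
From mathcomp Require Import all_classical all_reals all_analysis.

Set Implicit Arguments.
Unset Strict Implicit.
Unset Printing Implicit Defensive.

Import Order.TTheory GRing.Theory Num.Theory.
Import numFieldNormedType.Exports.

Local Open Scope classical_set_scope.
Local Open Scope ring_scope.

Section conditioning.
Context d (T : measurableType d) (R : realType) (P : probability T R).

(* [m] is a version of the conditional expectation of the nonnegative [Y] given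
   the sigma-algebra generated by [alpha].  The generalized sense: the defining
   identity holds in the extended reals and [Y] need not be integrable.  Only
   finite-valued versions are considered. *)
Definition cond_expectation (alpha Y m : T -> R) : Prop :=
  measurable_fun [set: g_sigma_algebra_preimageType alpha] m /\
  forall A, g_sigma_algebra_preimage alpha A ->
    (\int[P]_(w in A) (Y w)%:E = \int[P]_(w in A) (m w)%:E)%E.

Definition cond_probability (alpha : T -> R) (E : set T) (p : T -> R) : Prop :=
  cond_expectation alpha \1_E p.

(* Versions of conditional probabilities are almost surely unique, so the
   quantification over all versions [p] does not depend on their choice. *)
Definition cond_independent d' (U : measurableType d') (I : eqType)
    (alpha : T -> R) (Y : I -> {RV P >-> U}) : Prop :=
  forall (s : seq I) (B : I -> set U) (p : I -> T -> R), uniq s ->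
    (forall i, i \in s -> measurable (B i)) ->
    (forall i, i \in s -> cond_probability alpha (Y i @^-1` B i) (p i)) ->
  cond_probability alpha (\bigcap_(i in [set` s]) (Y i @^-1` B i))
    (fun w => \prod_(i <- s) p i w).

Definition has_density_on (X : {RV P >-> R}) (D : set R) (f : R -> R) : Prop :=
  [/\ measurable_fun D f, forall x, D x -> 0 <= f x &
   forall B : set R, measurable B ->
     P (X @^-1` B) = (\int[lebesgue_measure]_(x in B `&` D) (f x)%:E)%E].

(* E cos(theta V) + i E sin(theta V) = E exp(i theta V) *)
Definition char_fun (V : {RV P >-> R}) (theta : R) : R[i] :=
  Complex (\int[P]_w cos (theta * V w)) (\int[P]_w sin (theta * V w)).

(* symmetric [a]-stable with scale constant [K], i.e. scale K^(1/a) *)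
Definition symmetric_stable (a K : R) (V : {RV P >-> R}) : Prop :=
  forall theta : R,
    char_fun V theta = Complex (expR (- (K * `|theta| `^ a))) 0.

End conditioning.

Definition Gamma (R : realType) (z : R) : R :=
  \int[lebesgue_measure]_(x in `]0, +oo[) (x `^ (z - 1) * expR (- x)).

Section INAR1.
Context d (T : measurableType d) (R : realType) (P : probability T R).

(* [xi k j] and [eps k] stand for xi_{k+1,j+1} and eps_{k+1}. *)
Definition INAR1_inputs (X0 : {RV P >-> nat})
    (xi : nat -> nat -> {RV P >-> nat}) (eps : nat -> {RV P >-> nat})
    (i : unit + nat * nat + nat) : {RV P >-> nat} :=
  match i with
  | inl (inl _) => X0
  | inl (inr kj) => xi kj.1 kj.2
  | inr k => eps k
  end.

Definition randomized_INAR1 (lambda : R) (alpha : {RV P >-> R})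
    (X : nat -> {RV P >-> nat}) : Prop :=
  exists (xi : nat -> nat -> {RV P >-> nat}) (eps : nat -> {RV P >-> nat}),
    (forall w, 0 < alpha w < 1) /\
    cond_independent alpha (INAR1_inputs (X 0%N) xi eps) /\
    (forall k j,
      cond_probability P alpha (xi k j @^-1` [set 1%N]) alpha /\
      cond_probability P alpha (xi k j @^-1` [set 0%N])
        (fun w => 1 - alpha w)) /\
    (forall k m,
      cond_probability P alpha (eps k @^-1` [set m])
        (fun=> poisson_pmf lambda m)) /\
    (forall m,
      cond_probability P alpha (X 0%N @^-1` [set m])
        (fun w => poisson_pmf (lambda / (1 - alpha w)) m)) /\
    (forall k w,
      X k.+1 w = (\sum_(j < X k w) xi k j w + eps k w)%N).

End INAR1.

Section copies.
Context (R : realType).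

Definition pair_path (T : Type) (alpha : T -> R) (X : nat -> T -> nat) (w : T) :
  R * (nat -> nat) := (alpha w, fun k => X k w).

(* product sigma-algebra on R x nat^nat *)
Definition cylinder_sigma : set (set (R * (nat -> nat))) :=
  <<s [set C | exists2 B : set R, measurable B & C = [set x | B x.1]] `|`
      [set C | exists (k : nat) (B : set nat), C = [set x | B (x.2 k)]] >>.

Definition independent_copies
    d (T : measurableType d) (P : probability T R)
    (alpha : {RV P >-> R}) (X : nat -> {RV P >-> nat})
    d' (T' : measurableType d') (P' : probability T' R)
    (alpha' : nat -> {RV P' >-> R}) (X' : nat -> nat -> {RV P' >-> nat}) : Prop :=
  (forall j C, cylinder_sigma C ->
     P' (pair_path (alpha' j) (X' j) @^-1` C) = P (pair_path alpha X @^-1` C)) /\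
  (forall (s : seq nat) (C : nat -> set (R * (nat -> nat))), uniq s ->
     (forall j, cylinder_sigma (C j)) ->
     P' (\bigcap_(j in [set` s]) (pair_path (alpha' j) (X' j) @^-1` C j)) =
     (\prod_(j <- s) P' (pair_path (alpha' j) (X' j) @^-1` C j))%E).

End copies.

Section finite_dimensional_convergence.
Context (R : realType).

(* Processes are indexed by [0, +oo[; the value at negative times is ignored. *)
Definition fdd_cvg
    (d : nat -> measure_display) (T : forall n, measurableType (d n))
    (P : forall n, probability (T n) R) (X : forall n, R -> T n -> R)
    d' (T' : measurableType d') (Q : probability T' R) (Y : R -> T' -> R) : Prop :=
  forall (m : nat) (t : 'I_m -> R), (forall i, 0 <= t i) ->
  forall f : 'rV[R]_m -> R, continuous f -> (exists M, forall x, `|f x| <= M) ->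
    ('E_(P n)[fun w => f (\row_i X n (t i) w)] @[n --> \oo]
      --> 'E_Q[fun w => f (\row_i Y (t i) w)])%E.

(* Iterated limit: first N --> oo for each n >= 1, then n --> oo *)
Definition iterated_fdd_lim
    d (T : measurableType d) (P : probability T R) (Z : nat -> nat -> R -> T -> R)
    d' (T' : measurableType d') (Q : probability T' R) (L : R -> T' -> R) : Prop :=
  exists (dY : nat -> measure_display) (TY : forall n, measurableType (dY n))
    (PY : forall n, probability (TY n) R) (Y : forall n, R -> {RV (PY n) >-> R}),
    (forall n, (0 < n)%N ->
      fdd_cvg (fun=> P) (fun N t => Z n N t) (PY n) (fun t => Y n t)) /\
    fdd_cvg PY (fun n t => Y n t) Q L.

End finite_dimensional_convergence.

(* The index j : 'I_N counts copies from 0; [M j k] is the conditional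
   expectation of [X j k] given the j-th copy of alpha. *)
Definition aggregated_sum (R : realType) (T : Type) (X : nat -> nat -> T -> nat)
    (M : nat -> nat -> T -> R) (n N : nat) (t : R) (w : T) : R :=
  \sum_(j < N) \sum_(1 <= k < (Num.truncn (n%:R * t)).+1)
    ((X j k w)%:R - M j k w).

(* Main.v *)
Require Import Defs.
From HB Require Import structures.
From mathcomp Require Import all_boot all_order all_algebra.
From mathcomp Require Import all_classical all_reals all_analysis.
From mathcomp Require Import measurable_realfun complex ring lra.

Set Implicit Arguments.
Unset Strict Implicit.
Unset Printing Implicit Defensive.

Import Order.TTheory GRing.Theory Num.Theory.
Import numFieldNormedType.Exports.

Local Open Scope classical_set_scope.
Local Open Scope ring_scope.

Section bounded_expectation.
Context d (T : measurableType d) (R : realType) (P : probability T R).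
Implicit Types (f g : T -> R) (M : R).

Lemma bounded_integrable f M : measurable_fun setT f ->
  (forall x, `|f x| <= M) -> P.-integrable setT (EFin \o f).
Proof.
move=> mf fM; apply: measurable_bounded_integrable => //.
- by apply: (le_lt_trans (probability_le1 P _)) => //; rewrite ltry.
- exists M; split; first by rewrite num_real.
  by move=> y My x _; exact: le_trans (fM x) (ltW My).
Qed.

Lemma expectation_Rintegral f : P.-integrable setT (EFin \o f) ->
  'E_P[f]%E = (\int[P]_x f x)%:E.
Proof.
by move=> fi; rewrite expectation.unlock /Rintegral fineK// integrable_fin_num.
Qed.

Lemma le_Rintegral_bounded f M : measurable_fun setT f ->
  (forall x, `|f x| <= M) -> `|\int[P]_x f x| <= M.
Proof.
move=> mf fM; have fi := bounded_integrable mf fM.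
apply: (le_trans (le_normr_Rintegral measurableT fi)).
apply: (@le_trans _ _ (\int[P]_x M)).
  apply: le_Rintegral => //.
  - by apply: (@bounded_integrable _ M) => [|x]; [exact: measurableT_comp|rewrite normr_id].
  - exact: (@bounded_integrable _ `|M|).
by rewrite Rintegral_cst// (congr1 fine (probability_setT P)) mulr1.
Qed.

(** Bounded convergence for real-valued integrals over a probability. *)
Lemma bounded_cvg (f_ : nat -> T -> R) f M :
  (forall n, measurable_fun setT (f_ n)) -> measurable_fun setT f ->
  (forall n x, `|f_ n x| <= M) -> {ae P, forall x, f_ n x @[n --> \oo] --> f x} ->
  \int[P]_x f_ n x @[n --> \oo] --> \int[P]_x f x.
Proof.
move=> mf_ mf fM cf.
have [] := @dominated_convergence _ _ _ P setT measurableT (fun n => EFin \o f_ n) (EFin \o f) (cst M%:E).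
- by move=> n; exact/measurable_EFinP.
- exact/measurable_EFinP.
- by apply: filterS cf => x cx _; apply: cvg_EFin => //; apply: nearW.
- by apply: (@bounded_integrable _ `|M|).
- by apply: aeW => x n _ /=; rewrite lee_fin.
move=> fi _; rewrite -[X in _ --> X]fineK ?integrable_fin_num//.
by move/fine_cvg.
Qed.

End bounded_expectation.

Lemma FTC2_everywhere (R : realType) (f F : R -> R) (a b : R) : a < b ->
  continuous f -> (forall x : R, is_derive x 1 F (f x)) ->
  (\int[lebesgue_measure]_(x in `[a, b]) (f x)%:E = (F b - F a)%:E)%E.
Proof.
move=> ab cf dF.
have cF : continuous F.
  by move=> x; apply: differentiable_continuous; apply/derivable1_diffP; exact: ex_derive.
rewrite (@continuous_FTC2 _ f F a b)//.
- exact: continuous_subspaceT.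
- split; first by move=> x _; exact: ex_derive.
  + exact/cvg_at_right_filter/cF.
  + exact/cvg_at_left_filter/cF.
- by move=> x _; rewrite derive1E; exact: derive_val.
Qed.

Lemma measurable_cos_comp (R : realType) d (T : measurableType d) (D : set T)
  (f : T -> R) : measurable_fun D f -> measurable_fun D (fun x => cos (f x)).
Proof.
move=> mf; have := measurableT_comp (continuous_measurable_fun (@continuous_cos R)) mf.
exact.
Qed.

Lemma measurable_sin_comp (R : realType) d (T : measurableType d) (D : set T)
  (f : T -> R) : measurable_fun D f -> measurable_fun D (fun x => sin (f x)).
Proof.
move=> mf; have := measurableT_comp (continuous_measurable_fun (@continuous_sin R)) mf.
exact.
Qed.

Lemma measurable_continuous_comp (R : realType) d (T : measurableType d) (D : set T)
  (g : R -> R) (f : T -> R) : continuous g -> measurable_fun D f ->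
  measurable_fun D (fun x => g (f x)).
Proof.
by move=> cg mf; have := measurableT_comp (continuous_measurable_fun cg) mf; exact.
Qed.

Definition RV_of d (T : measurableType d) d' (U : measurableType d') (R : realType)
  (P : probability T R) (f : T -> U) (mf : measurable_fun setT f) : {RV P >-> U} :=
  HB.pack_for {mfun T >-> U} f (isMeasurableFun.Build d d' T U f mf).

Section bounded_measurable.
Context d (T : measurableType d) (R : realType) (P : probability T R).
Implicit Types f g : T -> R.

Definition bounded_measurable f :=
  measurable_fun setT f /\ exists M : R, forall w, `|f w| <= M.

Lemma bounded_measurable_integrable f :
  bounded_measurable f -> P.-integrable setT (EFin \o f).
Proof. by move=> [mf [M fM]]; exact: (bounded_integrable _ mf fM). Qed.

Lemma bounded_measurableD f g : bounded_measurable f -> bounded_measurable g ->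
  bounded_measurable (fun w => f w + g w).
Proof.
move=> [mf [M fM]] [mg [N gN]]; split; first exact: measurable_funD.
by exists (M + N) => w; rewrite (le_trans (ler_normD _ _))// lerD.
Qed.

Lemma bounded_measurableM f g : bounded_measurable f -> bounded_measurable g ->
  bounded_measurable (fun w => f w * g w).
Proof.
move=> [mf [M fM]] [mg [N gN]]; split; first exact: measurable_funM.
by exists (M * N) => w; rewrite normrM ler_pM.
Qed.

Lemma bounded_measurable_cst (c : R) : bounded_measurable (fun=> c).
Proof. by split => //; exists `|c|. Qed.

Lemma bounded_measurable_indic (A : set T) :
  measurable A -> bounded_measurable (\1_A : T -> R).
Proof.
move=> mA; split; first exact: measurable_indic.
by exists 1 => w; rewrite indicE; case: (_ \in _); rewrite ?normr1 ?normr0.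
Qed.

Lemma bounded_measurable_cos f : measurable_fun setT f ->
  bounded_measurable (fun w => cos (f w)).
Proof. by move=> mf; split; [exact: measurable_cos_comp|exists 1 => w; exact: cos_max]. Qed.

Lemma bounded_measurable_sin f : measurable_fun setT f ->
  bounded_measurable (fun w => sin (f w)).
Proof. by move=> mf; split; [exact: measurable_sin_comp|exists 1 => w; exact: sin_max]. Qed.

Lemma bounded_RintegralD f g : bounded_measurable f -> bounded_measurable g ->
  \int[P]_w (f w + g w) = \int[P]_w f w + \int[P]_w g w.
Proof.
by move=> bf bg; apply: RintegralD => //; exact: bounded_measurable_integrable.
Qed.

Lemma bounded_Rintegral_lin (a b : R) f g : bounded_measurable f -> bounded_measurable g ->
  \int[P]_w (a * f w + b * g w) = a * \int[P]_w f w + b * \int[P]_w g w.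
Proof.
move=> bf bg; have bc (c : R) := bounded_measurable_cst c.
rewrite bounded_RintegralD; [|exact: bounded_measurableM|exact: bounded_measurableM].
by rewrite !RintegralZl//; exact: bounded_measurable_integrable.
Qed.

Lemma bounded_RintegralB f g : bounded_measurable f -> bounded_measurable g ->
  \int[P]_w (f w - g w) = \int[P]_w f w - \int[P]_w g w.
Proof.
by move=> bf bg; apply: RintegralB => //; exact: bounded_measurable_integrable.
Qed.

Lemma Rintegral_probability_cst (c : R) : \int[P]_w c = c.
Proof. by rewrite Rintegral_cst// (congr1 fine (probability_setT P)) mulr1. Qed.

Lemma EFin_Rintegral f : bounded_measurable f ->
  (\int[P]_w (f w)%:E)%E = (\int[P]_w f w)%:E.
Proof.
by move=> bf; rewrite /Rintegral fineK// integrable_fin_num//; exact: bounded_measurable_integrable.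
Qed.

Lemma bounded_measurable_sum (I : Type) (s : seq I) (g : I -> T -> R) :
  (forall i, bounded_measurable (g i)) -> bounded_measurable (fun w => \sum_(i <- s) g i w).
Proof.
move=> bg; elim: s => [|i s ih].
  by under eq_fun do rewrite big_nil; exact: bounded_measurable_cst.
by under eq_fun do rewrite big_cons; exact: bounded_measurableD.
Qed.

Lemma bounded_Rintegral_sum (I : Type) (s : seq I) (g : I -> T -> R) :
  (forall i, bounded_measurable (g i)) ->
  \int[P]_w (\sum_(i <- s) g i w) = \sum_(i <- s) \int[P]_w g i w.
Proof.
move=> bg; elim: s => [|i s ih].
  by under eq_Rintegral do rewrite big_nil; rewrite big_nil Rintegral_probability_cst.
under eq_Rintegral do rewrite big_cons.
by rewrite big_cons bounded_RintegralD ?ih//; exact: bounded_measurable_sum.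
Qed.

Lemma measurable_norm_gt f (r : R) : measurable_fun setT f ->
  measurable [set w | r < `|f w|].
Proof.
move=> mf; have h : measurable_fun setT (fun w => `|f w|) by exact: measurableT_comp.
have -> : [set w | r < `|f w|] = (fun w => `|f w|) @^-1` `]r, +oo[%classic.
  by apply/seteqP; split => w; rewrite /preimage/= in_itv/= andbT.
by rewrite -[X in measurable X]setTI; apply: h => //; exact: measurable_itv.
Qed.

End bounded_measurable.

Lemma compact_unif_continuous (R : realType) (X : pseudoMetricType R)
  (K : set X) (f : X -> R) (e : R) : compact K -> continuous f -> 0 < e ->
  exists2 r : R, 0 < r & forall x y, K x -> ball x r y -> `|f y - f x| < e.
Proof.
move=> /compact_near_coveringP cK cf e0.
have h : forall x, K x -> \forall x' \near x & r \near 0^'+, forall y, ball x' r y -> `|f y - f x'| < e.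
  move=> x Kx; have := cf x => /cvgrPdist_lt/(_ (e / 2)); rewrite divr_gt0// => /(_ isT).
  move=> /nbhs_ballP[r /= r0 xr].
  exists (ball x (r / 2), [set s | s < r / 2]) => /=.
    split; first by apply: nbhsx_ballx; rewrite divr_gt0.
    by apply: nbhs_right_lt; rewrite divr_gt0.
  move=> [x' s] /= [xx' sr] y x'y.
  have fx' : `|f x - f x'| < e / 2 by apply: xr; apply: le_ball xx'; rewrite ler_pdivrMr// ler_peMr ?ltW// ltr1n.
  have fy : `|f x - f y| < e / 2.
    apply: xr; rewrite (splitr r); apply: ball_triangle xx' _.
    by apply: le_ball x'y; exact: ltW.
  rewrite (_ : f y - f x' = (f x - f x') - (f x - f y)); last by ring.
  by rewrite (le_lt_trans (ler_normB _ _))// (splitr e) ltrD.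
have [r /= r0 hr] := @cK _ (0^'+) (fun r x => forall y, ball x r y -> `|f y - f x| < e) _ h.
exists (r / 2); first by rewrite divr_gt0.
move=> x y Kx xy; apply: (hr (r / 2)) => //=.
  by rewrite sub0r normrN gtr0_norm ?divr_gt0// ltr_pdivrMr// ltr_pMr// ltr1n.
by rewrite divr_gt0.
Unshelve. all: by end_near. Qed.

Section Rfubini.
Context d (T : measurableType d) d' (T' : measurableType d') (R : realType).
Variables (P : probability T R) (Q : probability T' R) (f : T -> T' -> R) (M : R).
Hypothesis mf : measurable_fun setT (fun z : T * T' => f z.1 z.2).
Hypothesis fM : forall x y, `|f x y| <= M.

Lemma bounded_fubini :
  \int[P]_x (\int[Q]_y f x y) = \int[Q]_y (\int[P]_x f x y).
Proof.
have mx x : measurable_fun setT (f x).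
  by have := measurableT_comp mf (pair1_measurable x).
have my y : measurable_fun setT (f ^~ y).
  by have := measurableT_comp mf (pair2_measurable y).
rewrite /Rintegral; congr fine.
transitivity (\int[P]_x \int[Q]_y (f x y)%:E)%E.
  apply: eq_integral => x _; rewrite -[RHS]fineK//.
  by apply: integrable_fin_num => //; exact: bounded_integrable (mx x) (fM x).
rewrite (@Fubini _ _ _ _ _ P Q (fun z => (f z.1 z.2)%:E)).
  apply: eq_integral => x _; rewrite -[LHS]fineK//.
  by apply: integrable_fin_num => //; exact: bounded_integrable (my x) (fM ^~ x).
exact: (@bounded_integrable _ _ _ (P \x Q)%E (fun z => f z.1 z.2) M).
Qed.

Lemma bounded_fubini_measurable : measurable_fun setT (fun x => \int[Q]_y f x y).
Proof.
apply: (measurableT_comp (fine_measurable measurableT)).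
apply: (@measurable_fubini_F _ _ _ _ _ P Q (fun z => (f z.1 z.2)%:E)).
exact: (@bounded_integrable _ _ _ (P \x Q)%E (fun z => f z.1 z.2) M).
Qed.
End Rfubini.

Lemma Rintegral_uniform_le (R : realType) (a b : R) (ab : a < b) (g : R -> R) (c : R) :
  measurable_fun setT g -> (forall t, 0 <= g t) ->
  (forall t, a <= t <= b -> g t <= c) -> \int[uniform_prob ab]_t g t <= c.
Proof.
move=> mg g0 gc; rewrite /Rintegral integral_uniform; last 2 first.
- exact/measurable_EFinP.
- by move=> t; rewrite lee_fin.
have ba : 0 < b - a by rewrite subr_gt0.
have : (\int[lebesgue_measure]_(x in `[a, b]) (g x)%:E <= (c * (b - a))%:E)%E.
  apply: (@le_trans _ _ (\int[lebesgue_measure]_(x in `[a, b]) c%:E)%E).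
    apply: ge0_le_integral => //=.
    + by move=> x _; rewrite lee_fin.
    + exact/measurable_EFinP/measurable_funTS.
  by rewrite integral_cst//= lebesgue_measure_itv/= lte_fin ab -EFinD -EFinM.
move=> h.
rewrite -lee_fin fineK.
  apply: (@le_trans _ _ ((b - a)^-1%:E * (c * (b - a))%:E)%E).
    by apply: lee_wpmul2l => //; rewrite lee_fin invr_ge0 ltW.
  by rewrite -EFinM lee_fin mulrCA mulVf ?gt_eqF// mulr1.
rewrite fin_numM// ge0_fin_numE.
  by rewrite (le_lt_trans h)// ltry.
by apply: integral_ge0 => x _; rewrite lee_fin.
Qed.

Lemma Rintegral_indic d (T : measurableType d) (R : realType) (P : probability T R)
  (A : set T) : measurable A -> \int[P]_w (\1_A w) = fine (P A).
Proof. by move=> mA; rewrite /Rintegral integral_indic// setIT. Qed.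

Section tightness.
Context d (T : measurableType d) (R : realType) (P : probability T R).

Lemma integral_1Bcos (delta : R) (d0 : 0 < delta) (x : R) : x != 0 ->
  \int[uniform_prob d0]_t (1 - cos (t * x)) = 1 - sin (delta * x) / (delta * x).
Proof.
move=> x0.
rewrite /Rintegral integral_uniform; last 2 first.
- apply/measurable_EFinP; apply: measurable_funB => //.
  by apply: continuous_measurable_fun => y; apply: continuous_comp; [apply: mulrr_continuous|exact: continuous_cos].
- by move=> t; rewrite lee_fin subr_ge0 cos_le1.
have cf : continuous (fun t : R => 1 - cos (t * x)).
  move=> t; apply: continuousB; first exact: cst_continuous.
  by apply: continuous_comp; [exact: mulrr_continuous|exact: continuous_cos].
have dF (t : R) : is_derive t 1 (fun t => t - x^-1 * sin (t * x)) (1 - cos (t * x)).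
  have h1 : is_derive t 1 (fun t : R => t * x) x.
    have -> : (fun t => t * x) = (fun t => x *: t).
      by apply/funext => u; rewrite /GRing.scale/= mulrC.
    by apply: is_derive_eq; rewrite /GRing.scale/= mulr1.
  have h2 : is_derive t 1 (fun t => sin (t * x)) (cos (t * x) * x).
    exact: (@is_derive1_comp _ sin (fun t => t * x)).
  apply: is_derive_eq; rewrite /GRing.scale/= mulrCA mulVf// mulr1//.
rewrite (FTC2_everywhere d0 cf dF) !mul0r sin0 !mulr0 !subr0 -EFinM /=.
by rewrite mulrBr mulVf ?gt_eqF// invfM; congr (1 - _); ring.
Qed.

Lemma tail_le_cf (X : T -> R) (mX : measurable_fun setT X) (delta : R) (d0 : 0 < delta) :
  2^-1 * fine (P [set w | (2 / delta < `|X w|)%R]) <=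
  \int[uniform_prob d0]_t \int[P]_w (1 - cos (t * X w)).
Proof.
set Q := uniform_prob d0.
pose A := [set w | (2 / delta < `|X w|)%R]; rewrite -/A.
have mA : measurable A by exact: measurable_norm_gt.
have mXT : measurable_fun setT (fun z : R * T => 1 - cos (z.1 * X z.2)).
  apply: measurable_funB => //.
  apply: measurable_cos_comp; apply: measurable_funM => //.
  exact: measurableT_comp.
have bXT t w : `|1 - cos (t * X w)| <= 2.
  by rewrite (le_trans (ler_normB _ _))// normr1 (natrD _ 1 1) lerD2l cos_max.
rewrite (bounded_fubini Q P mXT bXT).
have mTX : measurable_fun setT (fun z : T * R => 1 - cos (z.2 * X z.1)).
  apply: measurable_funB => //.
  apply: measurable_cos_comp; apply: measurable_funM => //.
  exact: measurableT_comp.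
have bTX w t : `|1 - cos (t * X w)| <= 2 by exact: bXT.
have mi := bounded_fubini_measurable P Q mTX bTX.
have mT (w : T) : measurable_fun setT (fun t : R => 1 - cos (t * X w)).
  by have := measurableT_comp mTX (pair1_measurable w).
rewrite -(Rintegral_indic P mA) -RintegralZl//; last first.
  apply: (@bounded_integrable _ _ _ _ _ 1) => [|x]; first exact: measurable_indic.
  by rewrite indicE; case: (_ \in _); rewrite ?normr1 ?normr0.
apply: le_Rintegral => //.
- apply: (@bounded_integrable _ _ _ _ _ 1) => [|x].
    by apply: measurable_funM => //; exact: measurable_indic.
  rewrite indicE; case: (_ \in _); rewrite ?mulr1 ?mulr0 ?normr0//.
  by rewrite ger0_norm ?invr_ge0// invf_le1// ler1n.
- exact: (bounded_integrable P mi (fun w => le_Rintegral_bounded Q (mT w) (bTX w))).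
move=> w _; rewrite indicE; case: (boolP (w \in A)); last first.
  by rewrite mulr0 => _; apply: Rintegral_ge0 => t _; rewrite subr_ge0 cos_le1.
rewrite inE /A /= mulr1 => Xw.
have X0 : X w != 0.
  by rewrite -normr_gt0 (lt_trans _ Xw)// divr_gt0.
rewrite integral_1Bcos//.
have dX : 2 < `|delta * X w| by rewrite normrM (gtr0_norm d0) mulrC -ltr_pdivrMr.
have : `|sin (delta * X w) / (delta * X w)| <= 2^-1.
  rewrite normrM normfV -[leRHS]mul1r ler_pM ?sin_max//.
  by rewrite lef_pV2 ?posrE// ?ltW// (lt_trans _ dX).
rewrite ler_norml => /andP[_]; lra.
Qed.

Lemma tightness (S : nat -> {RV P >-> R}) (phi : R -> R) (e : R) :
  (forall t, \int[P]_w cos (t * S n w) @[n --> \oo] --> phi t) ->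
  {for 0, continuous phi} -> phi 0 = 1 -> 0 < e ->
  exists2 L : R, 0 < L & \forall n \near \oo, (P [set w | (L < `|S n w|)%R] <= e%:E)%E.
Proof.
move=> Sphi cphi phi0 e0.
have [delta d0 hd] : exists2 delta : R, 0 < delta & forall t, `|t| <= delta -> 1 - phi t <= e / 4.
  have /cvgrPdist_le/(_ (e / 4)) := cphi; rewrite divr_gt0// => /(_ isT).
  move=> /nbhs_ballP[r /= r0 hr]; exists (r / 2); first by rewrite divr_gt0.
  move=> t tr; rewrite -[X in X - _]phi0 (le_trans (ler_norm _))//; apply: (hr t).
  rewrite /ball/= sub0r normrN (le_lt_trans tr)//.
  by rewrite ltr_pdivrMr// ltr_pMr// ltr1n.
exists (2 / delta); first by rewrite divr_gt0.
pose h n t := \int[P]_w (1 - cos (t * S n w)).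
have mST n : measurable_fun setT (fun z : R * T => 1 - cos (z.1 * S n z.2)).
  apply: measurable_funB => //.
  apply: measurable_cos_comp; apply: measurable_funM => //.
  exact: measurableT_comp.
have bST n t w : `|1 - cos (t * S n w)| <= 2.
  by rewrite (le_trans (ler_normB _ _))// normr1 (natrD _ 1 1) lerD2l cos_max.
have mS n t : measurable_fun setT (fun w => 1 - cos (t * S n w)).
  by have := measurableT_comp (mST n) (pair1_measurable t).
pose Q := uniform_prob d0.
have mh n : measurable_fun setT (h n).
  exact: (bounded_fubini_measurable Q P (mST n) (bST n)).
have hphi t : h n t @[n --> \oo] --> 1 - phi t.
  rewrite (_ : (fun n => h n t) = (fun n => 1 - \int[P]_w cos (t * S n w))).
    by apply: cvgB (Sphi t); exact: cvg_cst.
  apply/funext => n; rewrite /h RintegralB//.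
  - by rewrite Rintegral_cst// (congr1 fine (probability_setT P)) mulr1.
  - by apply: (@bounded_integrable _ _ _ _ _ `|1|).
  - apply: (@bounded_integrable _ _ _ _ _ 1) => [|x]; last exact: cos_max.
    exact/measurable_cos_comp/measurable_funM.
have mphi : measurable_fun setT (fun t => 1 - phi t).
  by apply: (measurable_fun_cvg mh) => t _; exact: hphi.
have hcvg : \int[Q]_t h n t @[n --> \oo] --> \int[Q]_t (1 - phi t).
  apply: (@bounded_cvg _ _ _ Q _ _ 2) => //; last by apply: aeW => t; exact: hphi.
  by move=> n t; exact: le_Rintegral_bounded.
have phile : \int[Q]_t (1 - phi t) <= e / 4.
  apply: Rintegral_uniform_le => //.
    move=> t; apply: (@cvgr_to_ge _ _ _ _ (h ^~ t) _ _ (hphi t)).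
    by apply: nearW => n; apply: Rintegral_ge0 => w _; rewrite subr_ge0 cos_le1.
  by move=> t /andP[t0 td]; apply: hd; rewrite ger0_norm.
have e2 : e / 4 < e / 2 by rewrite ltr_pM2l// ltf_pV2 ?posrE// ltr_nat.
move/(@cvgr_lt _ _ _ _ _ _)/(_ _ (le_lt_trans phile e2)) : hcvg.
apply: filterS => n hn.
have mA : measurable [set w | (2 / delta < `|S n w|)%R] by exact: measurable_norm_gt.
have fA : P [set w | (2 / delta < `|S n w|)%R] \is a fin_num by exact: fin_num_measure.
rewrite -(fineK fA) lee_fin.
have := le_lt_trans (tail_le_cf (measurable_funPT (S n)) d0) hn.
by rewrite mulrC ltr_pM2r ?invr_gt0//; exact: ltW.
Qed.

End tightness.

Section bernstein.
Context (R : realType).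
Implicit Types (h : nat -> R) (y : R).

Fixpoint bernstein n h y : R :=
  if n is m.+1 then
    y * bernstein m (fun k => h k.+1) y + (1 - y) * bernstein m h y
  else h 0%N.

Lemma ler_bernstein n h h' y : 0 <= y <= 1 -> (forall k, h k <= h' k) ->
  bernstein n h y <= bernstein n h' y.
Proof.
move=> /andP[y0 y1]; elim: n h h' => //= n ih h h' hh'.
by rewrite lerD// ler_wpM2l ?subr_ge0// ih.
Qed.

Lemma bernstein_sqr n (a C c : R) y :
  bernstein n (fun k => a + C * (k%:R - c) ^+ 2) y =
  a + C * (n%:R * y * (1 - y) + (n%:R * y - c) ^+ 2).
Proof.
elim: n c => /= [c|n ih c]; first by rewrite !mul0r !sub0r add0r.
have -> : (fun k => a + C * (k.+1%:R - c) ^+ 2) = (fun k => a + C * (k%:R - (c - 1)) ^+ 2).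
  by apply/funext => k; rewrite -natr1; ring.
by rewrite !ih -natr1; ring.
Qed.

Lemma bernstein_approx (g : R -> R) (M e : R) : continuous g ->
  (forall x, `|g x| <= M) -> 0 < e ->
  exists n, forall y, 0 <= y <= 1 ->
    `|bernstein n (fun k => g (k%:R / n%:R)) y - g y| <= e.
Proof.
move=> cg gM e0.
have M0 : 0 <= M by rewrite (le_trans _ (gM 0)).
have e20 : 0 < e / 2 by rewrite divr_gt0.
have [r r0 gr] := compact_unif_continuous (@segment_compact R 0 1) cg e20.
pose D := (2 * M) / r ^+ 2.
have D0 : 0 <= D by rewrite divr_ge0 ?sqr_ge0// mulr_ge0.
pose n := (Num.truncn (2 * D / e)).+1.
have n0 : 0 < n%:R :> R by rewrite ltr0n.
have nD : D / n%:R <= e / 2.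
  have h : 2 * D <= n%:R * e by rewrite -ler_pdivrMr// ltW// truncnS_gt.
  by rewrite ler_pdivrMr//; lra.
exists n => y y01.
have key k : `|g (k%:R / n%:R) - g y| <= e / 2 + D / n%:R ^+ 2 * (k%:R - n%:R * y) ^+ 2.
  have -> : D / n%:R ^+ 2 * (k%:R - n%:R * y) ^+ 2 = D * (k%:R / n%:R - y) ^+ 2.
    by field; rewrite gt_eqF.
  have [yr|yr] := ltP `|y - k%:R / n%:R| r.
    rewrite (le_trans (ltW (gr y _ _ yr)))//.
    by rewrite lerDl mulr_ge0// sqr_ge0.
  rewrite (@le_trans _ _ (2 * M))//.
    by rewrite (le_trans (ler_normB _ _))// mulr2n mulrDl !mul1r lerD.
  have r2 : r ^+ 2 <= (k%:R / n%:R - y) ^+ 2.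
    by rewrite -[leRHS]real_normK ?num_real// ler_sqr ?nnegrE ?(ltW r0)// distrC.
  have -> : D * (k%:R / n%:R - y) ^+ 2 = 2 * M * ((k%:R / n%:R - y) ^+ 2 / r ^+ 2).
    by rewrite /D; field; rewrite !gt_eqF.
  have : 2 * M <= 2 * M * ((k%:R / n%:R - y) ^+ 2 / r ^+ 2).
    by rewrite ler_peMr ?mulr_ge0// ler_pdivlMr ?exprn_gt0// mul1r.
  lra.
have nyy : D / n%:R ^+ 2 * (n%:R * y * (1 - y) + (n%:R * y - n%:R * y) ^+ 2) <= e / 2.
  apply: le_trans nD; case/andP : y01 => y0 y1.
  have -> : D / n%:R ^+ 2 * (n%:R * y * (1 - y) + (n%:R * y - n%:R * y) ^+ 2) =
      D / n%:R * (y * (1 - y)) by field; rewrite gt_eqF.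
  apply: ler_piMr; first by rewrite divr_ge0 ?(ltW n0).
  by rewrite mulr_ile1 ?subr_ge0// lerBlDr lerDl.
rewrite ler_norml; apply/andP; split.
  rewrite lerBrDl.
  have -> : g y + - e = (g y - e / 2) + - (e / 2) by rewrite -addrA -opprD -splitr.
  apply: le_trans (ler_bernstein n y01 (h := fun k => (g y - e / 2) + - (D / n%:R ^+ 2) * (k%:R - n%:R * y) ^+ 2) _).
    by rewrite bernstein_sqr mulNr lerD2l lerN2.
  move=> k; have := key k; rewrite ler_norml => /andP[+ _]; rewrite lerBrDl; apply: le_trans.
  by rewrite mulNr opprD addrA.
rewrite lerBlDl.
have -> : g y + e = (g y + e / 2) + e / 2 by rewrite -addrA -splitr.
apply: (le_trans (ler_bernstein n y01 (h' := fun k => (g y + e / 2) + (D / n%:R ^+ 2) * (k%:R - n%:R * y) ^+ 2) _)).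
  by move=> k; have := key k; rewrite ler_norml => /andP[_]; rewrite lerBlDl addrA.
by rewrite bernstein_sqr lerD2l.
Qed.

Lemma bernstein_bounded n h y (M : R) : 0 <= y <= 1 -> (forall k, `|h k| <= M) ->
  `|bernstein n h y| <= M.
Proof.
move=> y01 hM; have bM (a : R) : bernstein n (fun=> a) y = a.
  transitivity (bernstein n (fun k => a + 0 * (k%:R - 0) ^+ 2) y).
    by congr bernstein; apply/funext => k; rewrite mul0r addr0.
  by rewrite bernstein_sqr mul0r addr0.
rewrite ler_norml; apply/andP; split.
  by rewrite -[leLHS]bM ler_bernstein// => k; have := hM k; rewrite ler_norml => /andP[].
by rewrite -[leRHS]bM ler_bernstein// => k; have := hM k; rewrite ler_norml => /andP[].
Qed.

End bernstein.

Lemma eq_is_cvgn (R : realType) (a b : nat -> R) : (forall n, a n = b n) -> cvgn a -> cvgn b.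
Proof. by move=> /funext ->. Qed.

(** Functions whose products with all characters have convergent expectations. *)
Section trigonometric_class.
Context d (T : measurableType d) (R : realType) (P : probability T R).
Variable S : nat -> {RV P >-> R}.

Definition cvg_against_characters (g : R -> R) := [/\ bounded_measurable g,
  (forall t, cvgn (fun n => \int[P]_w (g (S n w) * cos (t * S n w)))) &
  (forall t, cvgn (fun n => \int[P]_w (g (S n w) * sin (t * S n w))))].

Let bounded_comp n (f : R -> R) : bounded_measurable f -> bounded_measurable (fun w => f (S n w)).
Proof.
move=> [mf [M fM]]; split; last by exists M.
by have := measurableT_comp mf (measurable_funPT (S n)); exact.
Qed.

Let bcos t : bounded_measurable (fun x : R => cos (t * x)).
Proof. by apply: bounded_measurable_cos; exact: measurable_funM. Qed.

Let bsin t : bounded_measurable (fun x : R => sin (t * x)).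
Proof. by apply: bounded_measurable_sin; exact: measurable_funM. Qed.

Let cvgn_lin a b (f g : R -> R) : bounded_measurable f -> bounded_measurable g ->
  cvgn (fun n => \int[P]_w f (S n w)) -> cvgn (fun n => \int[P]_w g (S n w)) ->
  cvgn (fun n => \int[P]_w (a * f (S n w) + b * g (S n w))).
Proof.
move=> bf bg cf cg.
rewrite (_ : (fun n => _) = (fun n => a * \int[P]_w f (S n w) + b * \int[P]_w g (S n w))); last first.
  by apply/funext => n; apply: bounded_Rintegral_lin; exact: bounded_comp.
by apply: is_cvgD; apply: is_cvgM => //; exact: is_cvg_cst.
Qed.

Lemma cvg_against_characters_lin a b g h :
  cvg_against_characters g -> cvg_against_characters h ->
  cvg_against_characters (fun x => a * g x + b * h x).
Proof.
move=> [bg gc gs] [bh hc hs].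
have bM (u v : R -> R) : bounded_measurable u -> bounded_measurable v ->
  bounded_measurable (fun x => u x * v x) := @bounded_measurableM _ _ _ u v.
split.
- by apply: bounded_measurableD; apply: bM => //; exact: bounded_measurable_cst.
- move=> t; apply: eq_is_cvgn (@cvgn_lin a b _ _ (bM _ _ bg (bcos t)) (bM _ _ bh (bcos t)) (gc t) (hc t)) => n.
  by apply: eq_Rintegral => w _; ring.
- move=> t; apply: eq_is_cvgn (@cvgn_lin a b _ _ (bM _ _ bg (bsin t)) (bM _ _ bh (bsin t)) (gs t) (hs t)) => n.
  by apply: eq_Rintegral => w _; ring.
Qed.

(** Products of sines and cosines are again combinations of characters. *)
Lemma cvg_against_characters_sin c g :
  cvg_against_characters g -> cvg_against_characters (fun x => sin (c * x) * g x).
Proof.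
move=> [bg gc gs].
have bM (u v : R -> R) : bounded_measurable u -> bounded_measurable v ->
  bounded_measurable (fun x => u x * v x) := @bounded_measurableM _ _ _ u v.
split; first exact: bM.
- move=> t.
  apply: eq_is_cvgn (@cvgn_lin 2^-1 2^-1 _ _ (bM _ _ bg (bsin (c + t))) (bM _ _ bg (bsin (c - t))) (gs _) (gs _)) => n.
  by apply: eq_Rintegral => w _; rewrite mulrDl mulrBl sinD sinB; field.
- move=> t.
  apply: eq_is_cvgn (@cvgn_lin 2^-1 (- 2^-1) _ _ (bM _ _ bg (bcos (c - t))) (bM _ _ bg (bcos (c + t))) (gc _) (gc _)) => n.
  by apply: eq_Rintegral => w _; rewrite mulrBl mulrDl cosB cosD; field.
Qed.

Lemma cvg_against_characters_bernstein c n (h : nat -> R) :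
  cvg_against_characters (cst 1) ->
  cvg_against_characters (fun x => bernstein n h ((1 + sin (c * x)) / 2)).
Proof.
move=> t1; elim: n h => /= [h|n ih h].
  have := cvg_against_characters_lin (h 0%N) 0 t1 t1.
  by congr cvg_against_characters; apply/funext => x; rewrite mulr1 mul0r addr0.
have a := ih (fun k => h k.+1); have b := ih h.
have ab := cvg_against_characters_lin 2^-1 2^-1 a b.
have amb := cvg_against_characters_sin c (cvg_against_characters_lin 2^-1 (- 2^-1) a b).
have := cvg_against_characters_lin 1 1 ab amb.
congr cvg_against_characters; apply/funext => x.
by field.
Qed.

End trigonometric_class.

Lemma approx_cvgn (R : realType) (a : nat -> R) :
  (forall e, 0 < e -> exists2 b : nat -> R, cvgn b & \forall n \near \oo, `|a n - b n| <= e) ->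
  cvgn a.
Proof.
move=> h; apply/cauchy_cvgP; apply: cauchy_exP => e e0.
have e20 : 0 < e / 2 by rewrite divr_gt0.
have [b /cvg_ex[/= l bl] ab] := h _ e20.
exists l; have bl' : \forall n \near \oo, `|l - b n| < e / 2 by move/cvgrPdist_lt : bl; exact.
near=> n; rewrite /ball/=.
rewrite (_ : l - a n = (l - b n) - (a n - b n)); last by ring.
rewrite (le_lt_trans (ler_normB _ _))// (splitr e) ltr_leD//; near: n => //.
Unshelve. all: by end_near. Qed.

Section weak_limit_functional.
Context d (T : measurableType d) (R : realType) (P : probability T R).
Variable S : nat -> {RV P >-> R}.
Hypothesis tight : forall e : R, 0 < e -> exists2 L : R, 0 < L &
  \forall n \near \oo, (P [set w | (L < `|S n w|)%R] <= e%:E)%E.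
Hypothesis S1 : cvg_against_characters S (cst 1).

Lemma cvg_expectation_of_characters (f : R -> R) (M : R) : continuous f ->
  (forall x, `|f x| <= M) -> cvgn (fun n => \int[P]_w f (S n w)).
Proof.
move=> cf fM; apply: approx_cvgn => e e0.
have M0 : 0 <= M by rewrite (le_trans _ (fM 0)).
have e2 : 0 < e / 2 by rewrite divr_gt0.
have M20 : 0 < 2 * M + 1 by rewrite ltr_wpDl// mulr_ge0.
have [L L0 PL] := tight (divr_gt0 e2 M20).
pose c := (2 * L)^-1; have c0 : 0 < c by rewrite invr_gt0 mulr_gt0.
pose k : R := sin 2^-1.
have half : - (pi / 2) <= - 2^-1 :> R /\ 2^-1 <= pi / 2 :> R.
  rewrite lerN2; have := @pihalf_ge1 R; lra.
have k0 : 0 < k by apply: sin_gt0_pihalf; have := @pihalf_ge1 R; lra.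
have k1 : k < 1.
  have p := @pihalf_ge1 R.
  have i1 : 2^-1 \in `[- (pi / 2), pi / 2 :> R] by rewrite in_itv/=; lra.
  have i2 : pi / 2 \in `[- (pi / 2), pi / 2 :> R] by rewrite in_itv/=; lra.
  by rewrite /k -[ltRHS]sin_pihalf ltr_sin//; lra.
pose cl (y : R) := Num.max (- k) (Num.min k (2 * y - 1)).
have clb y : -1 < cl y < 1.
  rewrite /cl lt_max gt_max gt_min k1 /= ltrN2 k1/=; lra.
pose g y := f (asin (cl y) / c).
have cg : continuous g.
  move=> y; apply: (@continuous_comp _ _ _ (fun y => asin (cl y) / c) f); last exact: cf.
  apply: continuousM; last exact: cst_continuous.
  apply: (@continuous_comp _ _ _ cl asin); last exact: continuous_asin.
  apply: continuous_max; first exact: cst_continuous.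
  apply: continuous_min; first exact: cst_continuous.
  by apply: continuousB; [exact: mulrl_continuous|exact: cst_continuous].
have [n gn] := bernstein_approx cg (fun y => fM _) e2.
pose Tr x := bernstein n (fun k => g (k%:R / n%:R)) ((1 + sin (c * x)) / 2).
have tT : cvg_against_characters S Tr := cvg_against_characters_bernstein _ _ _ S1.
have y01 (x : R) : 0 <= (1 + sin (c * x)) / 2 <= 1.
  have := sin_le1 (c * x); have := sin_geN1 (c * x); lra.
have TM x : `|Tr x| <= M by apply: bernstein_bounded => [|j]; [exact: y01|exact: fM].
have fT x : `|x| <= L -> `|f x - Tr x| <= e / 2.
  move=> xL; rewrite distrC.
  suff -> : f x = g ((1 + sin (c * x)) / 2) by exact: gn.
  have cx : `|c * x| <= 2^-1.
    by rewrite normrM (gtr0_norm c0) /c invfM -mulrA ler_piMr// mulrC ler_pdivrMr// mul1r.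
  move: cx; rewrite ler_norml => /andP[cx1 cx2].
  have i1 : c * x \in `[- (pi / 2), pi / 2] by rewrite in_itv/=; lra.
  have s1 : sin (c * x) <= k.
    by rewrite /k le_eqVlt; case: (ltgtP (c * x) 2^-1) cx2 => // [h|->]; rewrite ?eqxx// ltr_sin ?h ?orbT// in_itv/=; lra.
  have s2 : - k <= sin (c * x).
    by rewrite /k -sinN le_eqVlt; case: (ltgtP (- 2^-1) (c * x)) cx1 => // [h|<-]; rewrite ?eqxx// ltr_sin ?h ?orbT// in_itv/=; lra.
  have E : 2 * ((1 + sin (c * x)) / 2) - 1 = sin (c * x) by field.
  rewrite /g /cl E.
  by rewrite (min_idPr s1) (max_idPr s2) sinK// mulrAC mulfV ?gt_eqF// mul1r.
have mS m (h : R -> R) : measurable_fun setT h -> measurable_fun setT (fun w => h (S m w)).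
  by move=> mh; have := measurableT_comp mh (measurable_funPT (S m)); exact.
have mf : measurable_fun setT f by exact: continuous_measurable_fun.
case: tT => [[mT _] /(_ 0) cT _].
exists (fun n => \int[P]_w Tr (S n w)).
  apply: eq_is_cvgn cT => m; apply: eq_Rintegral => w _.
  by rewrite mul0r cos0 mulr1.
apply: filterS PL => m PL.
pose A := [set w | (L < `|S m w|)%R].
have mA : measurable A by exact: measurable_norm_gt.
have fA : P A \is a fin_num by exact: fin_num_measure.
rewrite -/A -(fineK fA) lee_fin in PL.
rewrite -RintegralB//; last 2 first.
  exact: (@bounded_integrable _ _ _ _ _ M (mS _ _ mf)).
  exact: (@bounded_integrable _ _ _ _ _ M (mS _ _ mT)).
have iD : measurable_fun setT (fun w => f (S m w) - Tr (S m w)).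
  by apply: measurable_funB; exact: mS.
have i1A : P.-integrable setT (EFin \o (fun w => (2 * M) * \1_A w)).
  apply: (@bounded_integrable _ _ _ _ _ (2 * M)) => [|w].
    by apply: measurable_funM => //; exact: measurable_indic.
  rewrite indicE; case: (_ \in _); rewrite ?mulr1 ?mulr0 ?normr0 ?ger0_norm//; lra.
have ie : P.-integrable setT (EFin \o (fun w => e / 2)).
  by apply: (@bounded_integrable _ _ _ _ _ `|e / 2|).
have bD x : `|f x - Tr x| <= 2 * M.
  by rewrite (le_trans (ler_normB _ _))// mulr2n mulrDl !mul1r lerD.
have iD' : P.-integrable setT (EFin \o (fun w => f (S m w) - Tr (S m w))).
  exact: (@bounded_integrable _ _ _ _ _ (2 * M)).
apply: (le_trans (le_normr_Rintegral measurableT iD')).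
apply: (@le_trans _ _ (\int[P]_w (e / 2 + 2 * M * \1_A w))).
  apply: le_Rintegral => //.
  - apply: (@bounded_integrable _ _ _ _ _ (2 * M)) => [|w]; first exact: measurableT_comp.
    by rewrite normr_id.
  - exact: (integrableD measurableT ie i1A).
  - move=> w _; have [wL|wL] := leP `|S m w| L.
      by rewrite (le_trans (fT _ wL))// lerDl mulr_ge0// mulr_ge0.
    by rewrite indicE mem_set// mulr1 (le_trans (bD _))// lerDr ltW.
rewrite RintegralD// RintegralZl//; last first.
  apply: (@bounded_integrable _ _ _ _ _ 1) => [|x]; first exact: measurable_indic.
  by rewrite indicE; case: (_ \in _); rewrite ?normr1 ?normr0.
rewrite Rintegral_indic// Rintegral_cst// (congr1 fine (probability_setT P)) mulr1.
rewrite [leRHS]splitr lerD2l.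
apply: (@le_trans _ _ ((2 * M + 1) * fine (P A))).
  by rewrite ler_wpM2r// ?fine_ge0// lerDl.
by rewrite mulrC -ler_pdivlMr.
Qed.

End weak_limit_functional.

Lemma probability_eq_cdf (R : realType) (m1 m2 : probability R R) :
  (forall x : R, m1 `]-oo, x]%classic = m2 `]-oo, x]%classic) -> forall A, measurable A -> m1 A = m2 A.
Proof.
move=> m12 A mA.
have m12y x : m1 `]x, +oo[%classic = m2 `]x, +oo[%classic.
  by rewrite -setCitvl !probability_setC// m12.
apply: (@measure_unique _ _ R (@RGenOInfty.G R) (fun n => `]- n%:R, +oo[%classic)) => //.
- exact: RGenOInfty.measurableE.
- move=> _ _ [x ->] [y ->]; exists (Num.max x y); apply/seteqP; split => z /=.
    by rewrite !in_itv/= !andbT gt_max => -[-> ->].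
  by rewrite !in_itv/= !andbT gt_max => /andP[-> ->].
- by move=> n; exists (- n%:R).
- rewrite -subTset => x _; exists (Num.truncn `|x|).+1 => //=.
  rewrite in_itv/= andbT ltrNl (le_lt_trans _ (truncnS_gt _))//.
  by rewrite -normrN ler_norm.
- by move=> _ [x ->]; exact: m12y.
- by move=> n; rewrite (le_lt_trans (probability_le1 _ _))// ltry.
Qed.

Section quantile.
Context d (T : measurableType d) (R : realType) (P : probability T R).
Variable X : {RV P >-> R}.

Definition distribution_function (x : R) : R := fine (cdf X x).
Local Notation F := distribution_function.

Lemma distribution_functionE x : cdf X x = (F x)%:E.
Proof. by rewrite fineK// fin_num_measure. Qed.

Lemma distribution_function_le x y : x <= y -> F x <= F y.
Proof. by move=> xy; rewrite -lee_fin -!distribution_functionE cdf_nondecreasing. Qed.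

Definition quantile (u : R) : R :=
  if 0 < u < 1 then inf [set x | u <= F x] else 0.

Lemma quantile_le u x : 0 < u < 1 -> (quantile u <= x) = (u <= F x).
Proof.
move=> /[dup] u01 /andP[u0 u1]; rewrite /quantile u01.
set A := [set x | _].
have lbA : has_lbound A.
  have h : F r @[r --> -oo] --> (0 : R) by apply: fine_cvg; exact: cvg_cdfNy0.
  have : \forall r \near -oo, F r < u by exact: (cvgr_lt _ h).
  move=> [r [_ hr]]; exists (r - 1) => z /= Az; rewrite leNgt; apply/negP => zr.
  have := hr (r - 1); rewrite ltrBlDr ltrDl ltr01 => /(_ isT); rewrite ltNge => /negP; apply.
  exact/(le_trans Az)/distribution_function_le/ltW.
have A0 : A !=set0.
  have h : F r @[r --> +oo] --> (1 : R) by apply: fine_cvg; exact: cvg_cdfy1.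
  have : \forall r \near +oo, u < F r by exact: (cvgr_gt _ h).
  move=> [r [_ hr]]; exists (r + 1); apply/ltW/hr; rewrite ltrDl//.
apply/idP/idP => [infx|ux]; last by apply: ge_inf.
have h : F y @[y --> x^'+] --> F x.
  by apply: fine_cvg; rewrite -distribution_functionE; exact: cdf_right_continuous.
apply: (cvgr_to_ge h).
near=> y.
have xy : x < y by near: y; exact: nbhs_right_gt.
have [z Az zy] := inf_lt A0 (le_lt_trans infx xy).
by apply: (le_trans Az); apply: distribution_function_le; exact: ltW.
Unshelve. all: by end_near. Qed.

Lemma measurable_quantile : measurable_fun setT quantile.
Proof.
apply: (measurability _ (@RGenOInfty.measurableE R)) => // _ [_ [x ->] <-]; rewrite setTI.
have -> : quantile @^-1` `]x, +oo[ = ~` (quantile @^-1` `]-oo, x]) by rewrite preimage_setC setCitvl.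
apply: measurableC.
have -> : quantile @^-1` `]-oo, x] =
   (`]0, 1[ `&` `]-oo, F x]) `|` (~` `]0, 1[ `&` (if 0 <= x then setT else set0)).
  apply/seteqP; split => [u|u] /=; rewrite !in_itv/=; have [u01|u01] := boolP (0 < u < 1).
  - by rewrite quantile_le// => ?; left.
  - rewrite /quantile (negbTE u01) => x0; right; split; first exact/negP.
    by rewrite x0.
  - by rewrite quantile_le// => -[[]|[]//].
  - by rewrite /quantile (negbTE u01) => -[[]//|[_]]; case: ifP.
apply: measurableU; apply: measurableI => //; first exact: measurableC.
by case: ifP.
Qed.

Lemma expectation_quantile (f : R -> R) : measurable_fun setT f ->
  (exists M, forall x, `|f x| <= M) ->
  \int[uniform_prob (@ltr01 R)]_u f (quantile u) = \int[P]_w f (X w).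
Proof.
set U := uniform_prob _ => mf [M fM].
pose q : {RV U >-> R} := RV_of U measurable_quantile.
rewrite /Rintegral; congr fine.
transitivity (\int[distribution U q]_y (f y)%:E)%E.
  rewrite integral_distribution//; first exact/measurable_EFinP.
  by apply: (@bounded_integrable _ _ _ U _ M) => //; have := measurableT_comp mf measurable_quantile; exact.
transitivity (\int[distribution P X]_y (f y)%:E)%E; last first.
  rewrite integral_distribution//; first exact/measurable_EFinP.
  by apply: (@bounded_integrable _ _ _ P _ M) => //; have := measurableT_comp mf (measurable_funPT X); exact.
have E A : measurable A -> distribution U q A = distribution P X A.
  apply: (@probability_eq_cdf R (distribution U q) (distribution P X)) => x.
  transitivity ((F x)%:E); last by rewrite -distribution_functionE.
  change (U (quantile @^-1` `]-oo, x]%classic) = (F x)%:E).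
  have F0 : 0 <= F x by rewrite fine_ge0.
  have F1 : F x <= 1 by rewrite -lee_fin -distribution_functionE cdf_le1.
  set B := quantile @^-1` _.
  have mB : measurable B.
    by rewrite -[X in measurable X]setTI; exact: measurable_quantile.
  have -> : U B = lebesgue_measure (B `&` `[0, 1]).
    transitivity (\int[U]_u (\1_B u)%:E)%E; first by rewrite integral_indic// setIT.
    rewrite integral_uniform//.
      by rewrite subr0 invr1 mul1e integral_indic.
    exact/measurable_EFinP/measurable_indic.
  have sub1 : B `&` `[0, 1] `<=` `[0, F x] `|` [set 1].
    move=> u [] /=; rewrite !in_itv/= => Bu /andP[u0 u1].
    have [->|u1'] := eqVneq u 1; first by right.
    have {}u1' : u < 1 by rewrite lt_neqAle u1'.
    left; rewrite /= ?in_itv/= ?u0/=.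
    move: u0; rewrite le_eqVlt => /predU1P[<-//|u0'].
    by move: Bu; rewrite /B/= in_itv/= quantile_le ?u0'.
  have sub2 : `]0, F x[ `<=` B `&` `[0, 1].
    move=> u; rewrite /= !in_itv/= => /andP[u0 uF].
    have u1 : u < 1 by exact: lt_le_trans F1.
    split; last by rewrite !(ltW u0, ltW u1).
    by rewrite /B/= in_itv/= quantile_le ?u0// ltW.
  apply/eqP; rewrite eq_le; apply/andP; split.
    apply: (@le_trans _ _ (lebesgue_measure (`[0, F x] `|` [set 1] : set R))).
      by apply: le_measure; rewrite ?inE//; [exact: measurableI|exact: measurableU].
    apply: (le_trans (measureU2 _ _ _)) => //.
    have e1 : lebesgue_measure (`[0, F x] : set R) = (F x)%:E.
      rewrite lebesgue_measure_itv/= lte_fin; case: ifPn => [_|]; first by rewrite sube0.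
      by rewrite -leNgt => F0'; congr EFin; apply/le_anti; rewrite F0 F0'.
    have e2 : lebesgue_measure ([set 1] : set R) = 0%E by exact: lebesgue_measure_set1.
    rewrite -[leRHS]adde0; apply: leeD; rewrite le_eqVlt; apply/orP; left; apply/eqP.
      exact: e1.
    exact: e2.
  apply: (@le_trans _ _ (lebesgue_measure (`]0, F x[ : set R))).
    rewrite lebesgue_measure_itv/= lte_fin; case: ifPn => [_|]; first by rewrite sube0.
    by rewrite -leNgt lee_fin.
  by apply: le_measure; rewrite ?inE//; exact: measurableI.
by apply: eq_measure_integral => A mA _; exact: E.
Qed.

End quantile.

Lemma cvgn_of_rational_cuts (R : realType) (u : nat -> R) (A B : R) :
  (\forall n \near \oo, A <= u n) -> (\forall n \near \oo, u n <= B) ->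
  (forall c c' : rat, c < c' -> (\forall n \near \oo, ratr c <= u n) \/
     (\forall n \near \oo, u n <= ratr c')) ->
  cvgn u.
Proof.
move=> uA uB cut.
pose E := [set x | \forall n \near \oo, x <= u n].
have E0 : E !=set0 by exists A.
have ubE : has_ubound E.
  exists B => x Ex; near \oo => n.
  by apply: (@le_trans _ _ (u n)); near: n.
have supE : has_sup E by split.
apply/cvg_ex; exists (sup E); apply/cvgrPdist_lt => e e0.
have se : sup E < sup E + e by rewrite ltrDl.
have [c'] := rat_in_itvoo se; rewrite in_itv/= => /andP[c'1 c'2].
have [c] := rat_in_itvoo c'1; rewrite in_itv/= => /andP[c1 c2].
have cc' : c < c' by rewrite -(ltr_rat R).
have up : \forall n \near \oo, u n <= ratr c'.
  case: (cut c c' cc') => // cE; exfalso.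
  have : ratr c <= sup E by apply: ub_le_sup.
  by rewrite leNgt c1.
have [x Ex xs] := sup_adherent e0 supE.
near=> n.
have h1 : u n <= ratr c' by near: n.
have h2 : x <= u n by near: n.
rewrite ltr_norml; apply/andP; split.
  by rewrite ltrBrDl ltrBlDr (le_lt_trans h1)// (lt_le_trans c'2)// addrC.
by rewrite ltrBlDl -ltrBlDr (lt_le_trans xs).
Unshelve. all: by end_near. Qed.

Lemma bounded_of_near_bounded (R : realType) (u : nat -> R) (B : R) :
  (\forall n \near \oo, `|u n| <= B) -> exists B', forall n, `|u n| <= B'.
Proof.
move=> [N _ hN]; exists (`|B| + \sum_(i < N) `|u i|) => n.
have [Nn|nN] := leqP N n.
  rewrite (le_trans (hN n Nn))// (le_trans (ler_norm _))// lerDl.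
  by apply: sumr_ge0 => i _.
rewrite -[leLHS]add0r lerD// (bigD1 (Ordinal nN))//= lerDl.
by apply: sumr_ge0 => i _.
Qed.

Section ramp.
Context (R : realType).

Definition ramp (c c' x : R) : R := Num.max 0 (Num.min 1 ((c' - x) / (c' - c))).

Lemma ramp_ge0 c c' x : 0 <= ramp c c' x.
Proof. by rewrite /ramp le_max lexx. Qed.

Lemma ramp_le1 c c' x : ramp c c' x <= 1.
Proof. by rewrite /ramp ge_max ge_min lexx ler01. Qed.

Lemma norm_ramp_le1 c c' x : `|ramp c c' x| <= 1.
Proof. by rewrite ger0_norm ?ramp_ge0// ramp_le1. Qed.

Lemma ramp1 c c' x : c < c' -> x <= c -> ramp c c' x = 1.
Proof.
move=> cc' xc; rewrite /ramp (min_idPl _) ?(max_idPr _)//.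
by rewrite ler_pdivlMr ?subr_gt0// mul1r lerD2l lerN2.
Qed.

Lemma ramp0 c c' x : c < c' -> c' <= x -> ramp c c' x = 0.
Proof.
move=> cc' xc; apply/max_idPl; rewrite ge_min; apply/orP; right.
by rewrite pmulr_lle0 ?invr_gt0 ?subr_gt0// subr_le0.
Qed.

Lemma continuous_ramp c c' : continuous (ramp c c').
Proof.
move=> x; apply: (@continuous_max _ _ (cst 0) (fun x => Num.min 1 ((c' - x) / (c' - c)))); first exact: cst_continuous.
apply: continuous_min; first exact: cst_continuous.
apply: continuousM; last exact: cst_continuous.
by apply: continuousB; [exact: cst_continuous|].
Qed.

End ramp.

Section levy.
Context d (T : measurableType d) (R : realType) (P : probability T R).
Variables (S : nat -> {RV P >-> R}) (phi psi : R -> R).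
Hypothesis cosS : forall t, \int[P]_w cos (t * S n w) @[n --> \oo] --> phi t.
Hypothesis sinS : forall t, \int[P]_w sin (t * S n w) @[n --> \oo] --> psi t.
Hypothesis cphi : {for 0, continuous phi}.
Hypothesis phi0 : phi 0 = 1.

Let U := uniform_prob (@ltr01 R).

Let ind1 : cvg_against_characters S (cst 1).
Proof.
split.
- exact: bounded_measurable_cst.
- move=> t; apply: (@eq_is_cvgn _ (fun n => \int[P]_w cos (t * S n w))).
    by move=> n; apply: eq_Rintegral => w _; rewrite mul1r.
  by apply/cvg_ex; exists (phi t).
- move=> t; apply: (@eq_is_cvgn _ (fun n => \int[P]_w sin (t * S n w))).
    by move=> n; apply: eq_Rintegral => w _; rewrite mul1r.
  by apply/cvg_ex; exists (psi t).
Qed.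

Let tight (e : R) : 0 < e -> exists2 L : R, 0 < L &
  \forall n \near \oo, (P [set w | (L < `|S n w|)%R] <= e%:E)%E.
Proof. exact: tightness cosS cphi phi0. Qed.

Let cvgE (f : R -> R) (M : R) : continuous f -> (forall x, `|f x| <= M) ->
  cvgn (fun n => \int[P]_w f (S n w)).
Proof. exact: cvg_expectation_of_characters tight ind1 f M. Qed.

Let F n := distribution_function (S n).
Let q n := quantile (S n).

Let mray n x : measurable (S n @^-1` `]-oo, x]).
Proof. by rewrite -[X in measurable X]setTI; exact: measurable_funPT. Qed.

Let q_bounded (u : R) : exists B, \forall n \near \oo, `|q n u| <= B.
Proof.
have [u01|u01] := boolP (0 < u < 1); last first.
  by exists 0; near=> n; rewrite /q /quantile (negbTE u01) normr0.
have /andP[u0 u1] := u01.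
pose e := Num.min u (1 - u) / 2.
have e0 : 0 < e by rewrite divr_gt0// lt_min u0 subr_gt0.
have eu : e < u by rewrite /e minr_pMl ?invr_ge0// gt_min; lra.
have eu1 : e <= 1 - u by rewrite /e minr_pMl ?invr_ge0// ge_min; lra.
have [L L0 PL] := tight e0.
exists (L + 1); apply: filterS PL => n PL.
pose A := [set w | (L < `|S n w|)%R].
have mA : measurable A by exact: measurable_norm_gt.
rewrite ler_norml; apply/andP; split.
  apply/ltW; rewrite ltNge /q quantile_le// -ltNge.
  apply: le_lt_trans eu; rewrite -lee_fin -distribution_functionE.
  apply: le_trans PL; rewrite /cdf /distribution /pushforward.
  apply: le_measure; rewrite ?inE//.
  move=> w /=; rewrite in_itv/= => h.
  rewrite -normrN (lt_le_trans _ (ler_norm _))// ltrNr (le_lt_trans h)//.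
  by rewrite ltrN2 ltrDl.
rewrite /q quantile_le//.
have : (1 - e%:E <= P (~` A))%E by rewrite probability_setC// leeB.
rewrite -EFinB => h.
rewrite -lee_fin -distribution_functionE.
apply: le_trans (le_trans h _); first by rewrite lee_fin lerBrDl -lerBrDr.
rewrite /cdf /distribution /pushforward; apply: le_measure; rewrite ?inE//; first exact: measurableC.
move=> w /= /negP; rewrite -leNgt in_itv/= => h'.
by rewrite (le_trans (ler_norm _))// (le_trans h')// lerDl.
Unshelve. all: by end_near. Qed.

Let rampE (c c' : R) := lim ((\int[P]_w ramp c c' (S n w)) @[n --> \oo]).

Let F_indic n x : F n x = \int[P]_w (\1_(S n @^-1` `]-oo, x]) w).
Proof. by rewrite Rintegral_indic. Qed.

Let indic_int n x : P.-integrable setT (EFin \o (\1_(S n @^-1` `]-oo, x]) : T -> R)).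
Proof.
apply: (@bounded_integrable _ _ _ P _ 1); first exact: measurable_indic.
by move=> w; rewrite indicE; case: (_ \in _); rewrite ?normr1 ?normr0.
Qed.

Let ramp_int n (c c' : R) : P.-integrable setT (EFin \o (fun w => ramp c c' (S n w))).
Proof.
apply: (@bounded_integrable _ _ _ P _ 1); last by move=> w; exact: norm_ramp_le1.
by apply: measurable_continuous_comp => //; exact: continuous_ramp.
Qed.

Let rampS_le n (c c' : R) : c < c' -> \int[P]_w ramp c c' (S n w) <= F n c'.
Proof.
move=> cc'; rewrite F_indic; apply: le_Rintegral => // w _.
rewrite indicE; have [Sc|Sc] := leP (S n w) c'.
  by rewrite mem_set ?ramp_le1//= in_itv.
by rewrite ramp0 ?(ltW Sc)// ler0n.
Qed.

Let le_rampS n (c c' : R) : c < c' -> F n c <= \int[P]_w ramp c c' (S n w).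
Proof.
move=> cc'; rewrite F_indic; apply: le_Rintegral => // w _.
rewrite indicE; have [Sc|Sc] := leP (S n w) c.
  by rewrite ramp1// lern1; case: (_ \in _).
rewrite memNset ?ramp_ge0//= in_itv/=; apply/negP; by rewrite -ltNge.
Qed.

Let q_cvg (u : R) : 0 < u < 1 -> (forall c c' : rat, u <> rampE (ratr c) (ratr c')) ->
  cvgn (q ^~ u).
Proof.
move=> u01 uram.
have [B qB] := q_bounded u.
apply: (@cvgn_of_rational_cuts _ _ (- B) B).
- by apply: filterS qB => n; rewrite ler_norml => /andP[].
- by apply: filterS qB => n; rewrite ler_norml => /andP[].
move=> c c' cc'.
have rcc' : ratr c < ratr c' :> R by rewrite ltr_rat.
have rc : (\int[P]_w ramp (ratr c) (ratr c') (S n w)) @[n --> \oo] --> rampE (ratr c) (ratr c').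
  exact: (cvgE (@continuous_ramp _ _ _) (@norm_ramp_le1 _ _ _)).
have [h|h|h] := ltgtP u (rampE (ratr c) (ratr c')).
- right; have : \forall n \near \oo, u < \int[P]_w ramp (ratr c) (ratr c') (S n w) by exact: (cvgr_gt _ rc).
  apply: filterS => n un; rewrite /q quantile_le// ltW//.
  exact: (lt_le_trans un (rampS_le _ _)).
- left; have : \forall n \near \oo, \int[P]_w ramp (ratr c) (ratr c') (S n w) < u by exact: (cvgr_lt _ rc).
  apply: filterS => n un; rewrite ltW// ltNge /q quantile_le// -ltNge.
  exact: (le_lt_trans (le_rampS _ _) un).
- by have := uram c c'.
Qed.

Let V u := limn_sup (q ^~ u).

Let mV : measurable_fun setT V.
Proof.
have bq u : exists B', forall n, `|q n u| <= B'.
  by have [B] := q_bounded u; exact: bounded_of_near_bounded.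
apply: (@measurable_fun_limn_sup _ _ _ setT q).
- by move=> u _; have [B hB] := bq u; exists B => _ [n _ <-]; have := hB n; rewrite ler_norml => /andP[].
- by move=> u _; have [B hB] := bq u; exists (- B) => _ [n _ <-]; have := hB n; rewrite ler_norml => /andP[].
- by move=> n; exact: measurable_quantile.
Qed.

Let ae_q_cvg : {ae U, forall u, q n u @[n --> \oo] --> V u}.
Proof.
pose N : set R := \bigcup_(c in [set: rat]) \bigcup_(c' in [set: rat]) [set rampE (ratr c) (ratr c')].
have cN : countable N.
  apply: bigcup_countable => // c _; apply: bigcup_countable => // c' _.
exists N; split.
- exact: countable_measurable.
- have := @dominates_uniform_prob _ _ _ (@ltr01 R).
  move=> /null_content_dominatesP/(_ N); apply.
    exact: countable_measurable.
  exact: countable_lebesgue_measure0.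
move=> u; apply: contra_notP => Nu.
suff /cvg_ex[/= l ql] : cvgn (q ^~ u).
  by have [_] := cvg_limn_inf_sup ql; rewrite /V => ->.
have [u01|u01] := boolP (0 < u < 1).
  by apply: q_cvg => // c c' uE; apply: Nu; exists c => //; exists c'.
rewrite (_ : q ^~ u = cst 0); first exact: is_cvg_cst.
by apply/funext => n; rewrite /q /quantile (negbTE u01).
Qed.

Theorem levy_continuity : exists V : {RV U >-> R}, forall f : R -> R, continuous f ->
  (exists M, forall x, `|f x| <= M) ->
  \int[P]_w f (S n w) @[n --> \oo] --> \int[U]_u f (V u).
Proof.
exists (RV_of U mV) => f cf [M fM].
rewrite (_ : (fun n => _) = (fun n => \int[U]_u f (q n u))); last first.
  apply/funext => n; rewrite expectation_quantile//; last by exists M.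
  exact: continuous_measurable_fun.
apply: (@bounded_cvg _ _ _ U _ _ M) => //.
- by move=> n; apply: measurable_continuous_comp => //; exact: measurable_quantile.
- by apply: measurable_continuous_comp.
- have FF : Filter (nbhs (almost_everywhere U)) by exact: (ae_filter_ringOfSetsType U).
  apply: filterS ae_q_cvg => u qu; apply: continuous_cvg => //; exact: cf.
Qed.

End levy.

Section improper.
Context (R : realType).
Local Notation mu := (@lebesgue_measure R).

Lemma ge0_FTC_exhaustion (f F : R -> R) (D : set R) (a b : nat -> R) (l : R) :
  (forall n, a n < b n) -> nondecreasing_seq (fun n => `[a n, b n]%classic) ->
  D = \bigcup_n `[a n, b n]%classic ->
  (forall x, D x -> 0 <= f x) -> (forall x, D x -> {for x, continuous f}) ->
  (forall x, D x -> is_derive x 1 F (f x)) ->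
  F (b n) - F (a n) @[n --> \oo] --> l ->
  (\int[mu]_(x in D) (f x)%:E = l%:E)%E.
Proof.
move=> ab nd DE f0 cf dF Fl.
have subD n : `[a n, b n] `<=` D by rewrite DE => x nx; exists n.
have wcf n : {within `[a n, b n], continuous f}.
  by apply: continuous_in_subspaceT => x; rewrite inE => /subD; exact: cf.
have cF x : D x -> {for x, continuous F}.
  move=> Dx; apply: differentiable_continuous; apply/derivable1_diffP.
  by have := dF x Dx; apply: @ex_derive.
have In n : (\int[mu]_(x in `[a n, b n]) (f x)%:E = (F (b n) - F (a n))%:E)%E.
  have Da : D (a n) by apply: (subD n); rewrite /= in_itv/= lexx ltW.
  have Db : D (b n) by apply: (subD n); rewrite /= in_itv/= lexx ltW.
  rewrite (@continuous_FTC2 _ f F)//.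
  - split.
    + move=> x xab; have Dx : D x by apply: (subD n); exact: subset_itv_oo_cc.
      by have := dF x Dx; apply: @ex_derive.
    + exact/cvg_at_right_filter/cF.
    + exact/cvg_at_left_filter/cF.
  - move=> x xab; have Dx : D x by apply: (subD n); exact: subset_itv_oo_cc.
    by rewrite derive1E; have := dF x Dx; apply: @derive_val.
have h : (\int[mu]_(x in `[a n, b n]) (f x)%:E @[n --> \oo] -->
    \int[mu]_(x in \bigcup_n `[a n, b n]%classic) (f x)%:E)%E.
  apply: ge0_nondecreasing_set_cvg_integral => //.
  - by move=> n; apply/measurable_EFinP; apply: subspace_continuous_measurable_fun.
  - by move=> n x /subD Dx; rewrite lee_fin f0.
have h' : (\int[mu]_(x in `[a n, b n]) (f x)%:E @[n --> \oo] --> l%:E)%E.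
  by under eq_fun do rewrite In; apply: cvg_EFin => //; exact: nearW.
by rewrite DE; apply: (cvg_unique _ h h').
Qed.

Lemma cvg_powR_div (x b : R) : 0 < x -> 0 < b ->
  (x / n.+1%:R) `^ b @[n --> \oo] --> (0 : R).
Proof.
move=> x0 b0; have := @powR_cvg0 R b b0 => /cvg_at_rightP; apply; split.
  by move=> n; rewrite divr_gt0.
rewrite -[X in _ --> X](mulr0 x); apply: cvgM; first exact: cvg_cst.
exact: cvg_harmonic.
Qed.

Lemma nd_div (x : R) m n : 0 <= x -> (m <= n)%N -> x / n.+1%:R <= x / m.+1%:R.
Proof. by move=> x0 mn; rewrite ler_wpM2l// lef_pV2 ?posrE ?ltr0n// ler_nat ltnS. Qed.

(* some index puts x / n.+1 below a given positive bound *)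
Lemma div_lt_near (x y : R) : 0 < y -> exists n, x / n.+1%:R <= y.
Proof.
move=> y0; exists (Num.truncn (`|x| / y)); rewrite ler_pdivrMr// mulrC -ler_pdivrMr//.
rewrite ltW// (le_lt_trans _ (truncnS_gt _))// ler_pM2r ?invr_gt0//.
exact: ler_norm.
Qed.

Lemma integral_powR0 (x b : R) : 0 < x -> 0 < b ->
  (\int[mu]_(y in `]0%R, x]) (y `^ (b - 1))%:E = (x `^ b / b)%:E)%E.
Proof.
move=> x0 b0.
apply: (@ge0_FTC_exhaustion (fun y => y `^ (b - 1)) (fun y => b^-1 * y `^ b) _ (fun n => x / n.+2%:R) (fun=> x)).
- by move=> n; rewrite ltr_pdivrMr// ltr_pMr// ltr1n.
- by move=> m n mn; apply/subsetPset => y; rewrite /= !in_itv/= => /andP[ym ->]; rewrite andbT (le_trans _ ym)//; apply: (@nd_div x m.+1 n.+1); rewrite ?ltW.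
- apply/seteqP; split => y /=; rewrite in_itv/=.
    move=> /andP[y0 yx]; have [n xny] := div_lt_near x y0; exists n => //=.
    rewrite in_itv/= yx andbT (le_trans _ xny)//; apply: (@nd_div x n n.+1); rewrite ?ltW//.
  by move=> [n _]; rewrite /= in_itv/= => /andP[yn ->]; rewrite andbT (lt_le_trans _ yn)// divr_gt0.
- by move=> y _; exact: powR_ge0.
- move=> y; rewrite /= in_itv/= => /andP[y0 _].
  apply: differentiable_continuous; apply/derivable1_diffP.
  by apply: derivable_powR; rewrite in_itv/= y0.
- move=> y; rewrite /= in_itv/= => /andP[y0 _].
  have h := is_derive1_powR b y0.
  by apply: is_derive_eq; rewrite /GRing.scale/= mulrA mulVf ?gt_eqF// mul1r.
- rewrite -[X in _ --> X]subr0 mulrC; apply: cvgB; first exact: cvg_cst.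
  rewrite -[X in _ --> X](mulr0 b^-1); apply: cvgM; first exact: cvg_cst.
  by have := cvg_powR_div x0 b0; rewrite -cvg_shiftS.
Qed.

Lemma integral_powR1 (x b : R) : 0 < x -> 0 < b ->
  (\int[mu]_(y in `[(1 - x)%R, 1%R[) ((1 - y) `^ (b - 1))%:E = (x `^ b / b)%:E)%E.
Proof.
move=> x0 b0.
apply: (@ge0_FTC_exhaustion (fun y => (1 - y) `^ (b - 1)) (fun y => (- b^-1) * (1 - y) `^ b) _ (fun=> 1 - x) (fun n => 1 - x / n.+2%:R)).
- by move=> n; rewrite ltrD2l ltrN2 ltr_pdivrMr// ltr_pMr// ltr1n.
- move=> m n mn; apply/subsetPset => y; rewrite /= !in_itv/= => /andP[-> ym]/=.
  by rewrite (le_trans ym)// lerD2l lerN2; apply: (@nd_div x m.+1 n.+1); rewrite ?ltW.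
- apply/seteqP; split => y /=; rewrite in_itv/=.
    move=> /andP[yx y1]; have [n xny] : exists n, x / n.+1%:R <= 1 - y by apply: div_lt_near; rewrite subr_gt0.
    exists n => //=; rewrite in_itv/= yx/= lerBrDl -lerBrDr (le_trans _ xny)//.
    by apply: (@nd_div x n n.+1); rewrite ?ltW.
  move=> [n _]; rewrite /= in_itv/= => /andP[-> yn]/=; rewrite (le_lt_trans yn)//.
  by rewrite ltrBlDr ltrDl divr_gt0.
- by move=> y _; exact: powR_ge0.
- move=> y; rewrite /= in_itv/= => /andP[_ y1].
  apply: (@continuous_comp R R R (fun y => 1 - y) (fun y => y `^ (b - 1)) y).
    by apply: continuousB; [exact: cst_continuous|].
  apply: differentiable_continuous; apply/derivable1_diffP.
  by apply: derivable_powR; rewrite in_itv/= subr_gt0 y1.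
- move=> y; rewrite /= in_itv/= => /andP[_ y1].
  have y0 : 0 < 1 - y by rewrite subr_gt0.
  have h := is_derive1_powR b y0.
  have h1 : is_derive y 1 (fun y : R => 1 - y) (-1).
    by apply: is_derive_eq; rewrite add0r mul1r.
  have h2 : is_derive y 1 (fun y => (1 - y) `^ b) (b * (1 - y) `^ (b - 1) * -1).
    exact: (@is_derive1_comp _ (fun z => z `^ b) (fun y => 1 - y)).
  apply: is_derive_eq; rewrite /GRing.scale/=.
  by field; rewrite gt_eqF.
- have e z : 1 - (1 - z) = z :> R by ring.
  have -> : x `^ b / b = - b^-1 * 0 - (- b^-1 * (1 - (1 - x)) `^ b).
    by rewrite e mulr0 sub0r mulNr opprK mulrC.
  apply: cvgB; last exact: cvg_cst.
  apply: cvgM; first exact: cvg_cst.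
  under eq_fun do rewrite e.
  by have := cvg_powR_div x0 b0; rewrite -cvg_shiftS.
Qed.

End improper.

Section gamma_integral.
Context (R : realType).
Local Notation mu := (@lebesgue_measure R).

Lemma continuous_expRN : continuous (fun z : R => expR (- z)).
Proof.
move=> z; apply: (@continuous_comp R R R (fun z => - z) expR); first exact: oppr_continuous.
exact: continuous_expR.
Qed.

Lemma measurable_expRN : measurable_fun setT (fun z : R => expR (- z)).
Proof. exact: (continuous_measurable_fun continuous_expRN). Qed.

Lemma is_derive_expRN (z : R) : is_derive z 1 (fun z : R => - expR (- z)) (expR (- z)).
Proof.
have h : is_derive z 1 (fun z : R => - z) (-1) by apply: is_derive_eq.
have h2 : is_derive z 1 (fun z : R => expR (- z)) (expR (- z) * -1).
  exact: (@is_derive1_comp _ expR (fun z => - z)).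
by apply: is_derive_eq; rewrite mulrN1 opprK.
Qed.

Lemma integral_expRN (c : R) : 0 < c ->
  (\int[mu]_(z in `]0%R, c]) (expR (- z))%:E = (1 - expR (- c))%:E)%E.
Proof.
move=> c0; rewrite integral_itv_obnd_cbnd; last first.
  by apply/measurable_EFinP/measurable_funTS; exact: measurable_expRN.
rewrite (FTC2_everywhere c0 continuous_expRN is_derive_expRN).
by congr EFin; rewrite oppr0 expR0 opprK addrC.
Qed.

Lemma integrable_gamma (b : R) : 0 < b < 1 ->
  mu.-integrable `]0%R, +oo[ (fun z => (z `^ (- b) * expR (- z))%:E).
Proof.
move=> /andP[b0 b1].
have mf : measurable_fun setT (fun z : R => z `^ (- b) * expR (- z)).
  apply: measurable_funM; first exact: measurable_powR.
  exact: measurable_expRN.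
apply/integrableP; split; first exact/measurable_EFinP/measurable_funTS.
have b1' : 0 < 1 - b by rewrite subr_gt0.
under eq_integral => z _ do rewrite gee0_abs ?lee_fin ?mulr_ge0 ?powR_ge0 ?expR_ge0//.
have -> : `]0, +oo[%classic = `]0, 1] `|` `]1, +oo[ :> set R.
  by rewrite -itv_bndbnd_setU// bnd_simp.
rewrite ge0_integral_setU//=; last 3 first.
- exact/measurable_EFinP/measurable_funTS.
- by move=> z _; rewrite lee_fin mulr_ge0 ?powR_ge0 ?expR_ge0.
- apply/disj_setPS => z [] /=; rewrite !in_itv/= andbT => /andP[_ z1].
  by rewrite ltNge z1.
apply: lte_add_pinfty.
- apply: (@le_lt_trans _ _ (\int[mu]_(z in `]0%R, 1%R]) (z `^ ((1 - b) - 1))%:E)%E); last first.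
    by rewrite integral_powR0// ltry.
  apply: ge0_le_integral => //=.
  + by move=> z _; rewrite lee_fin mulr_ge0 ?powR_ge0 ?expR_ge0.
  + exact/measurable_EFinP/measurable_funTS.
  + by apply/measurable_EFinP/measurable_funTS; exact: measurable_powR.
  + move=> z; rewrite in_itv/= => /andP[z0 z1]; rewrite lee_fin addrAC subrr add0r.
    by rewrite ler_piMr ?powR_ge0// -expR0 ler_expR oppr_le0 ltW.
- apply: (@le_lt_trans _ _ (\int[mu]_(z in `]1%R, +oo[) (expR (- z))%:E)%E).
    apply: ge0_le_integral => //=.
    + by move=> z _; rewrite lee_fin mulr_ge0 ?powR_ge0 ?expR_ge0.
    + exact/measurable_EFinP/measurable_funTS.
    + by apply/measurable_EFinP/measurable_funTS; exact: measurable_expRN.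
    + move=> z; rewrite in_itv/= andbT => z1; rewrite lee_fin.
      rewrite ler_piMl ?expR_ge0// powRN invf_le1 ?powR_gt0 ?(lt_trans _ z1)//.
      by rewrite -(powRr0 z) ler_powR ?ltW.
  rewrite integral_itv_obnd_cbnd; last first.
    by apply/measurable_EFinP/measurable_funTS; exact: measurable_expRN.
  rewrite (@ge0_continuous_FTC2y _ (fun z => expR (- z)) (fun z => - expR (- z)) 1 0).
  + by rewrite -EFinB ltry.
  + by move=> z _; apply: expR_ge0.
  + by apply: continuous_subspaceT; exact: continuous_expRN.
  + rewrite -[X in _ --> X]oppr0; apply: cvgN; exact: cvgr_expR.
  + by move=> z _; have := is_derive_expRN z; apply: @ex_derive.
  + apply: cvg_at_right_filter; apply: cvgN; exact: continuous_expRN.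
  + by move=> z _; rewrite derive1E; have := is_derive_expRN z; apply: @derive_val.
Qed.

End gamma_integral.

Section abelian.
Context d (T : measurableType d) (R : realType) (P : probability T R).
Local Notation mu := (@lebesgue_measure R).
Variable X : T -> R.
Hypothesis mX : measurable_fun setT X.
Hypothesis X0 : forall w, 0 < X w.
Let G (x : R) : R := fine (P [set w | X w <= x]).

Let k (s : R) (p : T * R) : R :=
  if (0 < p.2) && (p.2 * X p.1 <= s) then expR (- p.2) else 0.

Let k_ge0 s p : 0 <= k s p.
Proof. by rewrite /k; case: ifP => // _; exact: expR_ge0. Qed.

Let mk s : measurable_fun setT (k s).
Proof.
have mX1 : measurable_fun setT (fun p : T * R => X p.1).
  by have := measurableT_comp mX (@measurable_fst _ _ T R); exact.
apply: measurable_fun_if => //=.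
- apply: measurable_and.
    by apply: measurable_fun_ltr.
  by apply: measurable_fun_ler => //; apply: measurable_funM.
- apply: measurable_funTS.
  by apply: (measurable_continuous_comp (@continuous_expRN R)).
Qed.

Let mSet x : measurable [set w | X w <= x].
Proof.
rewrite (_ : [set w | X w <= x] = X @^-1` `]-oo, x]).
  by rewrite -[Y in measurable Y]setTI; exact: mX.
by apply/seteqP; split => w /=; rewrite in_itv.
Qed.

Let inner_z s w : 0 < s -> (\int[mu]_z (k s (w, z))%:E = (1 - expR (- (s / X w)))%:E)%E.
Proof.
move=> s0; rewrite -integral_expRN ?divr_gt0// [RHS]integral_mkcond.
apply: eq_integral => z _; rewrite patchE /k/= -ler_pdivlMr//.
have -> : (z \in `]0, s / X w]%classic) = (0 < z <= s / X w).
  by apply/idP/idP; rewrite inE/= in_itv.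
by case: ifP.
Qed.

Let inner_w s z : 0 < z -> (\int[P]_w (k s (w, z))%:E = (expR (- z) * G (s / z))%:E)%E.
Proof.
move=> z0; rewrite EFinM /G fineK ?fin_num_measure//.
rewrite -[Y in P Y]setIT -integral_indic// -ge0_integralZl//.
- apply: eq_integral => w _; rewrite -EFinM /k/= z0/= indicE.
  rewrite mulrC -ler_pdivlMr//; have [h|h] := boolP (X w <= s / z).
    by rewrite mem_set// mulr1.
  by rewrite memNset ?mulr0//; exact/negP.
- exact/measurable_EFinP/measurable_indic.
Qed.

Let mkG s : measurable_fun (`]0, +oo[%classic : set R) (fun z : R => (expR (- z) * G (s / z))%:E).
Proof.
have mkE : measurable_fun setT (fun p : T * R => (k s p)%:E) by exact/measurable_EFinP.
have := measurable_fun_fubini_tonelli_G (m1 := P) _ mkE (fun p => k_ge0 s p).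
move/(measurable_funS measurableT (@subsetT _ (`]0, +oo[%classic : set R))).
apply: eq_measurable_fun => z; rewrite inE/= in_itv/= andbT => z0.
by rewrite /fubini_G inner_w.
Qed.

Lemma integral_1BexpR s : 0 < s ->
  (\int[P]_w (1 - expR (- (s / X w)))%:E =
   \int[mu]_(z in `]0%R, +oo[) (expR (- z) * G (s / z))%:E)%E.
Proof.
move=> s0; have mkE : measurable_fun setT (fun p : T * R => (k s p)%:E) by exact/measurable_EFinP.
transitivity (\int[P]_w \int[mu]_z (k s (w, z))%:E)%E.
  by apply: eq_integral => w _; rewrite inner_z.
rewrite (@fubini_tonelli _ _ _ _ _ P mu (fun p => (k s p)%:E))//; last by move=> p; rewrite lee_fin.
rewrite [RHS]integral_mkcond; apply: eq_integral => z _; rewrite patchE.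
have -> : (z \in `]0, +oo[%classic) = (0 < z).
  by apply/idP/idP; rewrite inE/= in_itv/= andbT.
case: ifPn; first exact: inner_w.
move=> /negbTE z0; apply: integral0_eq => w _; by rewrite /k/= z0.
Qed.

Variables (b kappa : R).
Hypothesis b01 : 0 < b < 1.
Hypothesis kappa0 : 0 <= kappa.
Hypothesis Gk : forall e, 0 < e -> exists2 r, 0 < r &
  forall x, 0 < x < r -> `|G x - kappa * x `^ b| <= e * x `^ b.

Let G_le1 x : G x <= 1.
Proof. by rewrite -lee_fin fineK ?fin_num_measure// probability_le1. Qed.

Let G_ge0 x : 0 <= G x.
Proof. by rewrite fine_ge0. Qed.

Let G_bound : exists2 C, 0 <= C & forall x, 0 < x -> G x <= C * x `^ b.
Proof.
have [r r0 hr] := Gk ltr01; have /andP[b0 b1] := b01.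
have rb : 0 < r `^ b by rewrite powR_gt0.
exists (kappa + 1 + (r `^ b)^-1); first by rewrite !addr_ge0// invr_ge0 ltW.
move=> x x0; have xb : 0 < x `^ b by rewrite powR_gt0.
have [xr|rx] := ltP x r.
  have := hr x; rewrite x0 xr => /(_ isT); rewrite ler_norml => /andP[_].
  rewrite lerBlDr => h; rewrite (le_trans h)// !mulrDl mul1r [_ + kappa * _]addrC.
  by rewrite lerDl mulr_ge0 ?ltW// invr_gt0.
apply: (le_trans (G_le1 x)); rewrite mulrDl.
have h : 1 <= (r `^ b)^-1 * x `^ b.
  by rewrite mulrC ler_pdivlMr// mul1r ge0_ler_powR ?nnegrE ?(ltW b0) ?(ltW r0) ?(ltW x0).
by rewrite (le_trans h)// lerDr mulr_ge0 ?addr_ge0// ltW.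
Qed.

Let scaled (s z : R) : 0 < s -> 0 < z -> (s / z) `^ b = s `^ b * z `^ (- b).
Proof. by move=> s0 z0; rewrite powRM ?invr_ge0 ?ltW// -[z^-1]powR_inv1 ?ltW// -powRrM mulN1r. Qed.

Let D : set R := `]0, +oo[%classic.

Let LR s : 0 < s -> \int[P]_w (1 - expR (- (s / X w))) =
   \int[mu]_(z in D) (expR (- z) * G (s / z)).
Proof. by move=> s0; rewrite /Rintegral integral_1BexpR. Qed.

Let igZ c : mu.-integrable D (EFin \o (fun z : R => c * (z `^ (- b) * expR (- z)))).
Proof.
apply: (@integrableZl _ _ _ mu D _ c (fun z => (z `^ (- b) * expR (- z))%:E)) => //.
  exact: measurable_itv.
exact: integrable_gamma.
Qed.

Let kernel_le C s : 0 < s -> (forall x, 0 < x -> G x <= C * x `^ b) ->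
  forall z, D z -> expR (- z) * G (s / z) <= C * s `^ b * (z `^ (- b) * expR (- z)).
Proof.
move=> s0 GC z; rewrite /D/= in_itv/= andbT => z0.
rewrite mulrC mulrA ler_wpM2r ?expR_ge0//.
by rewrite (le_trans (GC _ _)) ?divr_gt0// scaled// mulrA.
Qed.

Let igG s : 0 < s -> mu.-integrable D (EFin \o (fun z : R => expR (- z) * G (s / z))).
Proof.
move=> s0; have [C C0 GC] := G_bound.
apply: (le_integrable _ _ _ (igZ (C * s `^ b))); first exact: measurable_itv.
  exact: mkG.
move=> z Dz /=; rewrite lee_fin !ger0_norm ?kernel_le//.
  by rewrite !mulr_ge0 ?powR_ge0 ?expR_ge0.
by rewrite mulr_ge0 ?expR_ge0.
Qed.

Lemma abelian_bound : exists2 C, 0 <= C & forall s, 0 < s ->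
  \int[P]_w (1 - expR (- (s / X w))) <= C * s `^ b.
Proof.
have [C C0 GC] := G_bound; have ig := integrable_gamma b01.
exists (C * \int[mu]_(z in D) (z `^ (- b) * expR (- z))).
  by rewrite mulr_ge0//; apply: Rintegral_ge0 => z _; rewrite mulr_ge0 ?powR_ge0 ?expR_ge0.
move=> s s0; rewrite LR// mulrAC -RintegralZl//=; last exact: measurable_itv.
by apply: le_Rintegral; [exact: measurable_itv|exact: igG|exact: igZ|exact: kernel_le].
Qed.

Lemma abelian_cvg (s : nat -> R) : (forall n, 0 < s n) -> s n @[n --> \oo] --> (0 : R) ->
  (\int[P]_w (1 - expR (- (s n / X w)))) / s n `^ b @[n --> \oo] --> kappa * Gamma (1 - b).
Proof.
move=> s0 s_0.
have [C C0 GC] := G_bound; have ig := integrable_gamma b01.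
have igC : mu.-integrable D (fun z => (C * (z `^ (- b) * expR (- z)))%:E).
  exact: igZ.
have sb n : 0 < s n `^ b by rewrite powR_gt0.
have mkGs n : measurable_fun D (fun z => ((s n `^ b)^-1 * (expR (- z) * G (s n / z)))%:E).
  apply/measurable_EFinP; apply: measurable_funM => //.
  by apply/measurable_EFinP; exact: (mkG (s n)).
have mlim : measurable_fun D (fun z : R => (kappa * (z `^ (- b) * expR (- z)))%:E).
  apply/measurable_EFinP; apply: measurable_funM => //; apply: measurable_funTS.
  apply: measurable_funM; first exact: measurable_powR.
  exact: measurable_expRN.
have ptw z : D z -> ((s n `^ b)^-1 * (expR (- z) * G (s n / z))) @[n --> \oo] --> kappa * (z `^ (- b) * expR (- z)).
  rewrite /D/= in_itv/= andbT => z0; apply/cvgrPdist_le => e e0.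
  have zb : 0 < z `^ (- b) by rewrite powR_gt0.
  pose e' := e / (z `^ (- b) * expR (- z)).
  have e'0 : 0 < e' by rewrite divr_gt0// mulr_gt0// expR_gt0.
  have [r r0 hr] := Gk e'0.
  have : \forall n \near \oo, s n < r * z by apply: (cvgr_lt _ s_0); rewrite mulr_gt0.
  apply: filterS => n snr.
  have := hr (s n / z); rewrite divr_gt0//= ltr_pdivrMr// snr => /(_ isT).
  rewrite scaled// => h.
  have -> : kappa * (z `^ (- b) * expR (- z)) - (s n `^ b)^-1 * (expR (- z) * G (s n / z)) =
     - ((s n `^ b)^-1 * expR (- z) * (G (s n / z) - kappa * (s n `^ b * z `^ (- b)))).
    by field; rewrite gt_eqF.
  rewrite normrN normrM ger0_norm ?mulr_ge0 ?invr_ge0 ?expR_ge0 ?(ltW (sb n))//.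
  apply: (le_trans (ler_wpM2l _ h)); first by rewrite mulr_ge0 ?invr_ge0 ?expR_ge0 ?(ltW (sb n)).
  rewrite /e' le_eqVlt; apply/orP; left; apply/eqP; field.
  by rewrite !gt_eqF ?expR_gt0.
have [] := @dominated_convergence _ _ _ mu D (measurable_itv _)
   (fun n z => ((s n `^ b)^-1 * (expR (- z) * G (s n / z)))%:E)
   (fun z => (kappa * (z `^ (- b) * expR (- z)))%:E)
   (fun z => (C * (z `^ (- b) * expR (- z)))%:E) mkGs mlim _ igC.
- by apply: aeW => z Dz; apply: cvg_EFin; [exact: nearW|exact: ptw].
- apply: aeW => z n; rewrite /D/= in_itv/= andbT => z0.
  rewrite lee_fin ger0_norm ?mulr_ge0 ?invr_ge0 ?expR_ge0 ?(ltW (sb n))//.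
  have -> : C * (z `^ (- b) * expR (- z)) =
      (s n `^ b)^-1 * (expR (- z) * (C * (s n `^ b * z `^ (- b)))).
    by field; rewrite gt_eqF.
  rewrite ler_wpM2l ?invr_ge0 ?(ltW (sb n))// ler_wpM2l ?expR_ge0// -scaled//.
  exact/GC/divr_gt0.
move=> _ _ h.
have i2 : mu.-integrable D (EFin \o (fun z => z `^ (- b) * expR (- z))) by exact: ig.
have -> : kappa * Gamma (1 - b) = \int[mu]_(z in D) (kappa * (z `^ (- b) * expR (- z))).
  rewrite RintegralZl//; last exact: measurable_itv.
  rewrite /Gamma; congr (_ * _); apply: eq_Rintegral => z _.
  by rewrite addrAC subrr add0r.
have fin : (\int[mu]_(z in D) (kappa * (z `^ (- b) * expR (- z)))%:E)%E \is a fin_num.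
  by apply: integrable_fin_num; [exact: measurable_itv|exact: igZ].
move: h; rewrite -[Y in _ --> Y](fineK fin) => /fine_cvg; apply: cvg_trans.
apply: near_eq_cvg; apply: nearW => n /=.
by rewrite LR// mulrC -RintegralZl//; [exact: measurable_itv|exact: igG].
Qed.

End abelian.

Section survival.
Context d (T : measurableType d) (R : realType) (P : probability T R).
Local Notation mu := (@lebesgue_measure R).

Lemma survival_of_density (alpha : {RV P >-> R}) (psi : R -> R) (beta psi1 e : R) :
  -1 < beta -> 0 < psi1 ->
  has_density_on alpha `]0, 1[ (fun x => psi x * (1 - x) `^ beta) ->
  psi x @[x --> 1^'-] --> psi1 -> 0 < e ->
  exists2 r, 0 < r & forall x, 0 < x < r ->
    `|fine (P [set w | 1 - alpha w <= x]) - psi1 / (1 + beta) * x `^ (1 + beta)| <= e * x `^ (1 + beta).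
Proof.
move=> b1 p0 [mf f0 Pf] psil e0.
set b := 1 + beta; have b0 : 0 < b by rewrite /b -ltrBlDl sub0r.
have bE : beta = b - 1 by rewrite /b addrAC subrr add0r.
pose e' := Num.min (e * b) psi1.
have e'0 : 0 < e' by rewrite lt_min p0 mulr_gt0.
have e'1 : e' <= psi1 by rewrite ge_min lexx orbT.
have e'2 : e' / b <= e by rewrite ler_pdivrMr// ge_min lexx.
have [r r0 hr] : exists2 r, 0 < r & forall y, 1 - r < y < 1 -> `|psi1 - psi y| <= e'.
  have /cvgrPdist_le/(_ _ e'0) := psil.
  move=> [r /= r0 hr]; exists r => // y /andP[y1 y2]; apply: hr => //=.
  by rewrite ger0_norm ?subr_ge0 ?(ltW y2)// ltrBlDl -ltrBlDr.
exists (Num.min r 1); first by rewrite lt_min r0 ltr01.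
move=> x /andP[x0]; rewrite lt_min => /andP[xr x1].
have -> : [set w | 1 - alpha w <= x] = alpha @^-1` `[1 - x, +oo[.
  by apply/seteqP; split => w /=; rewrite in_itv/= andbT lerBlDr -lerBlDl.
rewrite Pf; last exact: measurable_itv.
have -> : (`[1 - x, +oo[%classic : set R) `&` `]0, 1[%classic = `[1 - x, 1[%classic.
  apply/seteqP; split => y /=; rewrite !in_itv/= ?andbT; first by move=> [-> /andP[_ ->]].
  move=> /andP[xy ->]; split => //; rewrite andbT (lt_le_trans _ xy)// subr_gt0//.
have sub : (`[1 - x, 1[%classic : set R) `<=` `]0, 1[%classic.
  by move=> y /=; rewrite !in_itv/= => /andP[xy ->]; rewrite andbT (lt_le_trans _ xy)// subr_gt0.
have mfE : measurable_fun (`[(1 - x), 1[%classic : set R) (fun y => psi y * (1 - y) `^ beta).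
  by apply: measurable_funS mf => //; exact: measurable_itv.
have mg c : measurable_fun (`[(1 - x), 1[%classic : set R) (fun y => (c * (1 - y) `^ (b - 1))).
  apply: measurable_funTS; apply: measurable_funM => //.
  have m1 : measurable_fun setT (fun y : R => 1 - y) by apply: measurable_funB.
  by have := measurableT_comp (@measurable_powR R (b - 1)) m1; exact.
have Ic c : 0 <= c -> (\int[mu]_(y in `[(1 - x)%R, 1%R[) (c * (1 - y) `^ (b - 1))%:E = (c * (x `^ b / b))%:E)%E.
  move=> c0; rewrite EFinM -(integral_powR1 x0 b0) -ge0_integralZl//.
  - apply/measurable_EFinP; have := mg 1; apply: eq_measurable_fun => y _.
    by rewrite mul1r.
  - by move=> y _; rewrite lee_fin powR_ge0.
have Up : (\int[mu]_(y in `[(1 - x)%R, 1%R[) (psi y * (1 - y) `^ beta)%:E <= ((psi1 + e') * (x `^ b / b))%:E)%E.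
  rewrite -Ic ?addr_ge0 ?(ltW p0) ?(ltW e'0)//; apply: ge0_le_integral => //.
  - by move=> y /sub /f0; rewrite lee_fin.
  - exact/measurable_EFinP.
  - by apply/measurable_EFinP; exact: mg.
  move=> y; rewrite /= in_itv/= => /andP[xy y1]; rewrite lee_fin bE ler_wpM2r ?powR_ge0//.
  have : `|psi1 - psi y| <= e' by apply: hr; rewrite y1 andbT (lt_le_trans _ xy)// ltrD2l ltrN2.
  rewrite ler_norml; lra.
have Lo : (((psi1 - e') * (x `^ b / b))%:E <= \int[mu]_(y in `[(1 - x)%R, 1%R[) (psi y * (1 - y) `^ beta)%:E)%E.
  rewrite -Ic ?subr_ge0//; apply: ge0_le_integral => //.
  - by move=> y _; rewrite lee_fin mulr_ge0 ?powR_ge0// subr_ge0.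
  - by apply/measurable_EFinP; exact: mg.
  - exact/measurable_EFinP.
  move=> y; rewrite /= in_itv/= => /andP[xy y1]; rewrite lee_fin bE ler_wpM2r ?powR_ge0//.
  have : `|psi1 - psi y| <= e' by apply: hr; rewrite y1 andbT (lt_le_trans _ xy)// ltrD2l ltrN2.
  rewrite ler_norml; lra.
have fin : (\int[mu]_(y in `[(1 - x)%R, 1%R[) (psi y * (1 - y) `^ beta)%:E)%E \is a fin_num.
  by rewrite fin_numE; apply/andP; split; apply/eqP => h; rewrite h in Up Lo.
rewrite -(fineK fin) !lee_fin in Up Lo.
have xb : 0 < x `^ b by rewrite powR_gt0.
apply: (@le_trans _ _ (e' / b * x `^ b)); last by rewrite ler_wpM2r ?(ltW xb).
have q1 : (psi1 + e') * (x `^ b / b) = psi1 / b * x `^ b + e' / b * x `^ b by field; rewrite gt_eqF.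
have q2 : (psi1 - e') * (x `^ b / b) = psi1 / b * x `^ b - e' / b * x `^ b by field; rewrite gt_eqF.
rewrite q1 in Up; rewrite q2 in Lo.
rewrite ler_norml; apply/andP; split; first by rewrite lerBrDl.
by rewrite lerBlDl.
Qed.

End survival.

Section compare.
Context (R : realType).

Lemma ge0_derive_ge0 (f df : R -> R) (x : R) :
  (forall y : R, is_derive y 1 f (df y)) -> (forall y, 0 <= y <= x -> 0 <= df y) ->
  f 0 = 0 -> 0 <= x -> 0 <= f x.
Proof.
move=> dfE df0 f0 x0; rewrite -f0.
apply: (@ger0_derive1_ndecr _ f 0 x) => //.
- move=> y; rewrite in_itv/= => /andP[y0 yx]; rewrite derive1E.
  by have h := dfE y; rewrite derive_val df0// !ltW.
- apply: continuous_subspaceT => y; apply: differentiable_continuous; apply/derivable1_diffP.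
  by have := dfE y; apply: @ex_derive.
Qed.

Lemma is_derive_mull (k y : R) : is_derive y 1 (fun x : R => k * x) k.
Proof. by apply: is_derive_eq; rewrite /GRing.scale/= mulr1. Qed.

Lemma is_derive_affine (k c y : R) : is_derive y 1 (fun x : R => k * x + c) k.
Proof. by have h := is_derive_mull k y; apply: is_derive_eq; rewrite addr0. Qed.

Lemma is_derive_monomial (k y : R) n :
  is_derive y 1 (fun x : R => k * x ^+ n.+1) (k * (n.+1%:R * y ^+ n)).
Proof.
have h : is_derive y 1 (fun x : R => x ^+ n.+1) (n.+1%:R * y ^+ n).
  have -> : (fun x : R => x ^+ n.+1) = (@id R) ^+ n.+1.
    by apply/funext => x; rewrite fctE.
  by apply: is_derive_eq; rewrite /GRing.scale/= mulr1.
by apply: is_derive_eq.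
Qed.

End compare.

Lemma nneseries_EFin_cvg (R : realType) (u : nat -> R) (l : R) :
  \sum_(m < n) u m @[n --> \oo] --> l -> (\sum_(0 <= m <oo) (u m)%:E = l%:E)%E.
Proof.
move=> h; apply/cvg_lim => //.
have h2 : (\sum_(m < n) u m)%:E @[n --> \oo] --> l%:E.
  by apply: cvg_EFin => //; exact: nearW.
apply: cvg_trans h2.
by apply: near_eq_cvg; apply: nearW => n /=; rewrite sumEFin big_mkord.
Qed.

Section poisson_characters.
Context (R : realType) (theta : R).

Let f (c x : R) := expR (x * cos theta) * cos (x * sin theta + c).
Let S n (c x : R) := \sum_(m < n) x ^+ m / m`!%:R * cos (m%:R * theta + c).

Let df c (x : R) : is_derive x 1 (f c) (f (c + theta) x).
Proof.
have h1 : is_derive x 1 (fun x => expR (x * cos theta)) (expR (x * cos theta) * cos theta).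
  have h := is_derive_mull (cos theta) x.
  have -> : (fun x => expR (x * cos theta)) = expR \o (fun x => cos theta * x).
    by apply/funext => y /=; rewrite mulrC.
  by rewrite [in X in is_derive _ _ _ X]mulrC [X in expR X]mulrC mulrC; exact: is_derive1_comp.
have h2 : is_derive x 1 (fun x => cos (x * sin theta + c)) (- sin (x * sin theta + c) * sin theta).
  have h := is_derive_affine (sin theta) c x.
  have -> : (fun x => cos (x * sin theta + c)) = cos \o (fun x => sin theta * x + c).
    by apply/funext => y /=; rewrite [y * _]mulrC.
  by rewrite [x * _]mulrC; exact: is_derive1_comp.
apply: is_derive_eq; rewrite /GRing.scale/= /f addrA [cos (_ + theta)]cosD; ring.
Qed.

Let dS n c (x : R) : is_derive x 1 (S n.+1 c) (S n (c + theta) x).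
Proof.
have hm (m : nat) : is_derive x 1 (fun x : R => x ^+ m.+1 / m.+1`!%:R * cos (m.+1%:R * theta + c))
    (x ^+ m / m`!%:R * cos (m%:R * theta + (c + theta))).
  have -> : m.+1%:R * theta + c = m%:R * theta + (c + theta).
    by rewrite -natr1; ring.
  have -> : (fun x : R => x ^+ m.+1 / m.+1`!%:R * cos (m%:R * theta + (c + theta))) =
     (fun x : R => (cos (m%:R * theta + (c + theta)) / m.+1`!%:R) * x ^+ m.+1).
    by apply/funext => y; ring.
  apply: (is_derive_eq (is_derive_monomial _ _ _)); rewrite factS natrM; field.
  by rewrite nat1r !pnatr_eq0 -!lt0n fact_gt0.
have -> : S n.+1 c = (fun x => cos c + \sum_(m < n) x ^+ m.+1 / m.+1`!%:R * cos (m.+1%:R * theta + c)).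
  apply/funext => y; rewrite /S big_ord_recl/= expr0 fact0 divr1 mul1r mul0r add0r.
  by congr (_ + _); apply: eq_bigr => i _.
have h : is_derive x 1 (fun x => \sum_(m < n) x ^+ m.+1 / m.+1`!%:R * cos (m.+1%:R * theta + c)) (S n (c + theta) x).
  have -> : (fun x : R => \sum_(m < n) x ^+ m.+1 / m.+1`!%:R * cos (m.+1%:R * theta + c)) =
     \sum_(m < n) (fun x : R => x ^+ m.+1 / m.+1`!%:R * cos (m.+1%:R * theta + c)).
    by apply/funext => y; rewrite fct_sumE.
  by apply: is_derive_sum.
by apply: is_derive_eq; rewrite add0r mul1r.
Qed.

Let taylor n (M x c : R) : 0 <= x <= M -> `|f c x - S n c x| <= expR M * (x ^+ n / n`!%:R).
Proof.
elim: n x c => [x c|n ih x c] /andP[x0 xM].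
  rewrite /S big_ord0 subr0 expr0 fact0 divr1 mulr1 /f normrM.
  rewrite -[leRHS]mulr1 ler_pM ?cos_max// ger0_norm ?expR_ge0// ler_expR.
  by rewrite (le_trans _ xM)// ler_piMr// cos_le1.
have dE (y : R) : is_derive y 1 (fun y : R => expR M * (y ^+ n.+1 / n.+1`!%:R)) (expR M * (y ^+ n / n`!%:R)).
  have -> : (fun y : R => expR M * (y ^+ n.+1 / n.+1`!%:R)) = (fun y : R => (expR M / n.+1`!%:R) * y ^+ n.+1).
    by apply/funext => z; ring.
  apply: (is_derive_eq (is_derive_monomial _ _ _)); rewrite factS natrM; field.
  by rewrite nat1r !pnatr_eq0 -!lt0n fact_gt0.
have D0 : f c 0 - S n.+1 c 0 = 0.
  rewrite /f /S !mul0r expR0 add0r mul1r big_ord_recl/= expr0 fact0 divr1 mul1r mul0r add0r.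
  by rewrite big1 ?addr0 ?subrr// => i _; rewrite expr0n/= mul0r mul0r.
rewrite ler_norml; apply/andP; split.
- rewrite -subr_ge0 opprK addrC.
  pose g (y : R) := expR M * (y ^+ n.+1 / n.+1`!%:R) + (f c y - S n.+1 c y).
  suff : 0 <= g x by [].
  apply: (@ge0_derive_ge0 _ g (fun y => expR M * (y ^+ n / n`!%:R) + (f (c + theta) y - S n (c + theta) y))); last exact: x0.
  + by move=> y; have h1 := dE y; have h2 := df c y; have h3 := dS n c y; apply: is_derive_eq.
  + move=> y /andP[y0 yx]; have := ih y (c + theta); rewrite y0 (le_trans yx)// => /(_ isT).
    by rewrite ler_norml => /andP[+ _]; rewrite -subr_ge0 opprK addrC.
  + by rewrite /g D0 addr0 expr0n/= mul0r mulr0.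
- rewrite -subr_ge0.
  pose g (y : R) := expR M * (y ^+ n.+1 / n.+1`!%:R) - (f c y - S n.+1 c y).
  suff : 0 <= g x by [].
  apply: (@ge0_derive_ge0 _ g (fun y => expR M * (y ^+ n / n`!%:R) - (f (c + theta) y - S n (c + theta) y))); last exact: x0.
  + by move=> y; have h1 := dE y; have h2 := df c y; have h3 := dS n c y; apply: is_derive_eq.
  + move=> y /andP[y0 yx]; have := ih y (c + theta); rewrite y0 (le_trans yx)// => /(_ isT).
    by rewrite ler_norml => /andP[_]; rewrite -subr_ge0.
  + by rewrite /g D0 subr0 expr0n/= mul0r mulr0.
Qed.

Let S_cvg c x : 0 <= x -> S n c x @[n --> \oo] --> f c x.
Proof.
move=> x0; apply/cvgrPdist_le => e e0.
have : expR x * (x ^+ n / n`!%:R) @[n --> \oo] --> (0 : R).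
  rewrite -[X in _ --> X](mulr0 (expR x)); apply: cvgM; first exact: cvg_cst.
  exact: cvg_exp_coeff.
move/cvgr_lt => /(_ _ e0); apply: filterS => n h.
rewrite (le_trans _ (ltW h))//; apply: taylor; by rewrite x0 lexx.
Qed.

(** The Poisson law integrates a shifted character in closed form. *)
Lemma poisson_sum_cos (x c : R) : 0 < x ->
  (\sum_(0 <= m <oo) (poisson_pmf x m * (1 + cos (m%:R * theta + c)))%:E =
   (1 + expR (- (x * (1 - cos theta))) * cos (x * sin theta + c))%:E)%E.
Proof.
move=> x0.
have e1 : series (exp_coeff x) n @[n --> \oo] --> expR x.
  exact: is_cvg_series_exp_coeff.
have -> : 1 + expR (- (x * (1 - cos theta))) * cos (x * sin theta + c) = expR (- x) * (expR x + f c x).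
  have e2 : expR (- x) * expR x = 1 by rewrite -expRD addNr expR0.
  have e3 : expR (- (x * (1 - cos theta))) = expR (- x) * expR (x * cos theta).
    by rewrite -expRD; congr expR; ring.
  by rewrite e3 [RHS]mulrDr e2 /f mulrA.
have h : expR (- x) * (series (exp_coeff x) n + S n c x) @[n --> \oo] --> expR (- x) * (expR x + f c x).
  apply: cvgM; first exact: cvg_cst.
  by apply: cvgD => //; by apply: S_cvg; exact: ltW.
apply: nneseries_EFin_cvg; apply: cvg_trans h.
apply: near_eq_cvg; apply: nearW => n /=.
rewrite /series/= /S big_mkord -big_split/= mulr_sumr; apply: eq_bigr => m _.
by rewrite /poisson_pmf x0 /exp_coeff/=; ring.
Qed.

End poisson_characters.

Section poisson_moments.
Context (R : realType).

Variable x : R.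
Hypothesis x0 : 0 < x.

Let pmfE m : poisson_pmf x m = expR (- x) * (x ^+ m / m`!%:R).
Proof. by rewrite /poisson_pmf x0 mulrC. Qed.

Let pmfS m : poisson_pmf x m.+1 * m.+1%:R = x * poisson_pmf x m.
Proof.
rewrite !pmfE factS natrM exprS; field.
by rewrite nat1r !pnatr_eq0 -!lt0n fact_gt0.
Qed.

Let total : \sum_(m < n) poisson_pmf x m @[n --> \oo] --> (1 : R).
Proof.
have -> : (fun n => \sum_(m < n) poisson_pmf x m) = (fun n => expR (- x) * series (exp_coeff x) n).
  by apply/funext => n; rewrite /series/= big_mkord mulr_sumr; apply: eq_bigr => m _; rewrite pmfE.
rewrite -(expR0 R) -(subrr x) addrC expRD; apply: cvgM; first exact: cvg_cst.
exact: is_cvg_series_exp_coeff.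
Qed.

Let first : \sum_(m < n) (poisson_pmf x m * m%:R) @[n --> \oo] --> x.
Proof.
rewrite -cvg_shiftS /=.
have -> : (fun n => \sum_(m < n.+1) (poisson_pmf x m * m%:R)) = (fun n => x * \sum_(m < n) poisson_pmf x m).
  by apply/funext => n; rewrite big_ord_recl/= mulr0 add0r mulr_sumr; apply: eq_bigr => m _; rewrite pmfS.
have h : x * \sum_(m < n) poisson_pmf x m @[n --> \oo] --> x * 1.
  by apply: cvgM; [exact: cvg_cst|exact: total].
by rewrite mulr1 in h.
Qed.

Let second : \sum_(m < n) (poisson_pmf x m * m%:R ^+ 2) @[n --> \oo] --> x * (x + 1).
Proof.
rewrite -cvg_shiftS /=.
have -> : (fun n => \sum_(m < n.+1) (poisson_pmf x m * m%:R ^+ 2)) =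
    (fun n => x * (\sum_(m < n) (poisson_pmf x m * m%:R) + \sum_(m < n) poisson_pmf x m)).
  apply/funext => n; rewrite big_ord_recl/= expr0n/= mulr0 add0r -big_split/= mulr_sumr.
  by apply: eq_bigr => m _; rewrite /bump/= add1n expr2 mulrA pmfS -natr1; ring.
apply: cvgM; first exact: cvg_cst.
by apply: cvgD; [exact: first|exact: total].
Qed.

Lemma poisson_sum1 : (\sum_(0 <= m <oo) (poisson_pmf x m)%:E = 1)%E.
Proof. exact: nneseries_EFin_cvg total. Qed.

Lemma poisson_mean : (\sum_(0 <= m <oo) (poisson_pmf x m * m%:R)%:E = x%:E)%E.
Proof. exact: nneseries_EFin_cvg first. Qed.

Lemma poisson_second_moment :
  (\sum_(0 <= m <oo) (poisson_pmf x m * m%:R ^+ 2)%:E = (x * (x + 1))%:E)%E.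
Proof. exact: nneseries_EFin_cvg second. Qed.

End poisson_moments.

Section trigonometric_bounds.
Context (R : realType).
Implicit Types x : R.

Lemma sin_le_id x : 0 <= x -> sin x <= x.
Proof.
move=> x0; rewrite -subr_ge0.
apply: (@ge0_derive_ge0 _ (fun y => y - sin y) (fun y => 1 - cos y)); last exact: x0.
- by move=> y _; rewrite subr_ge0 cos_le1.
- by rewrite sin0 subr0.
Qed.

Lemma onemcos_le_id x : 0 <= x -> 1 - cos x <= x.
Proof.
move=> x0; rewrite -subr_ge0.
apply: (@ge0_derive_ge0 _ (fun y => y - (1 - cos y)) (fun y => 1 - sin y)); last exact: x0.
- by move=> y; apply: is_derive_eq; ring.
- by move=> y _; rewrite subr_ge0 sin_le1.
- by rewrite cos0 subrr subr0.
Qed.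

Lemma cos_ge_sqr x : 0 <= x -> 0 <= cos x - 1 + 2^-1 * x ^+ 2.
Proof.
move=> x0.
apply: (@ge0_derive_ge0 _ (fun y => cos y - 1 + 2^-1 * y ^+ 2) (fun y => y - sin y)); last exact: x0.
- move=> y; have h := is_derive_monomial 2^-1 y 1.
  by apply: is_derive_eq; field.
- by move=> y /andP[y0 _]; rewrite subr_ge0 sin_le_id.
- by rewrite cos0 expr0n/= mulr0 subrr addr0.
Qed.

Lemma sin_ge_cube x : 0 <= x -> 0 <= sin x - x + 6^-1 * x ^+ 3.
Proof.
move=> x0.
apply: (@ge0_derive_ge0 _ (fun y => sin y - y + 6^-1 * y ^+ 3) (fun y => cos y - 1 + 2^-1 * y ^+ 2)); last exact: x0.
- move=> y; have h := is_derive_monomial 6^-1 y 2.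
  by apply: is_derive_eq; field.
- by move=> y /andP[y0 _]; rewrite cos_ge_sqr.
- by rewrite sin0 expr0n/= mulr0 subrr addr0.
Qed.

Lemma cos_le_pow4 x : 0 <= x -> 0 <= 1 - 2^-1 * x ^+ 2 + 24^-1 * x ^+ 4 - cos x.
Proof.
move=> x0.
apply: (@ge0_derive_ge0 _ (fun y => 1 - 2^-1 * y ^+ 2 + 24^-1 * y ^+ 4 - cos y)
   (fun y => sin y - y + 6^-1 * y ^+ 3)); last exact: x0.
- move=> y; have h := is_derive_monomial 24^-1 y 3; have h' := is_derive_monomial 2^-1 y 1.
  by apply: is_derive_eq; field.
- by move=> y /andP[y0 _]; rewrite sin_ge_cube.
- by rewrite cos0 !expr0n/= !mulr0 subr0 addr0 subrr.
Qed.

Lemma norm_sin_le x : `|sin x| <= `|x|.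
Proof.
wlog x0 : x / 0 <= x => [h|].
  have [/h//|/ltW x0] := leP 0 x.
  by rewrite -normrN -sinN -[leRHS]normrN h// oppr_ge0.
rewrite (ger0_norm x0) ler_norml sin_le_id// andbT.
have [xp|px] := leP x pi; first by rewrite (@le_trans _ _ 0) ?oppr_le0// sin_ge0_pi// x0.
by rewrite (le_trans _ (sin_geN1 x))// lerN2 (le_trans _ (ltW px))// (le_trans _ (pi_ge2 R)) ?ler1n.
Qed.

Lemma norm_onemcos_le x : `|1 - cos x| <= `|x|.
Proof.
rewrite ger0_norm ?subr_ge0 ?cos_le1// -cos_norm; exact: onemcos_le_id.
Qed.

Lemma cos_taylor x : `|x| <= 1 -> `|1 - cos x - x ^+ 2 / 2| <= 24^-1 * `|x| ^+ 3.
Proof.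
move=> x1; rewrite -cos_norm -(real_normK (num_real x)).
set y := `|x|; have y0 : 0 <= y by exact: normr_ge0.
have h1 := cos_ge_sqr y0; have h2 := cos_le_pow4 y0.
have h3 : y ^+ 4 <= y ^+ 3 by rewrite exprS ler_piMl// exprn_ge0.
by rewrite ler_norml; apply/andP; split; lra.
Qed.

Lemma sin_taylor x : `|sin x - x| <= 6^-1 * `|x| ^+ 3.
Proof.
wlog x0 : x / 0 <= x => [h|].
  have [/h//|/ltW x0] := leP 0 x.
  have := h (- x); rewrite oppr_ge0 x0 => /(_ isT).
  by rewrite sinN normrN -opprD normrN.
rewrite (ger0_norm x0); have h1 := sin_ge_cube x0; have h2 := sin_le_id x0.
have h3 : 0 <= x ^+ 3 by rewrite exprn_ge0.
by rewrite ler_norml; apply/andP; split; lra.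
Qed.

Lemma expRN_le1 (z : R) : 0 <= z -> expR (- z) <= 1.
Proof. by move=> z0; rewrite -expR0 ler_expR oppr_le0. Qed.

Lemma expRN_lipschitz (a b : R) : 0 <= a -> 0 <= b -> `|expR (- a) - expR (- b)| <= `|a - b|.
Proof.
wlog ab : a b / a <= b => [h a0 b0|a0 b0].
  have [ab|/ltW ab] := leP a b; first exact: h.
  by rewrite distrC [leRHS]distrC h.
rewrite ger0_norm ?subr_ge0 ?ler_expR ?lerN2// distrC ger0_norm ?subr_ge0//.
have -> : expR (- b) = expR (- a) * expR (- (b - a)) by rewrite -expRD; congr expR; ring.
rewrite -[X in X - _]mulr1 -mulrBr.
have h1 : 0 <= 1 - expR (- (b - a)).
  by rewrite subr_ge0 -expR0 ler_expR oppr_le0 subr_ge0.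
have h2 : 1 - expR (- (b - a)) <= b - a.
  by have := expR_ge1Dx (- (b - a)); lra.
apply: le_trans h2; rewrite ler_piMl// -expR0 ler_expR oppr_le0//.
Qed.

Lemma min2_le_expR (t u : R) : 0 <= t -> u <= 2 -> u <= t -> u <= 3 * (1 - expR (- t)).
Proof.
move=> t0 u2 ut.
have h : expR (- t) <= (1 + t)^-1.
  by rewrite expRN lef_pV2 ?posrE ?expR_gt0 ?expR_ge1Dx//; lra.
suff : u <= 3 * (1 - (1 + t)^-1) by lra.
have t1 : 0 < 1 + t by lra.
have -> : 3 * (1 - (1 + t)^-1) = 3 * t / (1 + t) by field; rewrite gt_eqF.
rewrite ler_pdivlMr//; have [t2|t2] := leP t 2.
  by apply: (@le_trans _ _ (t * (1 + t))); [rewrite ler_wpM2r// ltW|nra].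
by apply: (@le_trans _ _ (2 * (1 + t))); [rewrite ler_wpM2r// ltW|lra].
Qed.

Lemma poisson_cf_gaussian (m t : R) : 0 < m -> `|t| <= 1 ->
  `|expR (- (m * (1 - cos t))) * cos (m * sin t - t * m) - expR (- (m * (t ^+ 2 / 2)))|
   <= 3 * (1 - expR (- (m * `|t| ^+ 3))).
Proof.
move=> m0 t1; have m0' := ltW m0.
have t3 : 0 <= m * `|t| ^+ 3 by rewrite mulr_ge0 ?exprn_ge0.
have a0 : 0 <= m * (1 - cos t) by rewrite mulr_ge0// subr_ge0 cos_le1.
have b0 : 0 <= m * (t ^+ 2 / 2) by rewrite mulr_ge0// divr_ge0// sqr_ge0.
have e1 := expRN_le1.
apply: min2_le_expR => //.
  rewrite (le_trans (ler_normB _ _))// (natrD _ 1 1) lerD// ?normrM.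
    by rewrite mulr_ile1 ?cos_max// ger0_norm ?expR_ge0// e1.
  by rewrite ger0_norm ?expR_ge0// e1.
have -> : expR (- (m * (1 - cos t))) * cos (m * sin t - t * m) - expR (- (m * (t ^+ 2 / 2))) =
   (expR (- (m * (1 - cos t))) - expR (- (m * (t ^+ 2 / 2)))) -
   expR (- (m * (1 - cos t))) * (1 - cos (m * sin t - t * m)) by ring.
have l1 : `|expR (- (m * (1 - cos t))) - expR (- (m * (t ^+ 2 / 2)))| <= m * (24^-1 * `|t| ^+ 3).
  rewrite (le_trans (expRN_lipschitz a0 b0))// -mulrBr normrM (ger0_norm m0').
  by rewrite ler_wpM2l// cos_taylor.
have l2 : `|expR (- (m * (1 - cos t))) * (1 - cos (m * sin t - t * m))| <= m * (6^-1 * `|t| ^+ 3).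
  rewrite normrM ger0_norm ?expR_ge0//.
  rewrite (le_trans (ler_wpM2r _ (e1 _ a0)))// mul1r (le_trans (norm_onemcos_le _))//.
  by rewrite [t * m]mulrC -mulrBr normrM (ger0_norm m0') ler_wpM2l// sin_taylor.
by rewrite (le_trans (ler_normB _ _))//; lra.
Qed.

Lemma poisson_cf_sin (m t : R) : 0 < m ->
  `|expR (- (m * (1 - cos t))) * sin (m * sin t - t * m)|
   <= 3 * (1 - expR (- (m * `|t| ^+ 3))).
Proof.
move=> m0; have m0' := ltW m0.
have t3 : 0 <= m * `|t| ^+ 3 by rewrite mulr_ge0 ?exprn_ge0.
have a0 : 0 <= m * (1 - cos t) by rewrite mulr_ge0// subr_ge0 cos_le1.
have e1 : expR (- (m * (1 - cos t))) <= 1 by exact: expRN_le1.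
have le1 : `|expR (- (m * (1 - cos t))) * sin (m * sin t - t * m)| <= `|sin (m * sin t - t * m)|.
  by rewrite normrM ger0_norm ?expR_ge0// ler_piMl.
apply: min2_le_expR => //; first by rewrite (le_trans le1)// (le_trans (sin_max _))// ler1n.
rewrite (le_trans le1)// (le_trans (norm_sin_le _))// [t * m]mulrC -mulrBr normrM (ger0_norm m0').
rewrite ler_wpM2l// (le_trans (sin_taylor _))// ler_piMl ?exprn_ge0//.
by rewrite invf_le1// ler1n.
Qed.

End trigonometric_bounds.

Section conditional_transfer.
Context d (T : measurableType d) (R : realType) (P : probability T R).
Import HBNNSimple.

Lemma transfer_cond_expectation (alpha Y Z : T -> R) (g : R -> R) :
  measurable_fun setT alpha -> measurable_fun setT Y -> measurable_fun setT Z ->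
  (forall w, 0 <= Y w) -> (forall w, 0 <= Z w) ->
  (forall B, measurable B -> \int[P]_(w in alpha @^-1` B) (Y w)%:E =
     \int[P]_(w in alpha @^-1` B) (Z w)%:E)%E ->
  measurable_fun setT g -> (forall a, 0 <= g a) ->
  (\int[P]_w (Y w * g (alpha w))%:E = \int[P]_w (Z w * g (alpha w))%:E)%E.
Proof.
move=> malpha mY mZ Y0 Z0 YZ mg g0.
have mgE : measurable_fun setT (EFin \o g) by exact/measurable_EFinP.
pose g_ := nnsfun_approx measurableT mgE.
have mgn n : measurable_fun setT (fun w => g_ n (alpha w)).
  by have := measurableT_comp (measurable_funPT (g_ n)) malpha; exact.
have preB n r : measurable (alpha @^-1` (g_ n @^-1` [set r])).
  by rewrite -[X in measurable X]setTI; apply: malpha.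
(* for a simple function both integrals are the same finite combination *)
have simple (F : T -> R) n : measurable_fun setT F -> (forall w, 0 <= F w) ->
    (\int[P]_w (F w * g_ n (alpha w))%:E =
     \sum_(r \in range (g_ n)) r%:E * \int[P]_(w in alpha @^-1` (g_ n @^-1` [set r])) (F w)%:E)%E.
  move=> mF F0.
  transitivity (\int[P]_w (\sum_(r \in range (g_ n)) (F w * (r * \1_(g_ n @^-1` [set r]) (alpha w)))%:E))%E.
    apply: eq_integral => w _; rewrite fsumEFin//; congr EFin.
    rewrite {1}fimfunE mulr_fsumr//.
  have nn r w : 0 <= r * \1_(g_ n @^-1` [set r]) (alpha w).
    by have := nnfun_muleindic_ge0 (g_ n) r (alpha w); rewrite -EFinM lee_fin.
  have mi r : measurable_fun setT (fun w => (\1_(g_ n @^-1` [set r]) (alpha w) : R)).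
    have h : measurable_fun setT (\1_(g_ n @^-1` [set r]) : R -> R) by apply: measurable_indic.
    by have := measurableT_comp h malpha; exact.
  rewrite ge0_integral_fsum//; last 2 first.
  - by move=> r; apply/measurable_EFinP; apply: measurable_funM => //; apply: measurable_funM.
  - by move=> r w _; rewrite lee_fin mulr_ge0.
  apply: eq_fsbigr => r; rewrite inE => -[x _ xr].
  have r0 : 0 <= r by rewrite -xr.
  rewrite -ge0_integralZl//; last 2 first.
  - exact/measurable_EFinP/measurable_funTS.
  - by move=> w _; rewrite lee_fin.
  rewrite [RHS]integral_mkcond; apply: eq_integral => w _.
  rewrite patchE indicE; case: (boolP (w \in _)); rewrite ?inE ?notin_setE => aw.
    by rewrite mem_set//= mulr1 -EFinM mulrC.
  by rewrite memNset//= !mulr0.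
have lim (F : T -> R) : measurable_fun setT F -> (forall w, 0 <= F w) ->
   (\int[P]_w (F w * g_ n (alpha w))%:E @[n --> \oo] --> \int[P]_w (F w * g (alpha w))%:E)%E.
  move=> mF F0.
  have -> : (\int[P]_w (F w * g (alpha w))%:E)%E =
      (\int[P]_w (limn (fun n => (F w * g_ n (alpha w))%:E)))%E.
    apply: eq_integral => w _; apply/esym/cvg_lim => //.
    have h := cvg_nnsfun_approx measurableT mgE (fun x _ => g0 x) (I : setT (alpha w)).
    have {h} h : g_ n (alpha w) @[n --> \oo] --> g (alpha w) by move/fine_cvg : h; exact.
    have h2 : F w * g_ n (alpha w) @[n --> \oo] --> F w * g (alpha w).
      by apply: cvgM => //; exact: cvg_cst.
    by apply: cvg_EFin => //; exact: nearW.
  apply: cvg_monotone_convergence => //.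
  - by move=> n; apply/measurable_EFinP/measurable_funM.
  - by move=> n w _; rewrite lee_fin mulr_ge0.
  - move=> w _ m n mn; rewrite lee_fin ler_wpM2l//.
    by have /lefP := nd_nnsfun_approx measurableT mgE mn; apply.
have hY := lim Y mY Y0; have hZ := lim Z mZ Z0.
have E n : (\int[P]_w (Y w * g_ n (alpha w))%:E = \int[P]_w (Z w * g_ n (alpha w))%:E)%E.
  rewrite (simple Y)// (simple Z)//; apply: eq_fsbigr => r _; rewrite YZ//.
by move: hY; under eq_fun do rewrite E; move=> hY; exact: (cvg_unique _ hY hZ).
Qed.

End conditional_transfer.

Section cond_pmf.
Context d (T : measurableType d) (R : realType) (P : probability T R).

(** [X] has conditional probability mass function [p a] on the event [alpha = a]. *)
Definition cond_pmf (alpha : T -> R) (X : T -> nat) (p : R -> nat -> R) :=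
  forall B m, measurable B -> (P (alpha @^-1` B `&` X @^-1` [set m]) =
    \int[P]_(w in alpha @^-1` B) (p (alpha w) m)%:E)%E.

Variables (alpha : T -> R) (X : T -> nat) (p : R -> nat -> R).
Hypothesis malpha : measurable_fun setT alpha.
Hypothesis mX : measurable_fun setT X.
Hypothesis mp : forall m, measurable_fun setT (p ^~ m).
Hypothesis p0 : forall a m, 0 <= p a m.
Hypothesis aXp : cond_pmf alpha X p.

Let mXm m : measurable (X @^-1` [set m]).
Proof. by rewrite -[Y in measurable Y]setTI; exact: mX. Qed.

Lemma cond_pmf_expectation (h : R -> nat -> R) :
  (forall m, measurable_fun setT (h ^~ m)) -> (forall a m, 0 <= h a m) ->
  (\int[P]_w (h (alpha w) (X w))%:E =
   \int[P]_w (\sum_(0 <= m <oo) (p (alpha w) m * h (alpha w) m)%:E))%E.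
Proof.
move=> mh h0.
have mha m : measurable_fun setT (fun w => h (alpha w) m).
  by have := measurableT_comp (mh m) malpha; exact.
have mpa m : measurable_fun setT (fun w => p (alpha w) m).
  by have := measurableT_comp (mp m) malpha; exact.
transitivity (\int[P]_w (\sum_(0 <= m <oo) (\1_(X @^-1` [set m]) w * h (alpha w) m)%:E))%E.
  apply: eq_integral => w _; apply/esym; rewrite (@nneseriesD1 _ _ (X w))//.
    rewrite indicE mem_set// mul1r eseries0 ?adde0// => m _ mX'.
    by rewrite indicE memNset ?mul0r//= => /esym/eqP; rewrite (negbTE mX').
  by move=> m _; rewrite lee_fin mulr_ge0.
rewrite integral_nneseries//; last 2 first.
- by move=> m; apply/measurable_EFinP/measurable_funM => //; exact: measurable_indic.
- by move=> m w _; rewrite lee_fin mulr_ge0.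
rewrite integral_nneseries//; last 2 first.
- by move=> m; apply/measurable_EFinP/measurable_funM.
- by move=> m w _; rewrite lee_fin mulr_ge0.
apply: eq_eseriesr => m _.
apply: (@transfer_cond_expectation _ _ _ P alpha (\1_(X @^-1` [set m])) (fun w => p (alpha w) m) (h ^~ m)) => //.
move=> B mB; rewrite -aXp// integral_indic//; first by rewrite setIC.
by rewrite -[Y in measurable Y]setTI; exact: malpha.
Qed.

End cond_pmf.

Lemma measurable_inv (R : realType) : measurable_fun setT (fun x : R => x^-1).
Proof.
have mp : measurable_fun setT (fun x : R => x `^ (-1)) by exact: measurable_powR.
have mn : measurable_fun setT (fun x : R => - ((- x) `^ (-1))).
  apply: measurable_funN.
  by have := measurableT_comp mp (@oppr_measurable R setT); exact.
have -> : (fun x : R => x^-1) = (fun x => if 0 < x then x `^ (-1) else if x < 0 then - ((- x) `^ (-1)) else 0).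
  apply/funext => x; case: ltgtP => x0; last by rewrite -x0 invr0.
  - by rewrite powR_inv1 ?(ltW x0).
  - by rewrite powR_inv1 ?oppr_ge0 ?(ltW x0)// invrN opprK.
apply: measurable_fun_ifT => //; first exact: measurable_fun_ltr.
by apply: measurable_fun_ifT => //; exact: measurable_fun_ltr.
Qed.

Section poisson_identities.
Context (R : realType).

Lemma poisson_pmfE (x : R) m : 0 < x -> poisson_pmf x m = x ^+ m / m`!%:R * expR (- x).
Proof. by rewrite /poisson_pmf => ->. Qed.

Lemma poisson_thinning_term (mu a : R) u v : 0 < mu -> 0 < a < 1 ->
  poisson_pmf mu (u + v) * ('C(u + v, u)%:R * a ^+ u * (1 - a) ^+ v) =
  poisson_pmf (a * mu) u * poisson_pmf ((1 - a) * mu) v.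
Proof.
move=> m0 /andP[a0 a1]; have a1' : 0 < 1 - a by rewrite subr_gt0.
rewrite !poisson_pmfE ?mulr_gt0//.
have e : expR (- mu) = expR (- (a * mu)) * expR (- ((1 - a) * mu)).
  by rewrite -expRD; congr expR; ring.
have h : 'C(u + v, u)%:R * (u`!%:R * v`!%:R) = (u + v)`!%:R :> R.
  by rewrite -!natrM -(bin_fact (leq_addr v u)) addKn.
have fu : u`!%:R != 0 :> R by rewrite pnatr_eq0 -lt0n fact_gt0.
have fv : v`!%:R != 0 :> R by rewrite pnatr_eq0 -lt0n fact_gt0.
have fuv : 'C(u + v, u)%:R != 0 :> R by rewrite pnatr_eq0 -lt0n bin_gt0 leq_addr.
rewrite e -h !exprMn exprD; field.
by rewrite fu fv fuv.
Qed.

Lemma poisson_thinning (mu a : R) u : 0 < mu -> 0 < a < 1 ->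
  (\sum_(0 <= x <oo) (poisson_pmf mu x * ('C(x, u)%:R * a ^+ u * (1 - a) ^+ (x - u)))%:E =
   (poisson_pmf (a * mu) u)%:E)%E.
Proof.
move=> m0 a01; have /andP[a0 a1] := a01.
pose t x : R := poisson_pmf mu x * ('C(x, u)%:R * a ^+ u * (1 - a) ^+ (x - u)).
have t0 x : (0 <= (t x)%:E)%E.
  by rewrite lee_fin !mulr_ge0 ?poisson_pmf_ge0 ?exprn_ge0 ?subr_ge0 ?(ltW a0) ?(ltW a1).
rewrite (@nneseries_split _ (fun x => (t x)%:E) 0%N u)// add0n big1_seq ?add0e; last first.
  move=> x; rewrite mem_index_iota /= => xu.
  by rewrite /t bin_small// !mul0r mulr0.
rewrite -nneseries_addn//=.
under eq_eseriesr => v _.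
  rewrite /t addnC addKn poisson_thinning_term// EFinM; over.
rewrite /= nneseriesZl; last by move=> v _; rewrite lee_fin poisson_pmf_ge0.
by rewrite poisson_sum1 ?mule1// mulr_gt0// subr_gt0.
Qed.

Lemma poisson_convolution (a c : R) y : 0 < a -> 0 < c ->
  \sum_(u < y.+1) poisson_pmf a u * poisson_pmf c (y - u) = poisson_pmf (a + c) y.
Proof.
move=> a0 c0; rewrite poisson_pmfE ?addr_gt0// addrC exprDn mulr_suml mulr_suml.
apply: eq_bigr => -[u /=]; rewrite ltnS => uy _.
rewrite !poisson_pmfE// opprD expRD.
have h : 'C(y, u)%:R * (u`!%:R * (y - u)`!%:R) = y`!%:R :> R.
  by rewrite -!natrM -(bin_fact uy).
have fu : u`!%:R != 0 :> R by rewrite pnatr_eq0 -lt0n fact_gt0.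
have fv : (y - u)`!%:R != 0 :> R by rewrite pnatr_eq0 -lt0n fact_gt0.
have fuv : 'C(y, u)%:R != 0 :> R by rewrite pnatr_eq0 -lt0n bin_gt0.
rewrite -h -mulr_natr; field.
by rewrite fu fv fuv.
Qed.

End poisson_identities.

Section partition.
Context d (T : measurableType d) (R : realType) (P : probability T R).

Lemma probability_split (C : set T) (f : T -> nat) :
  measurable C -> measurable_fun setT f ->
  (P C = \sum_(0 <= m <oo) P (C `&` f @^-1` [set m]))%E.
Proof.
move=> mC mf.
have mCf m : measurable (C `&` f @^-1` [set m]).
  by apply: measurableI => //; rewrite -[X in measurable X]setTI; exact: mf.
have -> : P C = P (\bigcup_m (C `&` f @^-1` [set m])).
  by congr (P _); apply/seteqP; split => [w Cw|w [m _ []//]]; exists (f w).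
rewrite measure_semi_bigcup//.
  apply/trivIsetP => i j _ _ ij; apply/seteqP; split => // w [[_ fi] [_ fj]].
  by move: ij; rewrite -fi -fj eqxx.
exact: bigcup_measurable.
Qed.

End partition.

Section INAR_law.
Context d (T : measurableType d) (R : realType) (P : probability T R).
Variables (lambda : R) (alpha : {RV P >-> R}) (X : nat -> {RV P >-> nat}).
Variables (xi : nat -> nat -> {RV P >-> nat}) (eps : nat -> {RV P >-> nat}).
Hypothesis lambda0 : 0 < lambda.
Hypothesis a01 : forall w, 0 < alpha w < 1.
Hypothesis indep : cond_independent alpha (INAR1_inputs (X 0%N) xi eps).
Hypothesis xi_law : forall k j,
  cond_probability P alpha (xi k j @^-1` [set 1%N]) alpha /\
  cond_probability P alpha (xi k j @^-1` [set 0%N]) (fun w => 1 - alpha w).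
Hypothesis eps_law : forall k m,
  cond_probability P alpha (eps k @^-1` [set m]) (fun=> poisson_pmf lambda m).
Hypothesis X0_law : forall m,
  cond_probability P alpha (X 0%N @^-1` [set m]) (fun w => poisson_pmf (lambda / (1 - alpha w)) m).
Hypothesis X_rec : forall k w,
  X k.+1 w = (\sum_(j < X k w) xi k j w + eps k w)%N.

Let I := (unit + nat * nat + nat)%type.
Let Y (i : I) : {RV P >-> nat} := INAR1_inputs (X 0%N) xi eps i.
Let rate (a : R) := lambda / (1 - a).

(* conditional probability that the input [i] takes the value [b] *)
Let ver (i : I) (b : nat) (a : R) : R := match i with
  | inl (inl _) => poisson_pmf (rate a) b
  | inl (inr _) => if b == 1%N then a else 1 - a
  | inr _ => poisson_pmf lambda b
  end.

Let is_coin (i : I) := if i is inl (inr _) then true else false.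
Let good (s : seq I) (b : I -> nat) := forall i, i \in s -> is_coin i -> (b i <= 1)%N.
Let Ev (s : seq I) (b : I -> nat) := \bigcap_(i in [set` s]) (Y i @^-1` [set b i]).
Let prodv (s : seq I) (b : I -> nat) (a : R) := \prod_(i <- s) ver i (b i) a.
Let upd (b : I -> nat) (i : I) (c : nat) := fun i' => if i' == i then c else b i'.
Let pre B : set T := alpha @^-1` B.
Let Lint B (phi : R -> R) := (\int[P]_(w in pre B) (phi (alpha w))%:E)%E.
Let adm (phi : R -> R) := measurable_fun setT phi /\ forall a, 0 < a < 1 -> 0 <= phi a.

Let rate_gt0 a : 0 < a < 1 -> 0 < rate a.
Proof. by move=> /andP[_ a1]; rewrite divr_gt0// subr_gt0. Qed.

Let mrate : measurable_fun setT rate.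
Proof.
apply: measurable_funM => //.
have h : measurable_fun setT (fun a : R => 1 - a) by apply: measurable_funB.
by have := measurableT_comp (@measurable_inv R) h; exact.
Qed.

Let adm_pois m : adm (fun a => poisson_pmf (rate a) m).
Proof.
split; last by move=> a _; exact: poisson_pmf_ge0.
by have := measurableT_comp (@measurable_poisson_pmf R setT m measurableT) mrate; exact.
Qed.

Let adm_ver i b : adm (ver i b).
Proof.
case: i => [[t|kj]|k]; first exact: adm_pois.
  case: (eqVneq b 1%N) => [b1|/negbTE b1]; rewrite /ver b1; split.
  - exact: measurable_id.
  - by move=> a /andP[a0 _]; exact: ltW.
  - exact: measurable_funB.
  - by move=> a /andP[_ a1]; rewrite subr_ge0; exact: ltW.
by split; [exact: measurable_cst | move=> a _; exact: poisson_pmf_ge0].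
Qed.

Let admM phi psi : adm phi -> adm psi -> adm (fun a => phi a * psi a).
Proof.
move=> [m1 p1] [m2 p2]; split; first exact: measurable_funM.
by move=> a a01'; rewrite mulr_ge0 ?p1 ?p2.
Qed.

Let adm_prodv s b : adm (prodv s b).
Proof.
rewrite /prodv; elim: s => [|i s [ihm ih0]].
  split; first by under eq_fun do rewrite big_nil; exact: measurable_cst.
  by move=> a _; rewrite big_nil.
have [m1 p1] := admM (adm_ver i (b i)) (conj ihm ih0).
split; first by under eq_fun do rewrite big_cons.
by move=> a a01'; rewrite big_cons p1.
Qed.

Let adm_bin n u v : adm (fun a => 'C(n, u)%:R * a ^+ u * (1 - a) ^+ v).
Proof.
split; last first.
  by move=> a /andP[a0 a1]; rewrite !mulr_ge0 ?exprn_ge0 ?subr_ge0 ?(ltW a0) ?(ltW a1).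
apply: measurable_funM.
  by apply: measurable_funM => //; exact: measurable_funX.
by apply: measurable_funX; exact: measurable_funB.
Qed.

Let mpre B : measurable B -> measurable (pre B).
Proof. by move=> mB; exact: measurable_funPTI. Qed.

Let madm phi : adm phi -> measurable_fun setT (fun w => phi (alpha w)).
Proof. by move=> [m _]; have := measurableT_comp m (measurable_funPT alpha); exact. Qed.

Let eq_Lint B phi psi : (forall a, 0 < a < 1 -> phi a = psi a) -> Lint B phi = Lint B psi.
Proof. by move=> e; apply: eq_integral => w _; rewrite e. Qed.

Let LintD B phi psi : measurable B -> adm phi -> adm psi ->
  (Lint B phi + Lint B psi = Lint B (fun a => (phi a + psi a)%R))%E.
Proof.
move=> mB ap ap'; rewrite /Lint -ge0_integralD//.
- exact: mpre.
- by move=> w _; rewrite lee_fin; case: ap => _; apply.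
- by apply/measurable_EFinP/measurable_funTS/madm.
- by move=> w _; rewrite lee_fin; case: ap' => _; apply.
- by apply/measurable_EFinP/measurable_funTS/madm.
Qed.

Let Lint_series B (phi : nat -> R -> R) (psi : R -> R) : measurable B -> (forall m, adm (phi m)) ->
  (forall a : R, 0 < a < 1 -> (\sum_(0 <= m <oo) (phi m a)%:E = (psi a)%:E)%E) ->
  (\sum_(0 <= m <oo) Lint B (phi m) = Lint B psi)%E.
Proof.
move=> mB ap h; rewrite /Lint -integral_nneseries//.
- by apply: eq_integral => w _; rewrite h.
- exact: mpre.
- by move=> m; apply/measurable_EFinP/measurable_funTS/madm.
- by move=> m w _; rewrite lee_fin; case: (ap m) => _; apply.
Qed.

Let sigma_pre B : measurable B -> g_sigma_algebra_preimage alpha (pre B).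
Proof. by move=> mB; exists B => //; rewrite setTI. Qed.

Let mYi i c : measurable (Y i @^-1` [set c]).
Proof. exact: measurable_funPTI. Qed.

Let mEv s b : measurable (Ev s b).
Proof.
rewrite /Ev bigcap_seq; apply: bigsetI_measurable => i _; exact: mYi.
Qed.

Let Ev_cons i s b c : i \notin s -> Ev (i :: s) (upd b i c) = Y i @^-1` [set c] `&` Ev s b.
Proof.
move=> si; apply/seteqP; split => [w h|w [h1 h2] i' /=].
  split; first by have := h i; rewrite /= mem_head /upd eqxx; exact.
  move=> i' /= i's; have := h i'; rewrite /= inE i's orbT => /(_ isT).
  rewrite /upd; case: eqP => // e; by rewrite -e i's in si.
rewrite inE => /orP[/eqP->|i's]; first by rewrite /upd eqxx.
rewrite /upd; case: eqP => [e|_]; first by rewrite -e i's in si.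
exact: h2.
Qed.

Let prodv_cons i s b c a : i \notin s -> prodv (i :: s) (upd b i c) a = ver i c a * prodv s b a.
Proof.
move=> si; rewrite /prodv big_cons {1}/upd eqxx; congr (_ * _).
rewrite big_seq [RHS]big_seq; apply: eq_bigr => i' i's; rewrite /upd.
by case: eqP => // e; rewrite -e i's in si.
Qed.

Let good_cons i s b c : i \notin s -> good s b -> (is_coin i -> (c <= 1)%N) ->
  good (i :: s) (upd b i c).
Proof.
move=> si gs ci i'; rewrite inE /upd => /orP[/eqP->|i's]; first by rewrite eqxx.
case: eqP => [->//|_]; exact: gs.
Qed.

Let base s b B : uniq s -> good s b -> measurable B ->
  P (pre B `&` Ev s b) = Lint B (prodv s b).
Proof.
move=> us gs mB.
have [|i is_|_ h] := indep (s := s) (B := fun i => [set b i]) (p := fun i w => ver i (b i) (alpha w)) us.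
- by [].
- have := gs i is_; rewrite /cond_probability.
  case: i is_ => [[[]|[k j]]|k] is_ /=.
  + by move=> _; exact: X0_law.
  + have [h1 h0] := xi_law k j => /(_ isT); case: (b _) => [|[|//]] _ /=.
      exact: h0.
    exact: h1.
  + by move=> _; exact: eps_law.
rewrite /Lint -(h _ (sigma_pre mB)) integral_indic.
- by rewrite setIC.
- exact: mpre.
- exact: mEv.
Qed.

(* inputs that enter the recursion at step k or later *)
Let fut k (i : I) := match i with
  | inl (inl _) => false | inl (inr kj) => (k <= kj.1)%N | inr k' => (k <= k')%N end.
(* among those, the inputs other than the first n survival indicators of step k *)
Let fut' k n (i : I) := fut k i &&
  (if i is inl (inr kj) then (kj.1 == k) ==> (n <= kj.2)%N else true).

Let Us k n (w : T) := (\sum_(j < n) xi k j w)%N.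

Let mUs k n : measurable_fun setT (Us k n).
Proof.
rewrite /Us; elim: n => [|n ih]; first by under eq_fun do rewrite big_ord0; exact: measurable_cst.
by under eq_fun do rewrite big_ord_recr/=; apply: measurable_fun_addn.
Qed.

Let mUsu k n u : measurable (Us k n @^-1` [set u]).
Proof. by rewrite -[Y in measurable Y]setTI; exact: mUs. Qed.

Let law k := forall x s b B, uniq s -> (forall i, i \in s -> fut k i) -> good s b -> measurable B ->
  P (pre B `&` (X k @^-1` [set x] `&` Ev s b)) =
  Lint B (fun a => poisson_pmf (rate a) x * prodv s b a).

Let law' k n := forall x u s b B, uniq s -> (forall i, i \in s -> fut' k n i) -> good s b ->
  measurable B ->
  P (pre B `&` ((X k @^-1` [set x] `&` Us k n @^-1` [set u]) `&` Ev s b)) =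
  Lint B (fun a => poisson_pmf (rate a) x * ('C(n, u)%:R * a ^+ u * (1 - a) ^+ (n - u)) * prodv s b a).

Let coin_null k j : P (~` (xi k j @^-1` [set 0%N] `|` xi k j @^-1` [set 1%N])) = 0.
Proof.
have m0 : measurable (xi k j @^-1` [set 0%N]) by exact: measurable_funPTI.
have m1 : measurable (xi k j @^-1` [set 1%N]) by exact: measurable_funPTI.
have s1 : (P (xi k j @^-1` [set 0%N]) + P (xi k j @^-1` [set 1%N]) = 1)%E.
  have [[_ h1] [_ h0]] := xi_law k j.
  have := h0 _ (sigma_pre measurableT); have := h1 _ (sigma_pre measurableT).
  rewrite /pre preimage_setT !integral_indic// !setIT => h1' h0'.
  transitivity (\int[P]_w (1 - alpha w)%:E + \int[P]_w (alpha w)%:E)%E; first by congr (_ + _)%E.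
  rewrite -ge0_integralD//.
  - under eq_integral => w _ do rewrite -EFinD subrK.
    by rewrite integral_cst// mul1e; exact: probability_setT.
  - by move=> w _; rewrite lee_fin subr_ge0; have /andP[_ /ltW] := a01 w.
  - by apply/measurable_EFinP; apply: measurable_funB.
  - by move=> w _; rewrite lee_fin; have /andP[/ltW] := a01 w.
  - exact/measurable_EFinP.
rewrite probability_setC; last exact: measurableU.
rewrite measureU//; last first.
  by apply/seteqP; split => // w [/= -> ].
by rewrite [X in (1 - X)%E](_ : _ = 1%E) ?subee//.
Qed.

Let coin_split k j C : measurable C ->
  (P C = P (C `&` xi k j @^-1` [set 0%N]) + P (C `&` xi k j @^-1` [set 1%N]))%E.
Proof.
move=> mC.
have m0 : measurable (xi k j @^-1` [set 0%N]) by exact: measurable_funPTI.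
have m1 : measurable (xi k j @^-1` [set 1%N]) by exact: measurable_funPTI.
rewrite -measureU; [|exact: measurableI|exact: measurableI|]; last first.
  by apply/seteqP; split => // w [[_ /= ->] []].
rewrite -setIUr (measureDI P mC (measurableU _ _ m0 m1)) -[RHS]add0e; congr (_ + _)%E.
apply/eqP; rewrite -measure_le0 -(coin_null k j); apply: le_measure; rewrite ?inE.
- by apply: measurableD => //; exact: measurableU.
- by apply: measurableC; exact: measurableU.
- by move=> w [].
Qed.

Let law'0 k : law k -> law' k 0.
Proof.
move=> lk x u s b B us fs gs mB.
have -> : Us k 0 @^-1` [set u] = if u == 0%N then setT else set0.
  by apply/seteqP; split => w; rewrite /Us /= big_ord0; case: (eqVneq u 0%N) => [->|] //= /eqP u0 // e; case: u0.
rewrite bin0n; case: eqP => [->|_].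
  rewrite setIT lk//; last by move=> i /fs /andP[].
  by apply: eq_Lint => a _; rewrite !mul1r mulr1.
rewrite setI0 set0I setI0 measure0; apply/esym/integral0_eq => w _.
by rewrite !mul0r mulr0 mul0r.
Qed.

Let law'S k n : law' k n -> law' k n.+1.
Proof.
move=> lkn x u s b B us fs gs mB.
pose i0 : I := inl (inr (k, n)).
have i0s : i0 \notin s.
  by apply/negP => /fs; rewrite /fut' /= eqxx ltnn andbF.
have fs' i : i \in i0 :: s -> fut' k n i.
  rewrite inE => /orP[/eqP->|/fs]; first by rewrite /fut'/= leqnn eqxx leqnn.
  rewrite /fut'; case: i => [[//|kj]|//] /andP[-> /=]/implyP h; apply/implyP => /h; exact: ltnW.
have us' : uniq (i0 :: s) by rewrite /= i0s.
have UsS w : Us k n.+1 w = (Us k n w + xi k n w)%N by rewrite /Us big_ord_recr.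
rewrite (coin_split k n); last first.
  by apply: measurableI; [exact: mpre|apply: measurableI => //; apply: measurableI => //; exact: measurable_funPTI].
have e0 : pre B `&` (X k @^-1` [set x] `&` Us k n.+1 @^-1` [set u] `&` Ev s b) `&` xi k n @^-1` [set 0%N] =
  pre B `&` ((X k @^-1` [set x] `&` Us k n @^-1` [set u]) `&` Ev (i0 :: s) (upd b i0 0%N)).
  rewrite Ev_cons//; apply/seteqP; split => w /=.
    by rewrite UsS => -[[? [[? +] ?]]] x0; rewrite x0 addn0.
  by rewrite UsS => -[? [[? ?]]] [-> ?]; rewrite addn0.
rewrite e0 lkn//; last by apply: good_cons.
case: u e0 => [_|u _].
  have -> : pre B `&` (X k @^-1` [set x] `&` Us k n.+1 @^-1` [set 0%N] `&` Ev s b) `&` xi k n @^-1` [set 1%N] = set0.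
    by apply/seteqP; split => // w /=; rewrite UsS => -[[? [[? +] ?]]] x0; rewrite x0 addn1.
  rewrite measure0 adde0; apply: eq_Lint => a _.
  by rewrite prodv_cons// !bin0 !subn0 exprS /=; ring.
have -> : pre B `&` (X k @^-1` [set x] `&` Us k n.+1 @^-1` [set u.+1] `&` Ev s b) `&` xi k n @^-1` [set 1%N] =
  pre B `&` ((X k @^-1` [set x] `&` Us k n @^-1` [set u]) `&` Ev (i0 :: s) (upd b i0 1%N)).
  rewrite Ev_cons//; apply/seteqP; split => w /=.
    by rewrite UsS => -[[? [[? +] ?]]] x0; rewrite x0 addn1 => -[].
  by rewrite UsS => -[? [[? ->]]] [-> ?]; rewrite addn1.
rewrite lkn//; last by apply: good_cons.
rewrite LintD//; last 2 first.
- by apply: admM (adm_prodv _ _); apply: admM (adm_pois _) (adm_bin _ _ _).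
- by apply: admM (adm_prodv _ _); apply: admM (adm_pois _) (adm_bin _ _ _).
apply: eq_Lint => a _; rewrite !prodv_cons// /= binS natrD subSS.
have [un|nu] := ltnP u n.
  by rewrite -(subnSK un) !exprS; ring.
have -> : 'C(n, u.+1) = 0%N by rewrite bin_small.
by rewrite exprS; ring.
Qed.

Let law'_all k n : law k -> law' k n.
Proof. by move=> lk; elim: n => [|n]; [exact: law'0|exact: law'S]. Qed.

(* survivors of the population at time k *)
Let Uk k (w : T) := Us k (X k w) w.

Let mUk k : measurable_fun setT (Uk k).
Proof.
move=> _ B _; rewrite setTI.
have -> : Uk k @^-1` B = \bigcup_x (X k @^-1` [set x] `&` Us k x @^-1` B).
  apply/seteqP; split => [w wB|w [x _ [/= <-]]//]; by exists (X k w).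
apply: bigcupT_measurable => x; apply: measurableI; first exact: measurable_funPTI.
by rewrite -[Y in measurable Y]setTI; exact: mUs.
Qed.

Let mUku k u : measurable (Uk k @^-1` [set u]).
Proof. by rewrite -[Y in measurable Y]setTI; exact: mUk. Qed.

Let futU k (i : I) := fut k.+1 i || (i == inr k).

Let futU_fut' k n i : futU k i -> fut' k n i.
Proof.
case/orP => [|/eqP->]; last by rewrite /fut'/= leqnn.
rewrite /fut'; case: i => [[//|kj]|k']/=; last by move=> /ltnW->.
by move=> h; rewrite (ltnW h) (gtn_eqF h).
Qed.

Let lawU k : law k -> forall u s b B, uniq s -> (forall i, i \in s -> futU k i) -> good s b ->
  measurable B ->
  P (pre B `&` (Uk k @^-1` [set u] `&` Ev s b)) =
  Lint B (fun a => poisson_pmf (a * rate a) u * prodv s b a).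
Proof.
move=> lk u s b B us fs gs mB.
rewrite (@probability_split _ _ _ P _ (X k)); last 2 first.
- by apply: measurableI; [exact: mpre|exact: measurableI].
- exact: measurable_funPT.
have e x : P (pre B `&` (Uk k @^-1` [set u] `&` Ev s b) `&` X k @^-1` [set x]) =
    Lint B (fun a => poisson_pmf (rate a) x * ('C(x, u)%:R * a ^+ u * (1 - a) ^+ (x - u)) * prodv s b a).
  rewrite -(@law'_all k x lk)//; last by move=> i /fs; exact: futU_fut'.
  congr (P _); apply/seteqP; split => w /=; rewrite /Uk.
    by move=> [[? [? ?]]] xw; rewrite -{2}xw.
  by move=> [? [[xw ?] ?]]; rewrite xw.
under eq_eseriesr => x _ do rewrite e.
apply: Lint_series => //.
  by move=> x; apply: admM (adm_prodv _ _); apply: admM (adm_pois _) (adm_bin _ _ _).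
move=> a a01'; rewrite EFinM -(poisson_thinning u (rate_gt0 a01') a01') muleC.
have [a0 a1] := andP a01'.
rewrite -nneseriesZl; last first.
- move=> x _; rewrite lee_fin mulr_ge0 ?poisson_pmf_ge0// !mulr_ge0 ?exprn_ge0 ?(ltW a0)//.
  by rewrite subr_ge0 ltW.
- by apply: eq_eseriesr => x _; rewrite -EFinM mulrC.
Qed.

Let lawS k : law k -> law k.+1.
Proof.
move=> lk y s b B us fs gs mB.
have Xk w : X k.+1 w = (Uk k w + eps k w)%N by rewrite X_rec.
rewrite (@probability_split _ _ _ P _ (Uk k)); last 2 first.
- by apply: measurableI; [exact: mpre|apply: measurableI => //; exact: measurable_funPTI].
- exact: mUk.
have ks : inr k \notin s by apply/negP => /fs; rewrite /fut ltnn.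
have fs' i : i \in inr k :: s -> futU k i.
  by rewrite inE /futU => /orP[->|/fs->//]; rewrite orbT.
pose phi u a := if (u <= y)%N then poisson_pmf (a * rate a) u * (poisson_pmf lambda (y - u) * prodv s b a) else 0.
have e u : P (pre B `&` (X k.+1 @^-1` [set y] `&` Ev s b) `&` Uk k @^-1` [set u]) = Lint B (phi u).
  rewrite /phi; case: (leqP u y) => uy.
    rewrite [RHS](_ : _ = Lint B (fun a => poisson_pmf (a * rate a) u * prodv (inr k :: s) (upd b (inr k) (y - u)%N) a)); last first.
      by apply: eq_Lint => a _; rewrite prodv_cons.
    rewrite -(lawU lk)//; last 2 first.
    - by rewrite /= ks.
    - exact: good_cons.
    congr (P _); rewrite Ev_cons//; apply/seteqP; split => w /=.
      by rewrite Xk => -[[? [<- ?]]] ->; rewrite addKn.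
    by rewrite Xk => -[? [-> [-> ?]]]; rewrite subnKC.
  rewrite [X in P X](_ : _ = set0); last first.
    apply/seteqP; split => // w /=; rewrite Xk => -[[_ [yw _]] uw].
    by move: uy; rewrite -yw uw ltnNge leq_addr.
  by rewrite measure0; apply/esym/integral0_eq.
under eq_eseriesr => u _ do rewrite e.
have adm_au u : adm (fun a => poisson_pmf (a * rate a) u).
  split; last by move=> a _; exact: poisson_pmf_ge0.
  have h : measurable_fun setT (fun a : R => a * rate a) by exact: measurable_funM.
  by have := measurableT_comp (@measurable_poisson_pmf R setT u measurableT) h; exact.
apply: Lint_series => //.
  move=> u; rewrite /phi; case: (u <= y)%N; last by split; [exact: measurable_cst|move=> a _].
  apply: admM (adm_au u) _; apply: admM (adm_prodv _ _).
  by split; [exact: measurable_cst|move=> a _; exact: poisson_pmf_ge0].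
move=> a a01'; have [a0 a1] := andP a01'; have a1' : 1 - a != 0 by rewrite subr_eq0 gt_eqF.
apply: nneseries_EFin_cvg.
have <- : a * rate a + lambda = rate a by rewrite /rate; field.
rewrite -poisson_convolution//; last by rewrite mulr_gt0 ?rate_gt0.
apply: cvg_near_cst; near=> n.
have yn : (y.+1 <= n)%N by near: n; exact: nbhs_infty_ge.
rewrite mulr_suml (big_ord_widen n (fun u => poisson_pmf (a * rate a) u * poisson_pmf lambda (y - u) * prodv s b a)) //.
rewrite [RHS]big_mkcond/=; apply: eq_bigr => -[u /= _] _.
by rewrite /phi ltnS; case: ifP => // _; rewrite mulrA.
Unshelve. all: by end_near. Qed.

Let law_all k : law k.
Proof.
elim: k => [|k]; last exact: lawS.
move=> x s b B us fs gs mB.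
have xs : inl (inl tt) \notin s by apply/negP => /fs.
rewrite [RHS](_ : _ = Lint B (prodv (inl (inl tt) :: s) (upd b (inl (inl tt)) x))); last first.
  by apply: eq_Lint => a _; rewrite prodv_cons.
rewrite -base //; last 2 first.
- by rewrite /= xs.
- exact: good_cons.
by rewrite Ev_cons.
Qed.

Lemma INAR_marginal k : cond_pmf P alpha (X k) (fun a => poisson_pmf (lambda / (1 - a))).
Proof.
move=> B m mB; have := @law_all k m [::] (fun=> 0%N) B isT (fun i h => False_ind _ (Bool.diff_false_true h)) (fun i h => False_ind _ (Bool.diff_false_true h)) mB.
rewrite /Ev set_nil bigcap_set0 setIT => ->.
by apply: eq_integral => w _; rewrite /prodv big_nil mulr1.
Qed.

Let eps_pmf k : cond_pmf P alpha (eps k) (fun=> poisson_pmf lambda).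
Proof.
move=> B m mB; have := @base [:: inr k] (fun=> m) B.
rewrite /Ev /= bigcap_seq big_seq1 => ->//; last by move=> i; rewrite inE => /eqP->.
by apply: eq_integral => w _; rewrite /prodv big_seq1.
Qed.

Let XU k x u B : measurable B ->
  P (pre B `&` (X k @^-1` [set x] `&` Us k x @^-1` [set u])) =
  Lint B (fun a => poisson_pmf (rate a) x * ('C(x, u)%:R * a ^+ u * (1 - a) ^+ (x - u))).
Proof.
move=> mB; have := @law'_all k x (@law_all k) x u [::] (fun=> 0%N) B isT (fun i h => False_ind _ (Bool.diff_false_true h)) (fun i h => False_ind _ (Bool.diff_false_true h)) mB.
rewrite /Ev set_nil bigcap_set0 setIT => ->.
by apply: eq_integral => w _; rewrite /prodv big_nil mulr1.
Qed.

(* more survivors than individuals has probability zero *)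
Let extra_null k : P [set w | (X k w < Uk k w)%N] = 0.
Proof.
have -> : [set w | (X k w < Uk k w)%N] =
   \bigcup_x \bigcup_u (pre setT `&` (X k @^-1` [set x] `&` Us k x @^-1` [set (x + u).+1])).
  apply/seteqP; split => [w /= h|w [x _ [u _ [_ [/= <- h]]]]].
    exists (X k w) => //; exists (Uk k w - (X k w).+1)%N => //; split => //; split => //=.
    by rewrite -addSn subnKC.
  by rewrite /Uk h ltnS leq_addr.
have mXU x u : measurable (pre setT `&` (X k @^-1` [set x] `&` Us k x @^-1` [set u])).
  by apply: measurableI; [exact: mpre|apply: measurableI => //; exact: measurable_funPTI].
apply/negligibleP; first by apply: bigcupT_measurable => x; exact: bigcupT_measurable.
apply: negligible_bigcup => x; apply: negligible_bigcup => u.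
apply/negligibleP => //; apply: (eq_trans (@XU k x (x + u).+1 setT measurableT)); apply: integral0_eq => w _.
by rewrite bin_small ?ltnS ?leq_addr// !mul0r mulr0.
Qed.

(** The deaths of one step are Poisson distributed with the same parameter as the
    births, by the thinning property; this is why the increment is centered. *)
Lemma INAR_step k : exists V : T -> nat, [/\ measurable_fun setT V,
  cond_pmf P alpha V (fun=> poisson_pmf lambda),
  cond_pmf P alpha (eps k) (fun=> poisson_pmf lambda) &
  {ae P, forall w, (X k.+1 w)%:R - (X k w)%:R = (eps k w)%:R - (V w)%:R :> R}].
Proof.
pose V w := (X k w - Uk k w)%N.
have mV : measurable_fun setT V.
  by apply: measurable_fun_subn; [exact: measurable_funPT|exact: mUk].
have mV1 v : measurable (V @^-1` [set v]) by rewrite -[Y in measurable Y]setTI; exact: mV.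
have mN : measurable [set w | (X k w < Uk k w)%N].
  have := @measurable_fun_ltn _ _ setT _ _ (measurable_funPT (X k)) (mUk k) measurableT [set true].
  by rewrite setTI; apply.
have ae : {ae P, forall w, (Uk k w <= X k w)%N}.
  exists [set w | (X k w < Uk k w)%N]; split => //.
  by move=> w /= /negP; rewrite -ltnNge.
exists V; split => //; last first.
  apply: filterS ae => w h; rewrite X_rec -/(Us k _ w) -/(Uk k w) natrD /V natrB//.
  by ring.
move=> B v mB.
have mC : measurable (pre B `&` V @^-1` [set v]) by apply: measurableI; [exact: mpre|].
rewrite (measureDI P mC mN) [X in (_ + X)%E](_ : _ = 0%E); last first.
  apply/eqP; rewrite -measure_le0 -(extra_null k); apply: le_measure; rewrite ?inE//.
  exact: measurableI.
rewrite adde0; change (P ((pre B `&` V @^-1` [set v]) `\` [set w | (X k w < Uk k w)%N]) = Lint B (fun=> poisson_pmf lambda v)).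
rewrite (@probability_split _ _ _ P _ (Uk k)); last 2 first.
- exact: measurableD.
- exact: mUk.
have e u : P (((pre B `&` V @^-1` [set v]) `\` [set w | (X k w < Uk k w)%N]) `&` Uk k @^-1` [set u]) =
    Lint B (fun a => poisson_pmf (rate a) (u + v) * ('C(u + v, u)%:R * a ^+ u * (1 - a) ^+ v)).
  have := @XU k (u + v)%N u B mB; rewrite addKn => <-.
  congr (P _); apply/seteqP; split => w /=; rewrite /V /Uk.
    move=> [[[? vw] /negP uw] uE]; rewrite -leqNgt in uw; split => //.
    have xw : X k w = (u + v)%N by rewrite -uE -vw subnKC.
    by split => //; rewrite -xw.
  move=> [? [xw uE]]; rewrite xw uE addKn; split => //; split => //.
  by apply/negP; rewrite -leqNgt leq_addr.
under eq_eseriesr => u _ do rewrite e.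
apply: Lint_series => //.
  by move=> u; apply: admM (adm_pois _) (adm_bin _ _ _).
move=> a a01'; have [a0 a1] := andP a01'; have a1' : 1 - a != 0 by rewrite subr_eq0 gt_eqF.
under eq_eseriesr => u _ do rewrite poisson_thinning_term ?rate_gt0// EFinM muleC.
rewrite nneseriesZl; last by move=> u _; rewrite lee_fin poisson_pmf_ge0.
rewrite poisson_sum1; last by rewrite mulr_gt0 ?rate_gt0.
rewrite mule1.
by congr (poisson_pmf _ _)%:E; rewrite /rate; field.
Qed.

End INAR_law.

(** * Characteristic functions of sums of independent variables *)

Section independence.
Context d (T : measurableType d) (R : realType) (P : probability T R).

Lemma expectation_uncorrelated (Y Z : T -> R) (c : R) (g : R -> R) :
  measurable_fun setT Y -> measurable_fun setT Z -> measurable_fun setT g ->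
  (forall w, `|Y w| <= 1) -> (forall x, `|g x| <= 1) ->
  (forall B, measurable B ->
    \int[P]_w (Y w * \1_(Z @^-1` B) w) = c * \int[P]_w \1_(Z @^-1` B) w) ->
  \int[P]_w (Y w * g (Z w)) = c * \int[P]_w g (Z w).
Proof.
move=> mY mZ mg Y1 g1 YZ.
have mZB B : measurable B -> measurable (Z @^-1` B).
  by move=> mB; rewrite -[X in measurable X]setTI; exact: mZ.
have bY : bounded_measurable Y by split => //; exists 1.
have bg : bounded_measurable (fun w => g (Z w)).
  split; last by exists 1.
  by have := measurableT_comp mg mZ; exact.
have b1 : @bounded_measurable _ T R (fun=> 1) by exact: bounded_measurable_cst.
have cY : \int[P]_w Y w = c.
  have := YZ _ measurableT; rewrite preimage_setT.
  under eq_Rintegral do rewrite indicT mulr1.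
  under [in RHS]eq_Rintegral do rewrite indicT.
  by rewrite Rintegral_probability_cst mulr1.
have c1 : 0 <= c + 1.
  have : `|c| <= 1 by rewrite -cY; exact: le_Rintegral_bounded.
  by rewrite ler_norml => /andP[+ _]; lra.
have := @transfer_cond_expectation _ _ _ P Z (fun w => Y w + 1) (fun=> c + 1) (fun x => g x + 1).
have bYg := bounded_measurableM bY bg.
move=> /(_ mZ _ _ _ _ _ _ _) h.
have {h} : (\int[P]_w ((Y w + 1) * (g (Z w) + 1))%:E = \int[P]_w ((c + 1) * (g (Z w) + 1))%:E)%E.
  apply: h => //.
  - exact: measurable_funD.
  - by move=> w; have := Y1 w; rewrite ler_norml => /andP[+ _]; lra.
  - move=> B mB; have mi := mZB _ mB; have bi := bounded_measurable_indic R mi.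
    have e (F : T -> R) : (\int[P]_(w in Z @^-1` B) (F w)%:E = \int[P]_w (F w * \1_(Z @^-1` B) w)%:E)%E.
      rewrite integral_mkcond; apply: eq_integral => w _; rewrite patchE indicE.
      by case: (_ \in _); rewrite ?mulr1 ?mulr0.
    rewrite !e !EFin_Rintegral.
    + congr EFin; under eq_Rintegral do rewrite mulrDl mul1r.
      under [in RHS]eq_Rintegral do rewrite mulrDl mul1r.
      rewrite !bounded_RintegralD//; last 2 first.
      * by apply: bounded_measurableM => //; exact: bounded_measurable_cst.
      * exact: bounded_measurableM.
      rewrite YZ// RintegralZl//; exact: bounded_measurable_integrable.
    + by apply: bounded_measurableM => //; exact: bounded_measurable_cst.
    + by apply: bounded_measurableM => //; exact: bounded_measurableD.
  - exact: measurable_funD.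
  - by move=> x; have := g1 x; rewrite ler_norml => /andP[+ _]; lra.
have bg1 := bounded_measurableD bg b1.
rewrite !EFin_Rintegral.
- move=> [].
  under eq_Rintegral do rewrite mulrDl mul1r mulrDr mulr1.
  rewrite !bounded_RintegralD//; last exact: bounded_measurableD.
  rewrite RintegralZl//; last exact: bounded_measurable_integrable.
  rewrite bounded_RintegralD// Rintegral_probability_cst cY; lra.
- by apply: bounded_measurableM => //; exact: bounded_measurable_cst.
- by apply: bounded_measurableM => //; exact: bounded_measurableD.
Qed.

End independence.

Section iid_sums.
Context d (T : measurableType d) (R : realType) (P : probability T R).

Definition mutually_independent (Z : nat -> T -> R) :=
  forall (s : seq nat) (B : nat -> set R), uniq s -> (forall j, measurable (B j)) ->
  P (\bigcap_(j in [set` s]) (Z j @^-1` B j)) = (\prod_(j <- s) P (Z j @^-1` B j))%E.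

Variable Z : nat -> T -> R.
Hypothesis mZ : forall j, measurable_fun setT (Z j).
Hypothesis indep : mutually_independent Z.
Variables (theta C S : R).
Hypothesis ZC : forall j, \int[P]_w cos (theta * Z j w) = C.
Hypothesis ZS : forall j, \int[P]_w sin (theta * Z j w) = S.

Let Sum N w := \sum_(j < N) Z j w.

Let mSum N : measurable_fun setT (Sum N).
Proof. exact: measurable_sum. Qed.

(* powers of the complex number C + i S *)
Let a N := iter N (fun z : R * R => (z.1 * C - z.2 * S, z.1 * S + z.2 * C)) (1, 0).

Let Ev (s : seq nat) (B : nat -> set R) := \bigcap_(j in [set` s]) (Z j @^-1` B j).

Let mEv s B : (forall j, measurable (B j)) -> measurable (Ev s B).
Proof.
move=> mB; rewrite /Ev bigcap_seq; apply: bigsetI_measurable => j _.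
by rewrite -[X in measurable X]setTI; exact: mZ.
Qed.

Let joint N : forall s B, uniq s -> (forall j, j \in s -> (N <= j)%N) -> (forall j, measurable (B j)) ->
  \int[P]_w (cos (theta * Sum N w) * \1_(Ev s B) w) = (a N).1 * fine (P (Ev s B)) /\
  \int[P]_w (sin (theta * Sum N w) * \1_(Ev s B) w) = (a N).2 * fine (P (Ev s B)).
Proof.
elim: N => [|N ih] s B us sN mB; have mE := mEv s mB; have bE := bounded_measurable_indic R mE.
  rewrite /a /= mul0r mul1r; split.
    under eq_Rintegral do rewrite /Sum big_ord0 mulr0 cos0 mul1r.
    by rewrite /Rintegral integral_indic// setIT.
  under eq_Rintegral do rewrite /Sum big_ord0 mulr0 sin0 mul0r.
  exact: Rintegral_probability_cst.
pose F (t : bool) x : R := if t then cos (theta * x) else sin (theta * x).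
have mF t (f : T -> R) : measurable_fun setT f -> bounded_measurable (fun w => F t (f w)).
  by move=> mf; case: t; [apply: bounded_measurable_cos|apply: bounded_measurable_sin]; exact: measurable_funM.
have F1 t x : `|F t x| <= 1 by case: t; [exact: cos_max|exact: sin_max].
pose p (t : bool) := if t then (a N).1 else (a N).2.
pose q (t : bool) := if t then C else S.
have Ns : N \notin s by apply/negP => /sN; rewrite ltnn.
have main t u : \int[P]_w (F t (Sum N w) * \1_(Ev s B) w * F u (Z N w)) = p t * fine (P (Ev s B)) * q u.
  have -> : q u = \int[P]_w F u (Z N w) by case: u; rewrite /F /q ?ZC ?ZS.
  apply: expectation_uncorrelated => //.
  - by have [] := bounded_measurableM (mF t _ (mSum N)) bE.
  - by case: u => /=; [apply: measurable_cos_comp|apply: measurable_sin_comp]; exact: measurable_funM.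
  - move=> w; rewrite normrM mulr_ile1// indicE; case: (_ \in _); rewrite ?normr1 ?normr0//.
  move=> D mD.
  pose B' j := if j == N then D else B j.
  have mB' j : measurable (B' j) by rewrite /B'; case: ifP.
  have EB : Ev (N :: s) B' = Z N @^-1` D `&` Ev s B.
    apply/seteqP; split => [w h|w [h1 h2] j /=].
      split; first by have := h N; rewrite /= mem_head /B' eqxx; exact.
      move=> j /= js; have := h j; rewrite /= inE js orbT => /(_ isT).
      by rewrite /B'; case: eqP => // e; rewrite -e js in Ns.
    rewrite inE => /orP[/eqP->|js]; first by rewrite /B' eqxx.
    rewrite /B'; case: eqP => [e|_]; first by rewrite -e js in Ns.
    exact: h2.
  have mZD : measurable (Z N @^-1` D) by rewrite -[X in measurable X]setTI; exact: mZ.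
  have PE : fine (P (Ev (N :: s) B')) = fine (P (Ev s B)) * fine (P (Z N @^-1` D)).
    have e1 : P (Ev (N :: s) B') = (P (Z N @^-1` D) * P (Ev s B))%E.
      rewrite /Ev indep//=; last by rewrite Ns.
      rewrite big_cons indep// {1}/B' eqxx; congr (_ * _)%E.
      rewrite big_seq [RHS]big_seq; apply: eq_bigr => j js.
      by rewrite /B'; case: eqP => // e; rewrite -e js in Ns.
    by rewrite e1 fineM ?fin_num_measure// mulrC.
  rewrite Rintegral_indic//.
  transitivity (\int[P]_w (F t (Sum N w) * \1_(Ev (N :: s) B') w)).
    by apply: eq_Rintegral => w _; rewrite EB indicI /=; ring.
  rewrite -mulrA -PE.
  have [||h1 h2] := ih (N :: s) B' _ _ mB'.
  - by rewrite /= Ns.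
  - by move=> j; rewrite inE => /orP[/eqP->//|/sN/ltnW].
  by case: t; rewrite /F /p.
have bF t u : bounded_measurable (fun w => F t (Sum N w) * \1_(Ev s B) w * F u (Z N w)).
  by apply: bounded_measurableM; [apply: bounded_measurableM => //; exact: mF|exact: mF].
split.
  transitivity (\int[P]_w (F true (Sum N w) * \1_(Ev s B) w * F true (Z N w) -
      F false (Sum N w) * \1_(Ev s B) w * F false (Z N w))).
    apply: eq_Rintegral => w _; rewrite /Sum big_ord_recr/= mulrDr cosD; ring.
  by rewrite bounded_RintegralB// !main /=; ring.
transitivity (\int[P]_w (F false (Sum N w) * \1_(Ev s B) w * F true (Z N w) +
    F true (Sum N w) * \1_(Ev s B) w * F false (Z N w))).
  apply: eq_Rintegral => w _; rewrite /Sum big_ord_recr/= mulrDr sinD; ring.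
by rewrite bounded_RintegralD// !main /=; ring.
Qed.

Let cf_Sum N : \int[P]_w cos (theta * Sum N w) = (a N).1 /\
  \int[P]_w sin (theta * Sum N w) = (a N).2.
Proof.
have [//|//||h1 h2] := @joint N [::] (fun=> setT); first by move=> _.
have E0 : Ev [::] (fun=> setT) = setT by rewrite /Ev set_nil bigcap_set0.
move: h1 h2; rewrite E0 (congr1 fine (probability_setT P)) !mulr1 => <- <-.
by split; apply: eq_Rintegral => w _; rewrite indicT mulr1.
Qed.

(** Both real and imaginary parts of (C + i S)^k are bounded by 1, since they are
    themselves expectations of a cosine and of a sine; so the telescoping estimate
    of z^N - r^N needs no complex modulus. *)
Lemma iid_cf_approx N (r : R) : 0 <= r <= 1 ->
  `|\int[P]_w cos (theta * \sum_(j < N) Z j w) - r ^+ N| <= N%:R * (`|C - r| + `|S|) /\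
  `|\int[P]_w sin (theta * \sum_(j < N) Z j w)| <= N%:R * (`|C - r| + `|S|).
Proof.
move=> /andP[r0 r1]; have [-> ->] := cf_Sum N.
have a1 k : `|(a k).1| <= 1.
  have [<- _] := cf_Sum k; apply: le_Rintegral_bounded => [|w]; last exact: cos_max.
  by apply: measurable_cos_comp; exact: measurable_funM.
have a2 k : `|(a k).2| <= 1.
  have [_ <-] := cf_Sum k; apply: le_Rintegral_bounded => [|w]; last exact: sin_max.
  by apply: measurable_sin_comp; exact: measurable_funM.
elim: N => [|N [ih1 ih2]]; first by rewrite /a /= subrr normr0 mul0r.
set e := `|C - r| + `|S| in ih1 ih2 *.
have bd x y : `|x| <= 1 -> `|y| <= 1 -> `|x * (C - r)| + `|y * S| <= e.
  by move=> x1 y1; rewrite !normrM lerD// ler_piMl.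
have rle x : `|x| <= N%:R * e -> `|r * x| <= N%:R * e.
  by move=> h; rewrite normrM (ger0_norm r0) (le_trans _ h)// ler_piMl.
rewrite -natr1 mulrDl mul1r; split.
  have -> : (a N.+1).1 - r ^+ N.+1 = r * ((a N).1 - r ^+ N) + ((a N).1 * (C - r) - (a N).2 * S).
    by rewrite /= exprS; ring.
  rewrite (le_trans (ler_normD _ _))// lerD ?rle//.
  by rewrite (le_trans (ler_normB _ _))// bd.
have -> : (a N.+1).2 = r * (a N).2 + ((a N).2 * (C - r) + (a N).1 * S) by rewrite /=; ring.
rewrite (le_trans (ler_normD _ _))// lerD ?rle//.
by rewrite (le_trans (ler_normD _ _))// bd.
Qed.

End iid_sums.

Lemma cvg_onem_expR (R : realType) (k : R) : 0 <= k ->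
  n%:R * (1 - expR (- (k / n%:R))) @[n --> \oo] --> k.
Proof.
move=> k0.
apply: (@squeeze_cvgr _ _ _ _ (fun n => k / (1 + k / n%:R)) (cst k)); last 2 first.
- have h : (fun n => k / (1 + k / n%:R)) @ \oo --> k / (1 + k * 0).
    apply: cvgM; first exact: cvg_cst.
    apply: cvgV; first by rewrite mulr0 addr0 oner_eq0.
    apply: cvgD; first exact: cvg_cst.
    apply: cvgM; first exact: cvg_cst.
    apply/cvgrPdist_lt => e e0; near=> n; rewrite sub0r normrN ger0_norm ?invr_ge0//.
    have n0 : 0 < n%:R :> R by rewrite ltr0n; near: n; exact: nbhs_infty_gt.
    rewrite -[ltRHS]invrK ltf_pV2 ?posrE ?invr_gt0//; near: n; exact: nbhs_infty_gtr.
  by move: h; rewrite mulr0 addr0 divr1.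
- exact: cvg_cst.
near=> n; have n0 : 0 < n%:R :> R by rewrite ltr0n; near: n; exact: nbhs_infty_gt.
have x0 : 0 <= k / n%:R by rewrite divr_ge0// ltW.
have -> : k = n%:R * (k / n%:R) by rewrite mulrC divfK// gt_eqF.
set x := k / n%:R in x0 *.
have -> : n%:R * x / n%:R = x by rewrite mulrAC divff ?mul1r// gt_eqF.
rewrite -mulrA !ler_pM2l//; apply/andP; split.
  have h : expR (- x) <= (1 + x)^-1 by rewrite expRN lef_pV2 ?posrE ?expR_gt0 ?expR_ge1Dx//; lra.
  suff -> : x / (1 + x) = 1 - (1 + x)^-1 by lra.
  by field; rewrite gt_eqF//; lra.
by have := expR_ge1Dx (- x); lra.
Unshelve. all: by end_near. Qed.

Section iid_limit.
Context d (T : measurableType d) (R : realType) (P : probability T R).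
Variable Z : nat -> T -> R.
Hypothesis mZ : forall j, measurable_fun setT (Z j).
Hypothesis indep : mutually_independent P Z.

Lemma iid_cf_limit (c C S : nat -> R) (k : R) : 0 <= k ->
  (forall N j, \int[P]_w cos (c N * Z j w) = C N) ->
  (forall N j, \int[P]_w sin (c N * Z j w) = S N) ->
  N%:R * (1 - C N) @[N --> \oo] --> k -> N%:R * `|S N| @[N --> \oo] --> 0 ->
  \int[P]_w cos (c N * \sum_(j < N) Z j w) @[N --> \oo] --> expR (- k) /\
  \int[P]_w sin (c N * \sum_(j < N) Z j w) @[N --> \oo] --> 0.
Proof.
move=> k0 ZC ZS hC hS.
pose r N : R := expR (- (k / N%:R)).
have r01 N : 0 <= r N <= 1 by rewrite expR_ge0 expRN_le1// divr_ge0.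
pose e N := N%:R * (`|C N - r N| + `|S N|).
have e0 : e N @[N --> \oo] --> 0.
  have -> : e = fun N => `|N%:R * (1 - C N) - N%:R * (1 - r N)| + N%:R * `|S N|.
    apply/funext => N; rewrite /e mulrDr; congr (_ + _).
    by rewrite -mulrBr normrM normr_nat distrC; congr (_ * `|_|); ring.
  rewrite -[X in _ --> X]addr0; apply: cvgD => //.
  rewrite -(normr0 R) -[X in `|X|](subrr k).
  by apply: cvg_norm; apply: cvgB => //; exact: cvg_onem_expR.
have h N := iid_cf_approx mZ indep (ZC N) (ZS N) N (r01 N).
split.
  apply/cvgrPdist_lt => eps eps0; near=> N.
  have N0 : N%:R != 0 :> R by rewrite pnatr_eq0 -lt0n; near: N; exact: nbhs_infty_gt.
  have -> : expR (- k) = r N ^+ N by rewrite /r -expRM_natl mulrN mulrC divfK.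
  rewrite distrC (le_lt_trans (proj1 (h N)))//.
  rewrite (le_lt_trans (ler_norm _))//; near: N.
  by move/cvgr0Pnorm_lt : e0; apply.
apply/cvgr0Pnorm_lt => eps eps0; near=> N.
rewrite (le_lt_trans (proj2 (h N)))// (le_lt_trans (ler_norm _))//; near: N.
by move/cvgr0Pnorm_lt : e0; apply.
Unshelve. all: by end_near. Qed.

End iid_limit.

Lemma cvg_natr_powRN (R : realType) (p : R) : 0 < p ->
  n%:R `^ (- p) @[n --> \oo] --> (0 : R).
Proof.
move=> p0; apply/cvgr0Pnorm_lt => e e0; near=> n.
have hn : e `^ (- p^-1) < n%:R by near: n; exact: nbhs_infty_gtr.
rewrite ger0_norm ?powR_ge0// powRN -[ltRHS]invrK ltf_pV2 ?posrE ?invr_gt0//; last first.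
  by rewrite powR_gt0// (le_lt_trans _ hn)// powR_ge0.
have -> : e^-1 = (e `^ (- p^-1)) `^ p.
  by rewrite -powRrM mulNr mulVf ?gt_eqF// powRN powRr1// ltW.
by apply: gt0_ltr_powR => //; rewrite ?nnegrE ?powR_ge0// ler0n.
Unshelve. all: by end_near. Qed.

Section centered_poisson_mixture.
Context d (T : measurableType d) (R : realType) (P : probability T R).
Variables (lambda : R) (alpha : {RV P >-> R}) (X : T -> nat).
Hypothesis lambda0 : 0 < lambda.
Hypothesis a01 : forall w, 0 < alpha w < 1.
Hypothesis mX : measurable_fun setT X.
Hypothesis aX : cond_pmf P alpha X (fun a => poisson_pmf (lambda / (1 - a))).

Let W w : R := (X w)%:R - lambda / (1 - alpha w).
Let mu a : R := lambda / (1 - a).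
Let L (s : R) := \int[P]_w (1 - expR (- (s / (1 - alpha w)))).

Let mu0 w : 0 < mu (alpha w).
Proof. by have /andP[_ a1] := a01 w; rewrite divr_gt0// subr_gt0. Qed.

Let mmu : measurable_fun setT mu.
Proof.
apply: measurable_funM => //.
have h : measurable_fun setT (fun a : R => 1 - a) by apply: measurable_funB.
by have := measurableT_comp (@measurable_inv R) h; exact.
Qed.

Let mmua : measurable_fun setT (fun w => mu (alpha w)).
Proof. by have := measurableT_comp mmu (measurable_funPT alpha); exact. Qed.

Let mXR : measurable_fun setT (fun w => (X w)%:R : R).
Proof.
have h : measurable_fun setT (fun n : nat => n%:R : R) by [].
by have := measurableT_comp h mX; exact.
Qed.

Let bexp t : bounded_measurable (fun w => expR (- (mu (alpha w) * (1 - cos t)))).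
Proof.
split.
  have h : measurable_fun setT (fun w => - (mu (alpha w) * (1 - cos t))).
    by apply: measurable_funN; exact: measurable_funM.
  by have := measurableT_comp (@measurable_expR R) h; exact.
exists 1 => w; rewrite ger0_norm ?expR_ge0// expRN_le1// mulr_ge0 ?(ltW (mu0 w))//.
Qed.

Let cf_shift t c0 : \int[P]_w cos (t * W w + c0) =
  \int[P]_w (expR (- (mu (alpha w) * (1 - cos t))) *
    cos (mu (alpha w) * sin t - t * mu (alpha w) + c0)).
Proof.
have mt : measurable_fun setT (fun w => t * mu (alpha w)) by exact: measurable_funM.
have mW : measurable_fun setT (fun w => t * W w + c0).
  by apply: measurable_funD => //; apply: measurable_funM => //; exact: measurable_funB.
have mc : measurable_fun setT (fun w => mu (alpha w) * sin t - t * mu (alpha w) + c0).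
  by apply: measurable_funD => //; apply: measurable_funB => //; exact: measurable_funM.
have b1 := bounded_measurable_cos mW.
have b2 := bounded_measurableM (bexp t) (bounded_measurable_cos mc).
have bc1 : @bounded_measurable _ T R (fun=> 1) by exact: bounded_measurable_cst.
have := @cond_pmf_expectation _ _ _ P alpha X (fun a => poisson_pmf (mu a)) (measurable_funPT alpha) mX _ _ aX
  (fun a m => 1 + cos (m%:R * t + (c0 - t * mu a))).
have h : forall m, measurable_fun setT (fun a : R => 1 + cos (m%:R * t + (c0 - t * mu a))).
  move=> m; apply: measurable_funD => //; apply: measurable_cos_comp.
  by apply: measurable_funD => //; apply: measurable_funB => //; exact: measurable_funM.
move=> /(_ _ _ h) e.
have {e} : (\int[P]_w (1 + cos (t * W w + c0))%:E = \int[P]_w (1 + expR (- (mu (alpha w) * (1 - cos t))) *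
    cos (mu (alpha w) * sin t - t * mu (alpha w) + c0))%:E)%E.
  transitivity (\int[P]_w (1 + cos ((X w)%:R * t + (c0 - t * mu (alpha w))))%:E)%E.
    by apply: eq_integral => w _; congr (_ + cos _)%:E; rewrite /W /mu; ring.
  rewrite e.
  - apply: eq_integral => w _; rewrite poisson_sum_cos//.
    by congr (_ + _ * cos _)%:E; ring.
  - move=> m; have := measurableT_comp (@measurable_poisson_pmf R setT m measurableT) mmu; exact.
  - by move=> a m; exact: poisson_pmf_ge0.
  - by move=> a m; rewrite -lerBlDl sub0r cos_geN1.
rewrite !EFin_Rintegral; [|exact: bounded_measurableD|exact: bounded_measurableD].
by move=> []; rewrite !bounded_RintegralD// => /addrI.
Qed.

Let Lterm s : 0 <= s -> bounded_measurable (fun w => 1 - expR (- (s / (1 - alpha w)))).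
Proof.
move=> s0; split.
  apply: measurable_funB => //.
  have h : measurable_fun setT (fun w => - (s / (1 - alpha w))).
    apply: measurable_funN; apply: measurable_funM => //.
    have h : measurable_fun setT (fun w => 1 - alpha w) by apply: measurable_funB.
    by have := measurableT_comp (@measurable_inv R) h; exact.
  by have := measurableT_comp (@measurable_expR R) h; exact.
exists 1 => w; have /andP[_ a1] := a01 w.
have h : expR (- (s / (1 - alpha w))) <= 1 by rewrite expRN_le1// divr_ge0// subr_ge0 ltW.
by rewrite ger0_norm ?subr_ge0//; have := expR_ge0 (- (s / (1 - alpha w))); lra.
Qed.

Let muE s w : mu (alpha w) * s = (lambda * s) / (1 - alpha w).
Proof. by rewrite /mu mulrAC. Qed.

Lemma centered_cf_approx t : `|t| <= 1 ->
  `|\int[P]_w cos (t * W w) - (1 - L (lambda * (t ^+ 2 / 2)))| <= 3 * L (lambda * `|t| ^+ 3) /\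
  `|\int[P]_w sin (t * W w)| <= 3 * L (lambda * `|t| ^+ 3).
Proof.
move=> t1.
have l3 : 0 <= lambda * `|t| ^+ 3 by rewrite mulr_ge0 ?exprn_ge0// ltW.
have l2 : 0 <= lambda * (t ^+ 2 / 2) by rewrite mulr_ge0 ?divr_ge0 ?sqr_ge0// ltW.
have b3 := Lterm l3; have b2 := Lterm l2.
have c3 : @bounded_measurable _ T R (fun=> 3) by exact: bounded_measurable_cst.
have bound (f : T -> R) : bounded_measurable f ->
    (forall w, `|f w| <= 3 * (1 - expR (- ((lambda * `|t| ^+ 3) / (1 - alpha w))))) ->
    `|\int[P]_w f w| <= 3 * L (lambda * `|t| ^+ 3).
  move=> bf fle; rewrite (le_trans (le_normr_Rintegral _ _))//.
    exact: bounded_measurable_integrable.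
  rewrite /L -RintegralZl//; last exact: bounded_measurable_integrable.
  apply: le_Rintegral => //.
  - apply: bounded_measurable_integrable; case: bf => mf [M fM].
    by split; [exact: measurableT_comp|exists M => w; rewrite normr_id].
  - by apply: bounded_measurable_integrable; exact: bounded_measurableM.
have mt : measurable_fun setT (fun w => mu (alpha w) * sin t - t * mu (alpha w)).
  by apply: measurable_funB; exact: measurable_funM.
have bc := bounded_measurableM (bexp t) (bounded_measurable_cos mt).
have bs := bounded_measurableM (bexp t) (bounded_measurable_sin mt).
split.
  have -> : \int[P]_w cos (t * W w) = \int[P]_w (expR (- (mu (alpha w) * (1 - cos t))) *
      cos (mu (alpha w) * sin t - t * mu (alpha w))).
    have := cf_shift t 0; under eq_Rintegral do rewrite addr0.
    by move=> ->; apply: eq_Rintegral => w _; rewrite addr0.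
  have -> : 1 - L (lambda * (t ^+ 2 / 2)) = \int[P]_w expR (- (mu (alpha w) * (t ^+ 2 / 2))).
    rewrite -[X in X - _](Rintegral_probability_cst P) -bounded_RintegralB//; last exact: bounded_measurable_cst.
    by apply: eq_Rintegral => w _; rewrite muE; ring.
  have be : bounded_measurable (fun w => expR (- (mu (alpha w) * (t ^+ 2 / 2)))).
    have -> : (fun w => expR (- (mu (alpha w) * (t ^+ 2 / 2)))) =
        (fun w => 1 + (-1) * (1 - expR (- ((lambda * (t ^+ 2 / 2)) / (1 - alpha w))))).
      by apply/funext => w; rewrite muE; ring.
    apply: bounded_measurableD; first exact: bounded_measurable_cst.
    by apply: bounded_measurableM => //; exact: bounded_measurable_cst.
  rewrite -bounded_RintegralB//; apply: bound => [|w].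
    have -> : (fun w => expR (- (mu (alpha w) * (1 - cos t))) * cos (mu (alpha w) * sin t - t * mu (alpha w)) -
        expR (- (mu (alpha w) * (t ^+ 2 / 2)))) = (fun w => expR (- (mu (alpha w) * (1 - cos t))) *
        cos (mu (alpha w) * sin t - t * mu (alpha w)) + (-1) * expR (- (mu (alpha w) * (t ^+ 2 / 2)))).
      by apply/funext => w; rewrite mulN1r.
    apply: bounded_measurableD => //.
    by apply: bounded_measurableM => //; exact: bounded_measurable_cst.
  by rewrite -muE; exact: poisson_cf_gaussian.
have -> : \int[P]_w sin (t * W w) = \int[P]_w (expR (- (mu (alpha w) * (1 - cos t))) *
    sin (mu (alpha w) * sin t - t * mu (alpha w))).
  have := cf_shift t (- (pi / 2)); under eq_Rintegral do rewrite cosBpihalf.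
  by move=> ->; apply: eq_Rintegral => w _; rewrite cosBpihalf.
by apply: bound => // w; rewrite -muE; exact: poisson_cf_sin.
Qed.

End centered_poisson_mixture.

Section domain_of_attraction.
Context d (T : measurableType d) (R : realType) (P : probability T R).
Variables (lambda : R) (alpha : {RV P >-> R}) (X : T -> nat).
Hypothesis lambda0 : 0 < lambda.
Hypothesis a01 : forall w, 0 < alpha w < 1.
Hypothesis mX : measurable_fun setT X.
Hypothesis aX : cond_pmf P alpha X (fun a => poisson_pmf (lambda / (1 - a))).
Variables (b kappa : R).
Hypothesis b01 : 0 < b < 1.
Hypothesis kappa0 : 0 <= kappa.
Hypothesis tail : forall e, 0 < e -> exists2 r, 0 < r &
  forall x, 0 < x < r ->
    `|fine (P [set w | 1 - alpha w <= x]) - kappa * x `^ b| <= e * x `^ b.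

Let W w : R := (X w)%:R - lambda / (1 - alpha w).
Let p : R := 1 / (2 * b).

Lemma centered_cf_scaling (theta : R) :
  N%:R * (1 - \int[P]_w cos (theta * N%:R `^ (- p) * W w)) @[N --> \oo] -->
    kappa * Gamma (1 - b) * (lambda / 2) `^ b * `|theta| `^ (2 * b) /\
  N%:R * `|\int[P]_w sin (theta * N%:R `^ (- p) * W w)| @[N --> \oo] --> (0 : R).
Proof.
have /andP[b0 b1] := b01.
have p0 : 0 < p by rewrite divr_gt0// mulr_gt0.
have [->|theta0] := eqVneq theta 0.
  rewrite normr0 powR0 ?mulr0 ?mulf_neq0 ?gt_eqF//.
  split; apply: cvg_near_cst; apply: nearW => N.
    under eq_Rintegral do rewrite !mul0r cos0.
    by rewrite Rintegral_probability_cst subrr mulr0.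
  under eq_Rintegral do rewrite !mul0r sin0.
  by rewrite Rintegral_probability_cst normr0 mulr0.
have mA : measurable_fun setT (fun w => 1 - alpha w) by apply: measurable_funB.
have A0 w : 0 < 1 - alpha w by have /andP[_ a1] := a01 w; rewrite subr_gt0.
pose L (s : R) := \int[P]_w (1 - expR (- (s / (1 - alpha w)))).
pose t N := theta * N.+1%:R `^ (- p).
have x0 N : 0 < N.+1%:R `^ (- p) :> R by rewrite powR_gt0// ltr0n.
have tN N : `|t N| = `|theta| * N.+1%:R `^ (- p) by rewrite normrM (gtr0_norm (x0 N)).
have t0 N : 0 < `|t N| by rewrite tN mulr_gt0// normr_gt0.
have tpow q N : `|t N| `^ q = `|theta| `^ q * N.+1%:R `^ (- (p * q)).
  by rewrite tN powRM ?(ltW (x0 N))// -powRrM mulNr.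
pose s N := lambda * (t N ^+ 2 / 2).
pose s3 N := lambda * `|t N| ^+ 3.
have s0 N : 0 < s N by rewrite mulr_gt0// divr_gt0// exprn_even_gt0//= -normr_gt0.
have s30 N : 0 < s3 N by rewrite mulr_gt0// exprn_gt0.
have sb N : s N `^ b = (lambda / 2) `^ b * `|theta| `^ (2 * b) / N.+1%:R.
  have -> : s N = (lambda / 2) * `|t N| `^ 2.
    by rewrite /s powR_mulrn// -normrX ger0_norm ?sqr_ge0//; ring.
  rewrite powRM ?powR_ge0 ?divr_ge0 ?(ltW lambda0)// -powRrM tpow mulrA; congr (_ * _).
  have -> : p * (2 * b) = 1 by rewrite /p mul1r mulVf// mulf_neq0// gt_eqF.
  by rewrite powRN powRr1.
have s3b N : N.+1%:R * s3 N `^ b = lambda `^ b * `|theta| `^ (3 * b) * N.+1%:R `^ (- (1/2)).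
  have -> : s3 N = lambda * `|t N| `^ 3 by rewrite /s3 powR_mulrn.
  rewrite powRM ?powR_ge0 ?(ltW lambda0)// -powRrM tpow mulrCA -[RHS]mulrA; congr (_ * _).
  rewrite mulrCA; congr (_ * _).
  have -> : p * (3 * b) = 1 + 1 / 2 by rewrite /p; field; rewrite gt_eqF.
  rewrite opprD powRD; last by rewrite pnatr_eq0 implybT.
  by rewrite powRN powRr1// mulrA divff ?mul1r// pnatr_eq0.
have pcvg q : 0 < q -> N.+1%:R `^ (- q) @[N --> \oo] --> (0 : R).
  by move=> q0; rewrite (cvg_shiftS (fun N => N%:R `^ (- q))); exact: cvg_natr_powRN.
have t_cvg : `|t N| @[N --> \oo] --> 0.
  have h : `|theta| * N.+1%:R `^ (- p) @[N --> \oo] --> `|theta| * 0.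
    by apply: cvgM; [exact: cvg_cst|exact: pcvg].
  by move: h; rewrite mulr0; under eq_fun do rewrite -tN.
have s_cvg : s N @[N --> \oo] --> 0.
  rewrite (_ : s = fun N => lambda * (`|t N| * `|t N| / 2)); last first.
    by apply/funext => N; rewrite /s -normrM -expr2 ger0_norm ?sqr_ge0.
  rewrite -[X in _ --> X](mulr0 lambda); apply: cvgM; first exact: cvg_cst.
  rewrite -[X in _ --> X](mul0r 2^-1); apply: cvgM; last exact: cvg_cst.
  by rewrite -[X in _ --> X](mul0r 0); apply: cvgM.
have main := abelian_cvg mA A0 b01 kappa0 tail s0 s_cvg.
have [C C0 hC] := abelian_bound mA A0 b01 kappa0 tail.
pose err N := 3 * C * (lambda `^ b * `|theta| `^ (3 * b)) * N.+1%:R `^ (- (1/2)).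
have err_cvg : err N @[N --> \oo] --> 0.
  rewrite -[X in _ --> X](mulr0 (3 * C * (lambda `^ b * `|theta| `^ (3 * b)))).
  by apply: cvgM; [exact: cvg_cst|exact: pcvg].
have errP N : N.+1%:R * (3 * L (s3 N)) <= err N.
  rewrite /err -[leRHS]mulrA -s3b mulrCA -[leRHS]mulrA ler_pM2l//.
  by rewrite [leRHS]mulrCA ler_pM2l ?ltr0n// hC.
have approx : \forall N \near \oo,
    `|\int[P]_w cos (t N * W w) - (1 - L (s N))| <= 3 * L (s3 N) /\
    `|\int[P]_w sin (t N * W w)| <= 3 * L (s3 N).
  near=> N; apply: (centered_cf_approx lambda0 a01 mX aX).
  apply: ltW; rewrite -[ltLHS]normr_id; near: N.
  by move/cvgr0Pnorm_lt : t_cvg; apply.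
split.
  rewrite -(cvg_shiftS (fun N => N%:R * (1 - \int[P]_w cos (theta * N%:R `^ (- p) * W w)))).
  have hL : N.+1%:R * L (s N) @[N --> \oo] -->
      kappa * Gamma (1 - b) * (lambda / 2) `^ b * `|theta| `^ (2 * b).
    rewrite -mulrA (_ : (fun N => _) = fun N => L (s N) / s N `^ b * ((lambda / 2) `^ b * `|theta| `^ (2 * b))).
      by apply: cvgM; [exact: main|exact: cvg_cst].
    apply/funext => N; rewrite sb invf_div; field.
    by rewrite !gt_eqF ?powR_gt0 ?normr_gt0// divr_gt0.
  apply/cvgrPdist_le => e e0.
  have e20 : 0 < e / 2 by rewrite divr_gt0.
  near=> N.
  set K := kappa * _ * _ * _; rewrite -/(t N).
  have h1 : `|K - N.+1%:R * L (s N)| <= e / 2.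
    by near: N; move/cvgrPdist_le : hL; apply.
  have h2 : err N <= e / 2.
    rewrite (le_trans (ler_norm _))//; near: N.
    by move/cvgr0Pnorm_le : err_cvg; apply.
  have [h3 _] : `|\int[P]_w cos (t N * W w) - (1 - L (s N))| <= 3 * L (s3 N) /\
    `|\int[P]_w sin (t N * W w)| <= 3 * L (s3 N) by near: N.
  rewrite /=.
  have -> : K - N.+1%:R * (1 - \int[P]_w cos (t N * W w)) = (K - N.+1%:R * L (s N)) +
     N.+1%:R * (\int[P]_w cos (t N * W w) - (1 - L (s N))) by ring.
  rewrite (le_trans (ler_normD _ _))// (splitr e) lerD// normrM normr_nat.
  by rewrite (le_trans _ h2)// (le_trans _ (errP N))// ler_pM2l ?ltr0n.
rewrite -(cvg_shiftS (fun N => N%:R * `|\int[P]_w sin (theta * N%:R `^ (- p) * W w)|)).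
apply/cvgr0Pnorm_le => e e0; near=> N; rewrite /= -/(t N).
rewrite normrM normr_id normr_nat (@le_trans _ _ (err N))//.
  rewrite (le_trans _ (errP N))// ler_pM2l ?ltr0n//.
  have [_ //] : `|\int[P]_w cos (t N * W w) - (1 - L (s N))| <= 3 * L (s3 N) /\
    `|\int[P]_w sin (t N * W w)| <= 3 * L (s3 N) by near: N.
rewrite (le_trans (ler_norm _))//; near: N.
by move/cvgr0Pnorm_le : err_cvg; apply.
Unshelve. all: by end_near. Qed.

End domain_of_attraction.

Section row_functions.
Context (R : realType) (m : nat).

Lemma cvg_row (F : set_system nat) (FF : Filter F) (a : nat -> 'I_m -> R) (l : 'I_m -> R) :
  (forall i, a ^~ i @ F --> l i) -> \row_i a n i @[n --> F] --> \row_i l i.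
Proof.
move=> al; apply/cvg_ballP => e e0.
have : \forall n \near F, forall i : 'I_m, `|l i - a n i| < e.
  apply: filter_forall => i; have /cvgrPdist_lt := al i; exact.
by apply: filterS => n h; split => // i j; rewrite !mxE; exact: h.
Qed.

Lemma continuous_row (c : 'I_m -> R) : continuous (fun x : R => \row_i (c i * x)).
Proof.
move=> x; apply/cvg_ballP => e e0.
have : \forall y \near x, forall i : 'I_m, `|c i * x - c i * y| < e.
  apply: (@filter_forall R 'I_m (fun i y => `|c i * x - c i * y| < e) (nbhs x) _) => i.
  have : c i * y @[y --> x] --> c i * x by apply: cvgM => //; exact: cvg_cst.
  by move/cvgrPdist_lt => /(_ e e0).
by apply: filterS => y h; split => // i j; rewrite !mxE; exact: h.
Qed.

(** Rounding each coordinate down to a multiple of 1/(n+1) leaves countably many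
    values, so that no measurable structure on row vectors is needed. *)
Lemma measurable_row_continuous d (T : measurableType d) (f : 'rV[R]_m -> R)
  (Z : 'I_m -> T -> R) : continuous f -> (forall i, measurable_fun setT (Z i)) ->
  measurable_fun setT (fun w => f (\row_i Z i w)).
Proof.
move=> cf mZ.
pose fl n (i : 'I_m) w : int := Num.floor (n.+1%:R * Z i w).
pose q n (i : 'I_m) w : R := (fl n i w)%:~R / n.+1%:R.
apply: (@measurable_fun_cvg _ _ _ _ (fun n w => f (\row_i q n i w))); last first.
  move=> w _; suff h : \row_i q n i w @[n --> \oo] --> \row_i Z i w.
    by have := cvg_comp _ _ h (cf _); exact.
  apply: cvg_row => i; apply/cvgrPdist_lt => e e0; near=> n.
  have n0 : 0 < n.+1%:R :> R by rewrite ltr0n.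
  have /andP[h1 h2] := floor_itv (n.+1%:R * Z i w).
  have -> : Z i w - q n i w = (n.+1%:R * Z i w - (fl n i w)%:~R) / n.+1%:R.
    by rewrite /q mulrBl mulrAC divff ?mul1r// gt_eqF.
  rewrite ger0_norm ?divr_ge0 ?subr_ge0// ltr_pdivrMr//.
  rewrite (@lt_le_trans _ _ 1)//; first by rewrite ltrBlDl -intrD1.
  rewrite -ler_pdivrMl// mulr1; apply: ltW; rewrite (@lt_trans _ _ n%:R) ?ltr_nat//.
  near: n; exact: nbhs_infty_gtr.
move=> n _ B _; rewrite setTI.
have -> : (fun w => f (\row_i q n i w)) @^-1` B =
    \bigcup_(v : {ffun 'I_m -> int}) (if `[< B (f (\row_i ((v i)%:~R / n.+1%:R))) >]
      then \bigcap_(i in [set: 'I_m]) (fl n i @^-1` [set v i]) else set0).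
  have rowE v w : (forall i, fl n i w = v i) -> \row_i ((v i)%:~R / n.+1%:R) = \row_i q n i w :> 'rV[R]_m.
    by move=> h; apply/rowP => i; rewrite !mxE /q h.
  apply/seteqP; split => [w wB|w [v _]].
    exists [ffun i => fl n i w] => //; rewrite (rowE _ w) => [|i]; last by rewrite ffunE.
    by rewrite asboolT//= => i _ /=; rewrite ffunE.
  case: ifPn => // /asboolP h1 h2; rewrite /preimage/= -(rowE v) => // i; exact: h2.
apply: countable_bigcupT_measurable => [|v]; first exact: countableP.
case: ifP => // _; apply: fin_bigcap_measurable => // i _.
have -> : fl n i @^-1` [set v i] = (fun w => n.+1%:R * Z i w) @^-1` `[(v i)%:~R, (v i + 1)%:~R[%classic.
  apply/seteqP; split => w; rewrite /preimage/= in_itv/=.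
    by move/eqP; rewrite floor_eq.
  by rewrite -floor_eq => /eqP.
rewrite -[X in measurable X]setTI.
have h : measurable_fun setT (fun w => n.+1%:R * Z i w) by exact: measurable_funM.
by apply: h => //; exact: measurable_itv.
Unshelve. all: by end_near. Qed.

End row_functions.

Section slutsky.
Context d (T : measurableType d) (R : realType) (P : probability T R) (m : nat).
Variables (S : nat -> T -> R) (E : 'I_m -> nat -> T -> R) (c : 'I_m -> R).
Variables (f : 'rV[R]_m -> R) (M : R).
Hypothesis mS : forall n, measurable_fun setT (S n).
Hypothesis mE : forall i n, measurable_fun setT (E i n).
Hypothesis cf : continuous f.
Hypothesis fM : forall x, `|f x| <= M.
Hypothesis tightS : forall e, 0 < e ->
  exists2 L : R, 0 < L & \forall n \near \oo, (P [set w | (L < `|S n w|)%R] <= e%:E)%E.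
Hypothesis E0 : forall i r e, 0 < r -> 0 < e ->
  \forall n \near \oo, (P [set w | (r < `|E i n w|)%R] <= e%:E)%E.

(** A continuous function is uniformly continuous around the compact piece of line
    on which S stays with high probability. *)
Lemma slutsky_line :
  \int[P]_w f (\row_i (c i * S n w + E i n w)) - \int[P]_w f (\row_i (c i * S n w))
    @[n --> \oo] --> 0.
Proof.
have M0 : 0 <= M by rewrite (le_trans _ (fM 0)).
have b1 n : bounded_measurable (fun w => f (\row_i (c i * S n w + E i n w))).
  split; last by exists M.
  by apply: measurable_row_continuous => // i; apply: measurable_funD => //; exact: measurable_funM.
have b2 n : bounded_measurable (fun w => f (\row_i (c i * S n w))).
  split; last by exists M.
  by apply: measurable_row_continuous => // i; exact: measurable_funM.
have mbig := @measurable_norm_gt _ T R.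
apply/cvgr0Pnorm_le => e e0.
pose e1 := e / 2 / (2 * M * (1 + m%:R) + 1).
have den0 : 0 < 2 * M * (1 + m%:R) + 1 by rewrite ltr_wpDl// !mulr_ge0// addr_ge0.
have e10 : 0 < e1 by rewrite !divr_gt0.
have e20 : 0 < e / 2 by rewrite divr_gt0.
have [L L0 hL] := tightS e10.
pose K := (fun x : R => \row_i (c i * x)) @` `[- L, L]%classic.
have cK : compact K.
  apply: continuous_compact; last exact: segment_compact.
  exact/continuous_subspaceT/continuous_row.
have [r r0 hr] := compact_unif_continuous cK cf e20.
have r20 : 0 < r / 2 by rewrite divr_gt0.
have hE : \forall n \near \oo, forall i, (P [set w | (r / 2 < `|E i n w|)%R] <= e1%:E)%E.
  by apply: filter_forall => i; exact: E0.
near=> n.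
have PL : (P [set w | (L < `|S n w|)%R] <= e1%:E)%E by near: n.
have PE i : (P [set w | (r / 2 < `|E i n w|)%R] <= e1%:E)%E.
  by move: i; near: n.
pose bad w : R := \1_[set w | L < `|S n w|] w + \sum_i \1_[set w | r / 2 < `|E i n w|] w.
have bi (g : T -> R) s : measurable_fun setT g -> bounded_measurable (\1_[set w | s < `|g w|] : T -> R).
  by move=> mg; apply: bounded_measurable_indic; exact: mbig.
have bsum : bounded_measurable (fun w => \sum_i (\1_[set w | r / 2 < `|E i n w|] w : R)).
  by apply: bounded_measurable_sum => i; exact: bi.
have bbad : bounded_measurable bad by apply: bounded_measurableD => //; exact: bi.
have bc k : @bounded_measurable _ T R (fun=> k) by exact: bounded_measurable_cst.
have Ibad : \int[P]_w bad w <= e1 * (1 + m%:R).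
  rewrite bounded_RintegralD//; last exact: bi.
  rewrite mulrDr mulr1 lerD//.
    by rewrite Rintegral_indic; [rewrite -lee_fin fineK// fin_num_measure//; exact: mbig|exact: mbig].
  have -> : \int[P]_w (\sum_i (\1_[set w | r / 2 < `|E i n w|] w : R)) =
      \sum_i \int[P]_w (\1_[set w | r / 2 < `|E i n w|] w : R).
    by apply: bounded_Rintegral_sum => i; exact: bi.
  rewrite -[X in e1 * X%:R]card_ord mulr_natr -sumr_const; apply: ler_sum => i _.
  by rewrite Rintegral_indic; [rewrite -lee_fin fineK// fin_num_measure//; exact: mbig|exact: mbig].
have pointwise w : `|f (\row_i (c i * S n w + E i n w)) - f (\row_i (c i * S n w))| <= e / 2 + 2 * M * bad w.
  have bad0 : 0 <= bad w by rewrite addr_ge0// ?sumr_ge0.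
  have [/andP[Sw Ew]|] := boolP ((`|S n w| <= L) && [forall i, `|E i n w| <= r / 2]).
    apply: (@le_trans _ _ (e / 2)); last by rewrite lerDl !mulr_ge0.
    apply: ltW; apply: hr.
      by exists (S n w) => //=; rewrite in_itv/= -ler_norml.
    split => // i j; rewrite !mxE /ball/= opprD addNKr normrN.
    by rewrite (le_lt_trans (forallP Ew j))// ltr_pdivrMr// ltr_pMr// ltr1n.
  have dM : `|f (\row_i (c i * S n w + E i n w)) - f (\row_i (c i * S n w))| <= 2 * M.
    by rewrite (le_trans (ler_normB _ _))// mulr2n mulrDl mul1r lerD.
  move=> h; rewrite (le_trans dM)// (@le_trans _ _ (2 * M * bad w))//; last by rewrite lerDr ltW.
  rewrite ler_peMr ?mulr_ge0//; move: h; rewrite negb_and -ltNge negb_forall => /orP[h|h].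
    by rewrite /bad indicE mem_set// lerDl sumr_ge0.
  have /fintype.existsP[i hi] := h; move: hi; rewrite -ltNge => hi; rewrite /bad (bigD1 i)//= [X in _ + (X + _)]indicE mem_set//= addrCA lerDl.
  by rewrite addr_ge0// ?sumr_ge0.
rewrite -bounded_RintegralB//.
have bdiff : bounded_measurable (fun w => f (\row_i (c i * S n w + E i n w)) - f (\row_i (c i * S n w))).
  split; first by apply: measurable_funB; [have [] := b1 n|have [] := b2 n].
  by exists (M + M) => w; rewrite (le_trans (ler_normB _ _))// lerD.
rewrite (le_trans (le_normr_Rintegral _ _))//; first exact: bounded_measurable_integrable.
have bub : bounded_measurable (fun w => e / 2 + 2 * M * bad w).
  by apply: bounded_measurableD => //; exact: bounded_measurableM.
apply: (@le_trans _ _ (\int[P]_w (e / 2 + 2 * M * bad w))).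
  apply: le_Rintegral => //.
  - apply: bounded_measurable_integrable; case: bdiff => mf [N fN].
    by split; [exact: measurableT_comp|exists N => w; rewrite normr_id].
  - exact: bounded_measurable_integrable.
rewrite bounded_RintegralD//; last exact: bounded_measurableM.
rewrite Rintegral_probability_cst RintegralZl//; last exact: bounded_measurable_integrable.
rewrite [leRHS]splitr lerD2l (le_trans (ler_wpM2l _ Ibad)) ?mulr_ge0//.
have -> : e / 2 = e1 * (2 * M * (1 + m%:R) + 1) by rewrite /e1 divfK// gt_eqF.
by rewrite mulrCA ler_wpM2l ?(ltW e10)// lerDl.
Unshelve. all: by end_near. Qed.

End slutsky.

Section centered_square_integrable.
Context d (T : measurableType d) (R : realType) (P : probability T R).
Implicit Types f g : T -> R.

Definition square_integrable f :=
  measurable_fun setT f /\ (\int[P]_w (f w ^+ 2)%:E < +oo)%E.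

Lemma square_integrableP f : square_integrable f -> P.-integrable setT (fun w => (f w ^+ 2)%:E).
Proof.
move=> [mf f2]; apply/integrableP; split.
  by apply/measurable_EFinP; exact: measurable_funX.
by under eq_integral do rewrite /= ger0_norm ?sqr_ge0//.
Qed.

Lemma square_integrable_integrable f : square_integrable f -> P.-integrable setT (EFin \o f).
Proof.
move=> sf; have i2 := square_integrableP sf; case: sf => mf _.
have i1 : P.-integrable setT (EFin \o fun=> 1 : R).
  by apply: bounded_measurable_integrable; exact: bounded_measurable_cst.
apply: (@le_integrable _ _ _ _ _ _ _ _ _ _ (integrableD measurableT i1 i2)) => //.
  exact/measurable_EFinP.
move=> w _ /=; rewrite lee_fin [leRHS]ger0_norm ?addr_ge0 ?sqr_ge0//.
rewrite -real_normK ?num_real//; set x := `|f w|.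
have := sqr_ge0 (x - 2^-1); have := sqr_ge0 x; rewrite sqrrB; nra.
Qed.

Lemma square_integrableD f g : square_integrable f -> square_integrable g ->
  square_integrable (fun w => f w + g w).
Proof.
move=> sf sg; have [mf f2] := sf; have [mg g2] := sg.
split; first exact: measurable_funD.
apply: (@le_lt_trans _ _ (\int[P]_w (2 * f w ^+ 2 + 2 * g w ^+ 2)%:E)%E).
  apply: ge0_le_integral => //.
  - by move=> w _; rewrite lee_fin sqr_ge0.
  - by apply/measurable_EFinP; apply: measurable_funX; exact: measurable_funD.
  - apply/measurable_EFinP; apply: measurable_funD; apply: measurable_funM;
      do ?[exact: measurable_cst|exact: measurable_funX].
  - by move=> w _; rewrite lee_fin; have := sqr_ge0 (f w - g w); rewrite !expr2; nra.
have i : P.-integrable setT (fun w => (2 * f w ^+ 2 + 2 * g w ^+ 2)%:E).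
  have := integrableD measurableT (integrableZl measurableT 2 (square_integrableP sf))
    (integrableZl measurableT 2 (square_integrableP sg)).
  by apply: eq_integrable => // w _; rewrite /= EFinD !EFinM.
by have := integrable_lty measurableT i.
Qed.

Definition centered_sqr f := square_integrable f /\ \int[P]_w f w = 0.

Lemma centered_sqrD f g : centered_sqr f -> centered_sqr g -> centered_sqr (fun w => f w + g w).
Proof.
move=> [sf f0] [sg g0]; split; first exact: square_integrableD.
rewrite RintegralD ?f0 ?g0 ?addr0//; exact: square_integrable_integrable.
Qed.

Lemma centered_sqr_sum (I : Type) (s : seq I) (F : I -> T -> R) :
  (forall i, centered_sqr (F i)) -> centered_sqr (fun w => \sum_(i <- s) F i w).
Proof.
move=> cF; elim: s => [|i s ih].
  under eq_fun do rewrite big_nil; split; last exact: Rintegral_probability_cst.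
  split; first exact: measurable_cst.
  by under eq_integral do rewrite expr0n/=; rewrite integral0 ltry.
by under eq_fun do rewrite big_cons; exact: centered_sqrD.
Qed.

Lemma centered_sqr_ae f g : measurable_fun setT g -> {ae P, forall w, f w = g w} ->
  centered_sqr f -> centered_sqr g.
Proof.
move=> mg fg [[mf f2] f0]; split.
  split => //.
  have -> : (\int[P]_w (g w ^+ 2)%:E = \int[P]_w (f w ^+ 2)%:E)%E; last exact: f2.
  apply/esym/ae_eq_integral => //.
  - by apply/measurable_EFinP; exact: measurable_funX.
  - by apply/measurable_EFinP; exact: measurable_funX.
  - by apply: filterS fg => w e _ /=; rewrite e.
rewrite -f0 /Rintegral; congr fine; apply/esym/ae_eq_integral => //.
- exact/measurable_EFinP.
- exact/measurable_EFinP.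
- by apply: filterS fg => w e _ /=; rewrite e.
Qed.

(** First order Taylor expansion of the characteristic function at the origin. *)
Lemma centered_sqr_cf f : centered_sqr f -> exists2 k : R, 0 <= k &
  forall t, `|\int[P]_w cos (t * f w) - 1| + `|\int[P]_w sin (t * f w)| <= k * t ^+ 2.
Proof.
move=> [sf f0]; have [mf _] := sf; have i1 := square_integrable_integrable sf.
have i2 := square_integrableP sf.
pose V := \int[P]_w (f w ^+ 2).
exists (2^-1 * V + 2 * V).
  by rewrite addr_ge0// mulr_ge0//; apply: Rintegral_ge0 => w _; rewrite sqr_ge0.
move=> t; have mtf : measurable_fun setT (fun w => t * f w) by exact: measurable_funM.
have bc := bounded_measurable_cos mtf; have bs := bounded_measurable_sin mtf.
have bc1 : @bounded_measurable _ T R (fun=> 1) by exact: bounded_measurable_cst.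
have ic := bounded_measurable_integrable P bc; have is_ := bounded_measurable_integrable P bs.
have ib := bounded_measurable_integrable P bc1.
have key (F : T -> R) c : P.-integrable setT (EFin \o F) -> (forall w, `|F w| <= c * (t * f w) ^+ 2) ->
    `|\int[P]_w F w| <= c * V * t ^+ 2.
  move=> iF Fle; rewrite (le_trans (le_normr_Rintegral _ _))//.
  have -> : c * V * t ^+ 2 = \int[P]_w (c * t ^+ 2 * f w ^+ 2).
    by rewrite RintegralZl// mulrAC.
  apply: le_Rintegral => //.
  - exact: integrable_norm.
  - by have := integrableZl measurableT (c * t ^+ 2) i2; apply: eq_integrable => // w _; rewrite /= EFinM.
  - by move=> w _; rewrite (le_trans (Fle w))// exprMn mulrA.
rewrite mulrDl; apply: lerD.
  rewrite -[X in _ - X](Rintegral_probability_cst P) -bounded_RintegralB//; apply: key.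
    apply: bounded_measurable_integrable; split; first by apply: measurable_funB => //; case: bc.
    by exists (1 + 1) => w; rewrite (le_trans (ler_normB _ _))// lerD ?cos_max ?normr1.
  move=> w; have := cos_ge_sqr (normr_ge0 (t * f w)); rewrite cos_norm real_normK ?num_real//.
  by rewrite distrC ger0_norm ?subr_ge0 ?cos_le1// => h; lra.
have -> : \int[P]_w sin (t * f w) = \int[P]_w (sin (t * f w) - t * f w).
  rewrite RintegralB//; last first.
    by have := integrableZl measurableT t i1; apply: eq_integrable => // w _; rewrite /= EFinM.
  by rewrite RintegralZl// f0 mulr0 subr0.
apply: key.
  have i3 : P.-integrable setT (EFin \o (fun w => t * f w)).
    by have := integrableZl measurableT t i1; apply: eq_integrable => // w _; rewrite /= EFinM.
  by have := integrableB measurableT is_ i3; apply: eq_integrable => // w _; rewrite /= EFinB.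
move=> w; set x := t * f w; rewrite -[x ^+ 2]real_normK ?num_real//.
have [x1|x1] := leP `|x| 1.
  rewrite (le_trans (sin_taylor _))// (exprS _ 2) mulrA ler_wpM2r ?exprn_ge0//.
  by rewrite (le_trans (ler_wpM2l _ x1))//; lra.
rewrite (le_trans (ler_normB _ _))// (@le_trans _ _ (2 * `|x|))//.
  by rewrite mulr2n mulrDl mul1r lerD// norm_sin_le.
by rewrite ler_pM2l// expr2 ler_peMr// ltW.
Qed.

End centered_square_integrable.

Section negligible_noise.
Context d (T : measurableType d) (R : realType) (P : probability T R).
Variables (Z : nat -> T -> R) (C S : R -> R) (k : R) (c : nat -> R).
Hypothesis mZ : forall j, measurable_fun setT (Z j).
Hypothesis indep : mutually_independent P Z.
Hypothesis ZC : forall t j, \int[P]_w cos (t * Z j w) = C t.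
Hypothesis ZS : forall t j, \int[P]_w sin (t * Z j w) = S t.
Hypothesis k0 : 0 <= k.
Hypothesis CS : forall t, `|C t - 1| + `|S t| <= k * t ^+ 2.
Hypothesis c0 : N%:R * c N ^+ 2 @[N --> \oo] --> (0 : R).

Lemma iid_centered_negligible r e : 0 < r -> 0 < e ->
  \forall N \near \oo, (P [set w | (r < `|c N * \sum_(j < N) Z j w|)%R] <= e%:E)%E.
Proof.
move=> r0 e0; pose delta := 2 / r.
have d0 : 0 < delta by rewrite divr_gt0.
have rE : 2 / delta = r by rewrite /delta invf_div mulrCA divff ?mulr1// gt_eqF.
have eps0 : 0 < e / (2 * (k * delta ^+ 2 + 1)).
  by rewrite divr_gt0// mulr_gt0// ltr_wpDl// mulr_ge0// exprn_ge0// ltW.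
near=> N.
have hN : N%:R * c N ^+ 2 <= e / (2 * (k * delta ^+ 2 + 1)).
  by rewrite (le_trans (ler_norm _))//; near: N; move/cvgr0Pnorm_le : c0; apply.
pose X w := c N * \sum_(j < N) Z j w.
have mX : measurable_fun setT X by apply: measurable_funM => //; exact: measurable_sum.
have mA : measurable [set w | (r < `|X w|)%R] by exact: measurable_norm_gt.
have fA : P [set w | (r < `|X w|)%R] \is a fin_num by exact: fin_num_measure.
rewrite -/(X _) -(fineK fA) lee_fin.
have := tail_le_cf P mX d0; rewrite rE.
have bcos t : bounded_measurable (fun w => cos (t * X w)).
  by apply: bounded_measurable_cos; exact: measurable_funM.
have bc1 : @bounded_measurable _ T R (fun=> 1) by exact: bounded_measurable_cst.
have mXT : measurable_fun setT (fun z : R * T => 1 - cos (z.1 * X z.2)).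
  apply: measurable_funB => //.
  apply: measurable_cos_comp; apply: measurable_funM => //.
  exact: measurableT_comp.
have bXT t w : `|1 - cos (t * X w)| <= 2.
  by rewrite (le_trans (ler_normB _ _))// normr1 (natrD _ 1 1) lerD2l cos_max.
have : \int[uniform_prob d0]_t \int[P]_w (1 - cos (t * X w)) <= e / 2.
  apply: Rintegral_uniform_le.
  - exact: (bounded_fubini_measurable (uniform_prob d0) P mXT bXT).
  - by move=> t; apply: Rintegral_ge0 => w _; rewrite subr_ge0 cos_le1.
  move=> t /andP[t0 td]; rewrite bounded_RintegralB// Rintegral_probability_cst.
  have [h _] := iid_cf_approx mZ indep (ZC (t * c N)) (ZS (t * c N)) N (r := 1) (introT andP (conj ler01 (lexx 1))).
  rewrite expr1n in h.
  have e1 : \int[P]_w cos (t * X w) = \int[P]_w cos (t * c N * \sum_(j < N) Z j w).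
    by apply: eq_Rintegral => w _; rewrite /X mulrA.
  rewrite e1 (le_trans (ler_norm _))// distrC (le_trans h)//.
  rewrite (@le_trans _ _ (N%:R * (k * (t * c N) ^+ 2)))//; first by rewrite ler_wpM2l.
  have -> : N%:R * (k * (t * c N) ^+ 2) = (N%:R * c N ^+ 2) * (k * t ^+ 2) by ring.
  have kt : k * t ^+ 2 <= k * delta ^+ 2 + 1.
    by rewrite ler_wpDr// ler_wpM2l// lerXn2r// nnegrE// ltW.
  rewrite (le_trans (ler_pM _ _ hN kt))//.
  - by rewrite mulr_ge0// sqr_ge0.
  - by rewrite mulr_ge0// sqr_ge0.
  have den : k * delta ^+ 2 + 1 != 0.
    by rewrite gt_eqF// ltr_wpDl// mulr_ge0// exprn_ge0// ltW.
  by rewrite le_eqVlt; apply/orP; left; apply/eqP; field.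
by move=> h1 h2; have := le_trans h2 h1; rewrite mulrC ler_pM2r.
Unshelve. all: by end_near. Qed.

End negligible_noise.

Section same_law.
Context d (T : measurableType d) d' (T' : measurableType d') (R : realType).
Variables (P : probability T R) (P' : probability T' R) (Z : T -> R) (Z' : T' -> R).
Hypothesis mZ : measurable_fun setT Z.
Hypothesis mZ' : measurable_fun setT Z'.
Hypothesis same : forall B, measurable B -> P (Z @^-1` B) = P' (Z' @^-1` B).

Lemma same_law_integral (h : R -> \bar R) : measurable_fun setT h ->
  (\int[P]_w h (Z w) = \int[P']_w h (Z' w))%E.
Proof.
have ge0 (k : R -> \bar R) : measurable_fun setT k -> (forall x, 0 <= k x)%E ->
    (\int[P]_w k (Z w) = \int[P']_w k (Z' w))%E.
  move=> mk k0.
  have e1 := @ge0_integral_pushforward _ _ T R R Z mZ P setT k measurableT mk (fun x _ => k0 x).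
  have e2 := @ge0_integral_pushforward _ _ T' R R Z' mZ' P' setT k measurableT mk (fun x _ => k0 x).
  rewrite preimage_setT in e1; rewrite preimage_setT in e2.
  transitivity (\int[pushforward P Z]_y k y)%E; first exact/esym/e1.
  rewrite -e2; apply: eq_measure_integral => A mA _; exact: same.
move=> mh; rewrite integralE [RHS]integralE.
have hp := ge0 (h^\+)%E (measurable_funepos mh) (fun x => funepos_ge0 h x).
have hn := ge0 (h^\-)%E (measurable_funeneg mh) (fun x => funeneg_ge0 h x).
congr (_ - _)%E.
  rewrite (eq_integral (fun w => (h^\+)%E (Z w))) => [|w _]; last by rewrite !funeposE.
  by rewrite hp; apply: eq_integral => w _; rewrite !funeposE.
rewrite (eq_integral (fun w => (h^\-)%E (Z w))) => [|w _]; last by rewrite !funenegE.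
by rewrite hn; apply: eq_integral => w _; rewrite !funenegE.
Qed.

Lemma same_law_Rintegral (h : R -> R) : measurable_fun setT h ->
  \int[P]_w h (Z w) = \int[P']_w h (Z' w).
Proof.
by move=> mh; rewrite /Rintegral (@same_law_integral (EFin \o h))//; exact/measurable_EFinP.
Qed.

End same_law.

Section poisson_difference.
Context d (T : measurableType d) (R : realType) (P : probability T R).
Variables (lambda : R) (alpha : {RV P >-> R}).
Hypothesis lambda0 : 0 < lambda.

Let moment (V : T -> nat) (h : nat -> R) (l : R) : measurable_fun setT V ->
  cond_pmf P alpha V (fun=> poisson_pmf lambda) -> (forall m, 0 <= h m) ->
  (\sum_(0 <= m <oo) (poisson_pmf lambda m * h m)%:E = l%:E)%E ->
  (\int[P]_w (h (V w))%:E = l%:E)%E.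
Proof.
move=> mV VP h0 hl.
rewrite (cond_pmf_expectation (measurable_funPT alpha) mV _ _ VP (h := fun _ => h))//.
- under eq_integral do rewrite hl.
  by rewrite integral_cst//= probability_setT mule1.
- by move=> _ m; exact: poisson_pmf_ge0.
Qed.

Lemma poisson_square_integrable (V : T -> nat) : measurable_fun setT V ->
  cond_pmf P alpha V (fun=> poisson_pmf lambda) ->
  square_integrable P (fun w => (V w)%:R) /\ \int[P]_w (V w)%:R = lambda.
Proof.
move=> mV VP; split.
  split.
    have h : measurable_fun setT (fun n : nat => n%:R : R) by [].
    by have := measurableT_comp h mV; exact.
  rewrite (@moment V (fun m => m%:R ^+ 2) (lambda * (lambda + 1)))//.
  - by rewrite ltry.
  - exact: poisson_second_moment.
by rewrite /Rintegral (@moment V (fun m => m%:R) lambda)//; exact: poisson_mean.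
Qed.

Lemma poisson_difference_centered (V V' : T -> nat) :
  measurable_fun setT V -> measurable_fun setT V' ->
  cond_pmf P alpha V (fun=> poisson_pmf lambda) ->
  cond_pmf P alpha V' (fun=> poisson_pmf lambda) ->
  centered_sqr P (fun w => (V w)%:R - (V' w)%:R).
Proof.
move=> mV mV' VP VP'.
have [s1 i1] := poisson_square_integrable mV VP.
have [s2 i2] := poisson_square_integrable mV' VP'.
split; last first.
  by rewrite RintegralB// ?i1 ?i2 ?subrr//; exact: square_integrable_integrable.
apply: square_integrableD => //; case: s2 => m2 l2; split; first exact: measurable_funN.
by under eq_integral do rewrite sqrrN.
Qed.

End poisson_difference.

Section INAR_facts.
Context d (T : measurableType d) (R : realType) (P : probability T R).
Variables (lambda : R) (alpha : {RV P >-> R}) (X : nat -> {RV P >-> nat}).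
Hypothesis lambda0 : 0 < lambda.
Hypothesis INAR : randomized_INAR1 lambda alpha X.

Lemma INAR_alpha01 w : 0 < alpha w < 1.
Proof. by case: INAR => xi [eps [h _]]. Qed.

Lemma INAR_cond_pmf k : cond_pmf P alpha (X k) (fun a => poisson_pmf (lambda / (1 - a))).
Proof.
case: INAR => xi [eps [h1 [h2 [h3 [h4 [h5 h6]]]]]].
exact: (INAR_marginal lambda0 h1 h2 h3 h4 h5 h6).
Qed.

Let mXR k : measurable_fun setT (fun w => (X k w)%:R : R).
Proof.
have h : measurable_fun setT (fun n : nat => n%:R : R) by [].
by have := measurableT_comp h (measurable_funPT (X k)); exact.
Qed.

Lemma INAR_increment_centered k : centered_sqr P (fun w => (X k.+1 w)%:R - (X k w)%:R).
Proof.
case: INAR => xi [eps [h1 [h2 [h3 [h4 [h5 h6]]]]]].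
have [V [mV VP eP ae]] := INAR_step lambda0 h1 h2 h3 h4 h5 h6 k.
apply: (@centered_sqr_ae _ _ _ _ (fun w => (eps k w)%:R - (V w)%:R)).
- exact: measurable_funB.
- by apply: filterS ae => w ->.
- exact: (poisson_difference_centered lambda0 (measurable_funPT (eps k)) mV eP VP).
Qed.

Lemma INAR_drift_centered k : centered_sqr P (fun w => (X k w)%:R - (X 0 w)%:R).
Proof.
have -> : (fun w => (X k w)%:R - (X 0 w)%:R : R) =
    (fun w => \sum_(0 <= i < k) ((X i.+1 w)%:R - (X i w)%:R)).
  by apply/funext => w; rewrite (telescope_sumr (fun i => (X i w)%:R : R)).
by apply: centered_sqr_sum => i; exact: INAR_increment_centered.
Qed.

End INAR_facts.

Section functionals_of_copies.
Context (R : realType) d0 (T0 : measurableType d0) (P0 : probability T0 R)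
  (alpha0 : {RV P0 >-> R}) (X0 : nat -> {RV P0 >-> nat})
  d (T : measurableType d) (P : probability T R)
  (alpha : nat -> {RV P >-> R}) (X : nat -> nat -> {RV P >-> nat}).
Hypothesis copies : independent_copies alpha0 X0 alpha X.

Definition path_generator : set (set (R * (nat -> nat))) :=
  [set C | exists2 B : set R, measurable B & C = [set x | B x.1]] `|`
  [set C | exists (k : nat) (B : set nat), C = [set x | B (x.2 k)]].

Definition path_space := g_sigma_algebraType path_generator.

Lemma measurable_path_fst : measurable_fun setT (fun p : path_space => p.1).
Proof.
move=> _ B mB; rewrite setTI; apply: sub_sigma_algebra; left; exists B => //.
Qed.

Lemma measurable_path_snd k : measurable_fun setT (fun p : path_space => p.2 k).
Proof.
by move=> _ B mB; rewrite setTI; apply: sub_sigma_algebra; right; exists k, B.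
Qed.

Lemma measurable_pair_path d' (T' : measurableType d') (P' : probability T' R)
    (a : {RV P' >-> R}) (x : nat -> {RV P' >-> nat}) :
  measurable_fun setT (pair_path a x : T' -> path_space).
Proof.
apply: (@measurability _ _ T' path_space setT (pair_path a x) path_generator erefl) => _ [C [[B mB ->]|[k [B ->]]] <-]; rewrite setTI.
  exact: (measurable_funPTI a mB).
exact: (@measurable_funPTI _ _ _ _ (x k) B).
Qed.

Variable F : path_space -> R.
Hypothesis mF : measurable_fun setT F.

Let cyl B : measurable B -> cylinder_sigma (F @^-1` B).
Proof. by move=> mB; have := mF measurableT mB; rewrite setTI. Qed.

Lemma measurable_functional j : measurable_fun setT (fun w => F (pair_path (alpha j) (X j) w)).
Proof. by have := measurableT_comp mF (measurable_pair_path (alpha j) (X j)); exact. Qed.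

Lemma measurable_functional0 : measurable_fun setT (fun w => F (pair_path alpha0 X0 w)).
Proof. by have := measurableT_comp mF (measurable_pair_path alpha0 X0); exact. Qed.

Lemma functional_same_law j B : measurable B ->
  P ((fun w => F (pair_path (alpha j) (X j) w)) @^-1` B) =
  P0 ((fun w => F (pair_path alpha0 X0 w)) @^-1` B).
Proof. by move=> mB; have [h _] := copies; exact: (h j _ (cyl mB)). Qed.

Lemma functional_independent :
  mutually_independent P (fun j w => F (pair_path (alpha j) (X j) w)).
Proof.
move=> s B us mB; have [_ h] := copies.
exact: (h s (fun j => F @^-1` B j) us (fun j => cyl (mB j))).
Qed.

End functionals_of_copies.

Section conditional_mean_unique.
Context d (T : measurableType d) (R : realType) (P : probability T R).

Lemma null_of_integral0 (A : set T) (h : T -> R) : measurable A -> measurable_fun setT h ->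
  (forall w, A w -> 0 < h w) -> (\int[P]_(w in A) (h w)%:E <= 0)%E -> P A = 0.
Proof.
move=> mA mh h0 ih.
have ih0 : (\int[P]_(w in A) `|(h w)%:E| = 0)%E.
  rewrite (eq_integral (fun w => (h w)%:E)) => [|w]; last first.
    by rewrite inE => Aw /=; rewrite ger0_norm// ltW// h0.
  by apply/eqP; rewrite eq_le ih/= integral_ge0// => w Aw; rewrite lee_fin ltW// h0.
have mhA : measurable_fun A (EFin \o h) by exact/measurable_EFinP/measurable_funTS.
have [N [mN N0 AN]] := (ae_eq_integral_abs P mA mhA).1 ih0.
apply/eqP; rewrite -measure_le0 -N0; apply: le_measure; rewrite ?inE// => w Aw.
apply: AN => /= /(_ Aw) []; apply/eqP; rewrite gt_eqF//; exact: h0.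
Qed.

Lemma null_of_lt (A : set T) (f g : T -> R) : measurable A ->
  measurable_fun setT f -> measurable_fun setT g ->
  (forall w, A w -> 0 <= f w < g w) ->
  (\int[P]_(w in A) (f w)%:E = \int[P]_(w in A) (g w)%:E)%E ->
  (\int[P]_(w in A) (f w)%:E < +oo)%E -> P A = 0.
Proof.
move=> mA mf mg fg e fin.
apply: (@null_of_integral0 A (fun w => g w - f w)) => //.
- exact: measurable_funB.
- by move=> w Aw; have /andP[_] := fg w Aw; rewrite subr_gt0.
have e2 : (\int[P]_(w in A) (g w)%:E =
    \int[P]_(w in A) (g w - f w)%:E + \int[P]_(w in A) (f w)%:E)%E.
  rewrite -ge0_integralD//.
  - by apply: eq_integral => w _; rewrite -EFinD subrK.
  - by move=> w Aw; have /andP[_ h] := fg w Aw; rewrite lee_fin subr_ge0 ltW.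
  - by apply/measurable_EFinP/measurable_funTS; exact: measurable_funB.
  - by move=> w Aw; have /andP[h _] := fg w Aw; rewrite lee_fin.
  - exact/measurable_EFinP/measurable_funTS.
have f0 : (0 <= \int[P]_(w in A) (f w)%:E)%E.
  by apply: integral_ge0 => w Aw; have /andP[h _] := fg w Aw; rewrite lee_fin.
have ffin : (\int[P]_(w in A) (f w)%:E)%E \is a fin_num by rewrite ge0_fin_numE.
move: e ffin; rewrite e2; case: (\int[P]_(w in A) (f w)%:E)%E => // r e _.
move: e; case: (\int[P]_(w in A) (g w - f w)%:E)%E => // s [] /eqP.
by rewrite -subr_eq subrr lee_fin => /eqP <-.
Qed.

(** On the sigma-algebra of alpha the two versions are compared on events where
    the reference version is bounded, since neither need be integrable. *)
Lemma cond_expectation_unique (alpha Y m : T -> R) (v : R -> R) :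
  measurable_fun setT alpha -> measurable_fun setT v -> (forall a, 0 <= v a) ->
  cond_expectation P alpha Y m -> (forall w, 0 <= Y w) ->
  (forall B, measurable B -> (\int[P]_(w in alpha @^-1` B) (Y w)%:E =
     \int[P]_(w in alpha @^-1` B) (v (alpha w))%:E)%E) ->
  measurable_fun setT m /\ {ae P, forall w, m w = v (alpha w)}.
Proof.
move=> malpha mv v0 [msm hm] Y0 hv.
have subT A : g_sigma_algebra_preimage alpha A -> measurable A.
  by move=> [B mB <-]; exact: malpha.
have mm : measurable_fun setT m.
  by move=> _ B mB; apply: subT; exact: (msm measurableT B mB).
have mva : measurable_fun setT (fun w => v (alpha w)).
  by have := measurableT_comp mv malpha; exact.
split => //.
pose S := g_sigma_algebra_preimageType alpha.
have sv : measurable_fun setT (fun w : S => v (alpha w)).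
  have sa : measurable_fun setT (alpha : S -> R) by move=> _ B mB; exists B.
  by have := measurableT_comp mv sa; exact.
have key A : measurable (A : set S) -> (\int[P]_(w in A) (m w)%:E = \int[P]_(w in A) (v (alpha w))%:E)%E.
  by move=> sA; rewrite -hm//; case: sA => B mB <-; rewrite setTI; exact: hv.
have Slt (f g : S -> R) : measurable_fun setT f -> measurable_fun setT g ->
    measurable ([set w | f w < g w] : set S).
  move=> mf mg; have := measurable_fun_ltr mf mg measurableT (Y := [set true]).
  by rewrite setTI; apply.
pose A1 : set S := [set w | m w < 0].
have sA1 : measurable A1 by apply: Slt => //; exact: measurable_cst.
pose A2 n : set S := [set w | m w < v (alpha w)] `&` ~` A1 `&` [set w | v (alpha w) < n%:R].
have sA2 n : measurable (A2 n).
  apply: measurableI; last by apply: Slt => //; exact: measurable_cst.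
  by apply: measurableI; [exact: Slt|exact: measurableC].
pose A3 n : set S := [set w | v (alpha w) < m w] `&` [set w | v (alpha w) < n%:R].
have sA3 n : measurable (A3 n).
  by apply: measurableI; [exact: Slt|apply: Slt => //; exact: measurable_cst].
have fin (A : set T) n : measurable A -> (forall w, A w -> v (alpha w) < n%:R) ->
    (\int[P]_(w in A) (v (alpha w))%:E < +oo)%E.
  move=> mA hA; apply: (@le_lt_trans _ _ (\int[P]_(w in A) (n%:R)%:E)%E).
    apply: ge0_le_integral => //.
    - by move=> w _; rewrite lee_fin.
    - exact/measurable_EFinP/measurable_funTS.
    - by move=> w Aw; rewrite lee_fin ltW// hA.
  rewrite integral_cst// lte_mul_pinfty// ?lee_fin//.
  by rewrite (le_lt_trans (probability_le1 P mA))// ltry.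
have null1 : P A1 = 0.
  apply: (@null_of_integral0 A1 (fun w => - m w)) => //.
  - exact: subT.
  - exact: measurable_funN.
  - by move=> w; rewrite /A1/= oppr_gt0.
  have h : (0 <= \int[P]_(w in A1) (m w)%:E)%E.
    by rewrite key//; apply: integral_ge0 => w _; rewrite lee_fin.
  move: h; rewrite integralE [X in (X - _)%E](_ : _ = 0%E) ?add0e ?oppe_ge0; last first.
    apply: integral0_eq => w A1w; rewrite funeposE; apply/max_idPr.
    by rewrite lee_fin ltW.
  rewrite (eq_integral (fun w => (- m w)%:E))// => w; rewrite inE => A1w.
  by rewrite funenegE; apply/max_idPl; rewrite -EFinN lee_fin oppr_ge0 ltW.
have null2 n : P (A2 n) = 0.
  apply: (@null_of_lt (A2 n) m (fun w => v (alpha w))) => //.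
  - exact: (subT _ (sA2 n)).
  - by move=> w [[/= h1 h2] _]; rewrite h1 andbT leNgt; apply/negP; exact: h2.
  - exact: key.
  - by rewrite key//; apply: (fin _ n) => [|w []//]; exact: (subT _ (sA2 n)).
have null3 n : P (A3 n) = 0.
  apply: (@null_of_lt (A3 n) (fun w => v (alpha w)) m) => //.
  - exact: (subT _ (sA3 n)).
  - by move=> w [/= h1 _]; rewrite h1 v0.
  - by rewrite key.
  - by apply: (fin _ n) => [|w []//]; exact: (subT _ (sA3 n)).
have N1 : P.-negligible A1 by apply/negligibleP => //; exact: subT.
have N2 : P.-negligible (\bigcup_n A2 n).
  by apply: negligible_bigcup => n; apply/negligibleP; [exact: (subT _ (sA2 n))|exact: null2].
have N3 : P.-negligible (\bigcup_n A3 n).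
  by apply: negligible_bigcup => n; apply/negligibleP; [exact: (subT _ (sA3 n))|exact: null3].
apply: negligibleS (negligibleU N1 (negligibleU N2 N3)) => w /= /eqP.
have vn : v (alpha w) < (Num.truncn (v (alpha w))).+1%:R by exact: truncnS_gt.
have [m0|m0] := ltP (m w) 0; first by left.
rewrite neq_lt => /orP[h|h]; right; [left|right].
  by exists (Num.truncn (v (alpha w))).+1 => //; split => //; split => //; apply/negP; rewrite -leNgt.
by exists (Num.truncn (v (alpha w))).+1.
Qed.

End conditional_mean_unique.

Section copies_of_INAR.
Context (R : realType) (lambda : R) d0 (T0 : measurableType d0) (P0 : probability T0 R)
  (alpha0 : {RV P0 >-> R}) (X0 : nat -> {RV P0 >-> nat})
  d (T : measurableType d) (P : probability T R)
  (alpha : nat -> {RV P >-> R}) (X : nat -> nat -> {RV P >-> nat})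
  (M : nat -> nat -> T -> R).
Hypothesis lambda0 : 0 < lambda.
Hypothesis INAR : randomized_INAR1 lambda alpha0 X0.
Hypothesis copies : independent_copies alpha0 X0 alpha X.
Hypothesis M_cond : forall j k,
  cond_expectation P (alpha j) (fun w => (X j k w)%:R) (M j k).

(** The conditional mean, made nonnegative outside the range of alpha: the copies
    of alpha need to lie in the unit interval only almost surely. *)
Definition stationary_mean (a : R) : R := if a < 1 then lambda / (1 - a) else 0.

Let v := stationary_mean.

Lemma stationary_mean_ge0 a : 0 <= stationary_mean a.
Proof.
by rewrite /stationary_mean; case: ifPn => // a1; rewrite divr_ge0 ?(ltW lambda0)// subr_ge0 ltW.
Qed.

Lemma measurable_stationary_mean : measurable_fun setT stationary_mean.
Proof.
apply: measurable_fun_ifT => //.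
- by apply: measurable_fun_ltr.
- apply: measurable_funM => //.
  have h : measurable_fun setT (fun a : R => 1 - a) by apply: measurable_funB.
  by have := measurableT_comp (@measurable_inv R) h; exact.
Qed.

Let mnatr : measurable_fun setT (fun n : nat => n%:R : R).
Proof. by []. Qed.

Let path_snd k : measurable_fun setT (fun p : path_space R => (p.2 k)%:R : R).
Proof. by have := measurableT_comp mnatr (@measurable_path_snd R k); exact. Qed.

Let path_v : measurable_fun setT (fun p : path_space R => v p.1).
Proof. by have := measurableT_comp measurable_stationary_mean (@measurable_path_fst R); exact. Qed.

Lemma copy_conditional_mean j k B : measurable B ->
  (\int[P]_(w in alpha j @^-1` B) (X j k w)%:R%:E =
   \int[P]_(w in alpha j @^-1` B) (v (alpha j w))%:E)%E.
Proof.
move=> mB.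
have e (g : T -> R) : (\int[P]_(w in alpha j @^-1` B) (g w)%:E = \int[P]_w (\1_B (alpha j w) * g w)%:E)%E.
  rewrite integral_mkcond; apply: eq_integral => w _; rewrite patchE indicE.
  by rewrite -[w \in _]/(alpha j w \in B); case: (_ \in _); rewrite ?mul1r ?mul0r.
have m1 : measurable_fun setT (fun p : path_space R => \1_B p.1 : R).
  have h : measurable_fun setT (\1_B : R -> R) by exact: measurable_indic.
  by have := measurableT_comp h (@measurable_path_fst R); exact.
have mEFin : measurable_fun setT (@EFin R) by exact/measurable_EFinP.
have mF1 : measurable_fun setT (fun p : path_space R => \1_B p.1 * (p.2 k)%:R : R) by exact: measurable_funM.
have mF2 : measurable_fun setT (fun p : path_space R => \1_B p.1 * v p.1 : R) by exact: measurable_funM.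
have t1 := same_law_integral (measurable_functional alpha X mF1 j) (measurable_functional0 alpha0 X0 mF1)
  (functional_same_law copies mF1 j) mEFin.
have t2 := same_law_integral (measurable_functional alpha X mF2 j) (measurable_functional0 alpha0 X0 mF2)
  (functional_same_law copies mF2 j) mEFin.
rewrite !e; apply: (eq_trans t1); apply/esym; apply: (eq_trans t2); apply/esym.
have h1 m : measurable_fun setT (fun a : R => \1_B a * m%:R : R).
  by apply: measurable_funM => //; exact: measurable_indic.
have i0 (a : R) : 0 <= \1_B a :> R by rewrite indicE ler0n.
rewrite (cond_pmf_expectation (measurable_funPT alpha0) (measurable_funPT (X0 k)) _ _
  (INAR_cond_pmf lambda0 INAR k) h1)//; last 2 first.
- move=> m; have h : measurable_fun setT (fun a : R => lambda / (1 - a)).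
    apply: measurable_funM => //.
    have h : measurable_fun setT (fun a : R => 1 - a) by apply: measurable_funB.
    by have := measurableT_comp (@measurable_inv R) h; exact.
  by have := measurableT_comp (@measurable_poisson_pmf R setT m measurableT) h; exact.
- by move=> a m; exact: poisson_pmf_ge0.
apply: eq_integral => w _.
have /andP[_ a1] := INAR_alpha01 INAR w.
have mu0 : 0 < lambda / (1 - alpha0 w) by rewrite divr_gt0// subr_gt0.
under eq_eseriesr => m _ do rewrite mulrCA EFinM.
rewrite nneseriesZl; last by move=> m _; rewrite lee_fin mulr_ge0// poisson_pmf_ge0.
by rewrite poisson_mean// -EFinM /v /stationary_mean /= a1.
Qed.

Lemma copy_mean_version j k : measurable_fun setT (M j k) /\
  {ae P, forall w, M j k w = v (alpha j w)}.
Proof.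
apply: (cond_expectation_unique _ _ _ (M_cond j k)).
- exact: measurable_funPT.
- exact: measurable_stationary_mean.
- exact: stationary_mean_ge0.
- by move=> w; rewrite ler0n.
- by move=> B mB; exact: copy_conditional_mean.
Qed.

Definition initial_excess (p : path_space R) : R := (p.2 0)%:R - stationary_mean p.1.

Definition total_drift K (p : path_space R) : R :=
  \sum_(1 <= k < K.+1) ((p.2 k)%:R - (p.2 0)%:R).

Lemma measurable_initial_excess : measurable_fun setT initial_excess.
Proof. exact: measurable_funB. Qed.

Lemma measurable_total_drift K : measurable_fun setT (total_drift K).
Proof.
rewrite /total_drift; apply: measurable_sum => k; exact: measurable_funB.
Qed.

Lemma total_drift_centered K : centered_sqr P0 (fun w => total_drift K (pair_path alpha0 X0 w)).
Proof. by apply: centered_sqr_sum => k; exact: (INAR_drift_centered lambda0 INAR k). Qed.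

(** Up to a null set, the aggregated sum splits into K identical contributions of
    the initial excess and a square integrable centered remainder. *)
Lemma aggregated_sum_split n N t : {ae P, forall w,
  aggregated_sum X M n N t w =
  (Num.truncn (n%:R * t))%:R * \sum_(j < N) initial_excess (pair_path (alpha j) (X j) w) +
  \sum_(j < N) total_drift (Num.truncn (n%:R * t)) (pair_path (alpha j) (X j) w)}.
Proof.
set K := Num.truncn _.
have : {ae P, forall w, forall j k, M j k w = v (alpha j w)}.
  have h : P.-negligible (\bigcup_j \bigcup_k ~` [set w | M j k w = v (alpha j w)]).
    apply: negligible_bigcup => j; apply: negligible_bigcup => k.
    by have [_] := copy_mean_version j k.
  apply: negligibleS h => w /= /existsNP[j /existsNP[k hjk]].
  by exists j => //; exists k.
apply: filterS => w h; rewrite /aggregated_sum -/K mulr_sumr -big_split/=.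
apply: eq_bigr => j _; rewrite /total_drift /initial_excess.
have -> : K%:R * ((X j 0 w)%:R - v (alpha j w)) = \sum_(1 <= k < K.+1) ((X j 0 w)%:R - v (alpha j w)).
  by rewrite big_const_nat iter_addr_0 subSS subn0 mulr_natl.
by rewrite -big_split/=; apply: eq_bigr => k _; rewrite h; ring.
Qed.

End copies_of_INAR.

Lemma cvg_norm_powR0 (R : realType) (c : R) : 0 < c ->
  `|t| `^ c @[t --> (0 : R)] --> (0 : R).
Proof.
move=> c0; apply/cvgr0Pnorm_lt => e e0.
have ec0 : 0 < e `^ c^-1 by rewrite powR_gt0.
have : \forall t \near (0 : R), `|t| < e `^ c^-1.
  by have := @cvg_id _ (nbhs (0 : R)) => /cvgr0Pnorm_lt; apply.
apply: filterS => t ht; rewrite ger0_norm ?powR_ge0//.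
have -> : e = (e `^ c^-1) `^ c by rewrite -powRrM mulVf ?gt_eqF// powRr1// ltW.
by apply: gt0_ltr_powR => //; rewrite nnegrE// ltW.
Qed.

(** The truncated time points of the discrete skeleton approach the true ones. *)
Lemma cvg_truncn_ratio (R : realType) (t : R) : 0 <= t ->
  (Num.truncn (n%:R * t))%:R / n%:R @[n --> \oo] --> t.
Proof.
move=> t0; apply/cvgrPdist_lt => e e0; near=> n.
have n0 : 0 < n%:R :> R by rewrite ltr0n; near: n; exact: nbhs_infty_gt.
have nt : 0 <= n%:R * t by rewrite mulr_ge0// ltW.
have /andP[h1 h2] := truncn_itv nt.
have -> : t - (Num.truncn (n%:R * t))%:R / n%:R = (n%:R * t - (Num.truncn (n%:R * t))%:R) / n%:R.
  by rewrite mulrBl mulrAC divff ?mul1r// gt_eqF.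
rewrite ger0_norm ?divr_ge0 ?subr_ge0 ?(ltW n0)// ltr_pdivrMr//.
rewrite (@lt_trans _ _ 1)//; first by rewrite ltrBlDl natr1.
rewrite -ltr_pdivrMl// mulr1; near: n; exact: nbhs_infty_gtr.
Unshelve. all: by end_near. Qed.

Theorem theorem4p8 (R : realType) (lambda beta psi1 : R) (psi : R -> R)
  (d0 : measure_display) (T0 : measurableType d0) (P0 : probability T0 R)
  (alpha0 : {RV P0 >-> R}) (X0 : nat -> {RV P0 >-> nat})
  (d : measure_display) (T : measurableType d) (P : probability T R)
  (alpha : nat -> {RV P >-> R}) (X : nat -> nat -> {RV P >-> nat})
  (M : nat -> nat -> T -> R)
  (lambda_gt0 : 0 < lambda)
  (beta_range : -1 < beta < 0)
  (X0_INAR1 : randomized_INAR1 lambda alpha0 X0)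
  (alpha0_density :
    has_density_on alpha0 `]0, 1[ (fun x => psi x * (1 - x) `^ beta))
  (psi1_gt0 : 0 < psi1)
  (psi_lim : psi x @[x --> 1^'-] --> psi1)
  (copies : independent_copies alpha0 X0 alpha X)
  (M_cond_exp : forall j k,
    cond_expectation P (alpha j) (fun w => (X j k w)%:R) (M j k)) :
  exists (dV : measure_display) (TV : measurableType dV) (Q : probability TV R)
    (V : {RV Q >-> R}),
    symmetric_stable (2 * (1 + beta))
      (psi1 * (lambda / 2) `^ (1 + beta) * (Gamma (- beta) / (1 + beta))) V /\
    iterated_fdd_lim P
      (fun n N t w => n%:R^-1 * N%:R `^ (- (1 / (2 * (1 + beta)))) *
                      aggregated_sum X M n N t w)
      Q (fun t w => V w * t).
Proof.
have /andP[b1 b2] := beta_range.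
set b := 1 + beta.
have b01 : 0 < b < 1 by apply/andP; split; rewrite /b; lra.
have /andP[b0 b_1] := b01.
set Kc := psi1 * (lambda / 2) `^ b * (Gamma (- beta) / b).
set p := 1 / (2 * b).
have Kc0 : 0 <= Kc.
  apply: mulr_ge0; first by rewrite mulr_ge0 ?powR_ge0 ?(ltW psi1_gt0).
  apply: divr_ge0; last exact: ltW.
  by apply: Rintegral_ge0 => x _; rewrite mulr_ge0 ?powR_ge0 ?expR_ge0.
pose W j w := initial_excess lambda (pair_path (alpha j) (X j) w).
have mE := measurable_initial_excess lambda.
have mW j : measurable_fun setT (W j) := measurable_functional alpha X mE j.
have indepW : mutually_independent P W := functional_independent copies mE.
have mW0 := measurable_functional0 alpha0 X0 mE.
pose W0 w : R := (X0 0 w)%:R - lambda / (1 - alpha0 w).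
have W0E w : initial_excess lambda (pair_path alpha0 X0 w) = W0 w.
  by have /andP[_ a1] := INAR_alpha01 X0_INAR1 w; rewrite /initial_excess /stationary_mean /= a1.
have lawW j (h : R -> R) : measurable_fun setT h -> \int[P]_w h (W j w) = \int[P0]_w h (W0 w).
  move=> mh; rewrite (same_law_Rintegral (mW j) mW0 (functional_same_law copies mE j) mh).
  by apply: eq_Rintegral => w _; rewrite W0E.
pose sc N : R := N%:R `^ (- p).
have mS N : measurable_fun setT (fun w => sc N * \sum_(j < N) W j w).
  by apply: measurable_funM => //; exact: measurable_sum.
pose S (N : nat) : {RV P >-> R} := RV_of P (mS N).
pose phi (t : R) : R := expR (- (Kc * `|t| `^ (2 * b))).
have tail : forall e, 0 < e -> exists2 r, 0 < r & forall x, 0 < x < r ->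
    `|fine (P0 [set w | 1 - alpha0 w <= x]) - psi1 / b * x `^ b| <= e * x `^ b.
  by move=> e e0; exact: (survival_of_density b1 psi1_gt0 alpha0_density psi_lim e0).
have kappa0 : 0 <= psi1 / b by rewrite divr_ge0// ltW.
have cfS t : \int[P]_w cos (t * S N w) @[N --> \oo] --> phi t /\
    \int[P]_w sin (t * S N w) @[N --> \oo] --> (0 : R).
  have [h1 h2] := centered_cf_scaling lambda_gt0 (INAR_alpha01 X0_INAR1) (measurable_funPT (X0 0))
    (INAR_cond_pmf lambda_gt0 X0_INAR1 0) b01 kappa0 tail t.
  have k0 : 0 <= Kc * `|t| `^ (2 * b) by rewrite mulr_ge0// powR_ge0.
  have mcos c : measurable_fun setT (fun x : R => cos (c * x)).
    by apply: measurable_cos_comp; exact: measurable_funM.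
  have msin c : measurable_fun setT (fun x : R => sin (c * x)).
    by apply: measurable_sin_comp; exact: measurable_funM.
  have [] := @iid_cf_limit _ _ _ P W mW indepW (fun N => t * sc N)
    (fun N => \int[P0]_w cos (t * sc N * W0 w)) (fun N => \int[P0]_w sin (t * sc N * W0 w)) _ k0.
  - by move=> N j; exact: (lawW j _ (mcos (t * sc N))).
  - by move=> N j; exact: (lawW j _ (msin (t * sc N))).
  - have -> : Kc * `|t| `^ (2 * b) = psi1 / b * Gamma (1 - b) * (lambda / 2) `^ b * `|t| `^ (2 * b).
      by rewrite /Kc (_ : 1 - b = - beta); [ring|rewrite /b; ring].
    exact: h1.
  - exact: h2.
  by rewrite /phi => g1 g2; split; [move: g1|move: g2];
    under eq_fun do under eq_Rintegral do rewrite -mulrA.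
have phi0 : phi 0 = 1.
  by rewrite /phi normr0 powR0 ?mulr0 ?oppr0 ?expR0// mulf_neq0// gt_eqF.
have cphi : {for 0, continuous phi}.
  have h : - (Kc * `|t| `^ (2 * b)) @[t --> (0 : R)] --> - (Kc * 0).
    by apply: cvgN; apply: cvgM; [exact: cvg_cst|apply: cvg_norm_powR0; rewrite mulr_gt0].
  have := cvg_comp _ _ h (@continuous_expR R _).
  have -> : expR (- (Kc * 0)) = phi 0 by rewrite phi0 mulr0 oppr0 expR0.
  exact.
have cfS1 t := (cfS t).1; have cfS2 t := (cfS t).2.
have [V hV] := levy_continuity cfS1 cfS2 cphi phi0.
set U := uniform_prob _ in V hV.
have stV : symmetric_stable (2 * b) Kc V.
  move=> theta; rewrite /char_fun; congr Complex.
    have ct : continuous (fun x : R => cos (theta * x)).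
      move=> x; apply: (@continuous_comp R R R (fun x => theta * x) cos); last exact: continuous_cos.
      exact: mulrl_continuous.
    have h : \int[P]_w cos (theta * S N w) @[N --> \oo] --> \int[U]_u cos (theta * V u).
      have bc : exists M : R, forall x : R, `|cos (theta * x)| <= M by exists 1 => x; exact: cos_max.
      exact: (hV _ ct bc).
    exact: (cvg_unique _ h (cfS1 theta)).
  have ct : continuous (fun x : R => sin (theta * x)).
    move=> x; apply: (@continuous_comp R R R (fun x => theta * x) sin); last exact: continuous_sin.
    exact: mulrl_continuous.
  have h : \int[P]_w sin (theta * S N w) @[N --> \oo] --> \int[U]_u sin (theta * V u).
    have bs : exists M : R, forall x : R, `|sin (theta * x)| <= M by exists 1 => x; exact: sin_max.
    exact: (hV _ ct bs).
  exact: (cvg_unique _ h (cfS2 theta)).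
exists _, _, U, V; split => //.
pose K n t := Num.truncn (n%:R * t : R).
have mY n t : measurable_fun setT (fun u => (K n t)%:R / n%:R * V u).
  by apply: measurable_funM.
exists (fun=> _), (fun=> _), (fun=> U), (fun n t => RV_of U (mY n t)); split.
  move=> n n0 m t t0 f cf [B fB].
  pose Z N (i : 'I_m) w := n%:R^-1 * N%:R `^ (- p) * aggregated_sum X M n N (t i) w.
  have mX j k : measurable_fun setT (fun w => (X j k w)%:R : R).
    have h : measurable_fun setT (fun n : nat => n%:R : R) by [].
    by have := measurableT_comp h (measurable_funPT (X j k)); exact.
  have mM j k := (copy_mean_version lambda_gt0 X0_INAR1 copies M_cond_exp j k).1.
  have mZ N i : measurable_fun setT (Z N i).
    apply: measurable_funM => //; apply: measurable_sum => j; apply: measurable_sum => k.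
    exact: measurable_funB.
  pose G k j w := total_drift k (pair_path (alpha j) (X j) w).
  have mG k j : measurable_fun setT (G k j) := measurable_functional alpha X (@measurable_total_drift R k) j.
  pose E (i : 'I_m) N w := n%:R^-1 * sc N * \sum_(j < N) G (K n (t i)) j w.
  have mEE i N : measurable_fun setT (E i N).
    by apply: measurable_funM => //; exact: measurable_sum.
  pose c (i : 'I_m) : R := (K n (t i))%:R / n%:R.
  have ae N : {ae P, forall w, \row_i Z N i w = \row_i (c i * S N w + E i N w) :> 'rV[R]_m}.
    have : {ae P, forall w, forall i, Z N i w = c i * S N w + E i N w}.
      apply: filter_forall => i.
      apply: filterS (aggregated_sum_split lambda_gt0 X0_INAR1 copies M_cond_exp n N (t i)) => w h.
      by rewrite /Z h /c /S /E /= /sc /W /G /K; ring.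
    by apply: filterS => w h; apply/rowP => i; rewrite !mxE h.
  have bZ N : bounded_measurable (fun w => f (\row_i Z N i w)).
    by split; [exact: measurable_row_continuous|exists B].
  have bSE N : bounded_measurable (fun w => f (\row_i (c i * S N w + E i N w))).
    split; last by exists B.
    by apply: measurable_row_continuous => // i; apply: measurable_funD => //; exact: measurable_funM.
  have eZ N : \int[P]_w f (\row_i Z N i w) = \int[P]_w f (\row_i (c i * S N w + E i N w)).
    rewrite /Rintegral; congr fine; apply: ae_eq_integral => //.
    - by apply/measurable_EFinP; case: (bZ N).
    - by apply/measurable_EFinP; case: (bSE N).
    - by apply: filterS (ae N) => w e _ /=; rewrite e.
  have small i r e : 0 < r -> 0 < e ->
      \forall N \near \oo, (P [set w | (r < `|E i N w|)%R] <= e%:E)%E.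
    have [k k0 hk] := centered_sqr_cf (total_drift_centered lambda_gt0 X0_INAR1 (K n (t i))).
    have mF := @measurable_total_drift R (K n (t i)).
    have lawG j (h : R -> R) : measurable_fun setT h -> \int[P]_w h (G (K n (t i)) j w) =
        \int[P0]_w h (total_drift (K n (t i)) (pair_path alpha0 X0 w)).
      exact: (same_law_Rintegral (mG _ j) (measurable_functional0 alpha0 X0 mF) (functional_same_law copies mF j)).
    apply: (iid_centered_negligible (mG (K n (t i))) (functional_independent copies mF) _ _ k0 hk).
    - move=> x j; apply: (lawG j (fun y => cos (x * y))).
      by apply: measurable_cos_comp; exact: measurable_funM.
    - move=> x j; apply: (lawG j (fun y => sin (x * y))).
      by apply: measurable_sin_comp; exact: measurable_funM.
    (* the exponent 1 - 1 / b is negative: this is where beta < 0 enters *)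
    have q0 : 0 < 2 * p - 1.
      by rewrite subr_gt0 /p mul1r invfM mulrA divff// mul1r invf_gt1.
    have hq : n%:R^-1 ^+ 2 * N%:R `^ (- (2 * p - 1)) @[N --> \oo] --> n%:R^-1 ^+ 2 * (0 : R).
      by apply: cvgM; [exact: cvg_cst|exact: cvg_natr_powRN].
    move: hq; rewrite mulr0; apply: cvg_trans; apply: near_eq_cvg; near=> N.
    have N0 : N%:R != 0 :> R by rewrite pnatr_eq0 -lt0n; near: N; exact: nbhs_infty_gt.
    have e1 : N%:R `^ (- (2 * p - 1)) = N%:R * sc N ^+ 2.
      have -> : - (2 * p - 1) = 1 + - p * 2 by ring.
      by rewrite powRD ?N0 ?implybT// powRr1// powRrM powR_mulrn// powR_ge0.
    by rewrite e1; ring.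
  have tight e : 0 < e -> exists2 L : R, 0 < L &
      \forall N \near \oo, (P [set w | (L < `|S N w|)%R] <= e%:E)%E.
    exact: tightness cfS1 cphi phi0.
  have sl := slutsky_line c mS mEE cf fB tight small.
  have hVf : \int[P]_w f (\row_i (c i * S N w)) @[N --> \oo] --> \int[U]_u f (\row_i (c i * V u)).
    have cg : continuous (fun x : R => f (\row_i (c i * x))).
      move=> x; apply: (@continuous_comp _ _ _ (fun x : R => \row_i (c i * x)) f).
        exact: continuous_row.
      exact: cf.
    have bg : exists B' : R, forall x : R, `|f (\row_i (c i * x))| <= B' by exists B.
    exact: (hV _ cg bg).
  have lim : \int[P]_w f (\row_i Z N i w) @[N --> \oo] --> \int[U]_u f (\row_i (c i * V u)).
    have h := cvgD sl hVf; rewrite add0r in h.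
    under eq_fun do rewrite eZ.
    rewrite (_ : (fun N => _) = (fun N => \int[P]_w f (\row_i (c i * S N w + E i N w)) -
        \int[P]_w f (\row_i (c i * S N w)) + \int[P]_w f (\row_i (c i * S N w)))); first exact: h.
    by apply/funext => N; rewrite subrK.
  have bY : bounded_measurable (fun u => f (\row_i (c i * V u))).
    split; last by exists B.
    by apply: measurable_row_continuous => // i; exact: measurable_funM.
  rewrite expectation_Rintegral; last exact: bounded_measurable_integrable.
  rewrite (_ : (fun N => _) = fun N => (\int[P]_w f (\row_i Z N i w))%:E).
    by apply: cvg_EFin => //; exact: nearW.
  by apply/funext => N; exact: (expectation_Rintegral (bounded_measurable_integrable P (bZ N))).
move=> m t t0 f cf [B fB].
have bY n : bounded_measurable (fun u => f (\row_i ((K n (t i))%:R / n%:R * V u))).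
  split; last by exists B.
  by apply: measurable_row_continuous => // i; exact: measurable_funM.
have bL : bounded_measurable (fun u => f (\row_i (V u * t i))).
  split; last by exists B.
  by apply: measurable_row_continuous => // i; exact: measurable_funM.
have lim : \int[U]_u f (\row_i ((K n (t i))%:R / n%:R * V u)) @[n --> \oo] --> \int[U]_u f (\row_i (V u * t i)).
  apply: (@bounded_cvg _ _ _ U _ _ B) => //.
  - by move=> n; case: (bY n).
  - by case: bL.
  apply: aeW => u.
  suff h : \row_i ((K n (t i))%:R / n%:R * V u) @[n --> \oo] --> \row_i (V u * t i).
    by have := cvg_comp _ _ h (cf _); exact.
  apply: cvg_row => i; rewrite mulrC; apply: cvgM; last exact: cvg_cst.
  exact: cvg_truncn_ratio.
rewrite expectation_Rintegral; last exact: bounded_measurable_integrable.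
rewrite (_ : (fun n => _) = fun n => (\int[U]_u f (\row_i ((K n (t i))%:R / n%:R * V u)))%:E).
  by apply: cvg_EFin => //; exact: nearW.
by apply/funext => n; exact: (expectation_Rintegral (bounded_measurable_integrable U (bY n))).
Unshelve. all: by end_near. Qed.
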